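(* For all $\beta>0$, $\lambda\in\mathbb R$, $h\in\mathbb R$, the limit $\lim_{N\to\infty}A_N(\beta,\lambda,h)$ exists and $$\lim_{N\to\infty}A_N(\beta,\lambda,h)=\sup_{N\ge1}A_N(\beta,\lambda,h).$$
   Context: For $N\ge 1$, $\beta>0$, $\lambda\in\mathbb{R}$, $h\in\mathbb{R}$, let $J=(J_{ij})_{i,j=1}^N$ be $N^2$ i.i.d. standard Gaussian $\mathcal N(0,1)$ random variables (one for each ordered pair $(i,j)$, diagonal pairs included). $\mathbb E_z$ denotes integration with respect to the standard Gaussian measure $(2\pi)^{-N/2}e^{-\|z\|^2/2}dz$ on $\mathbb R^N$, and $\mathbb E$ denotes expectation with respect to the disorder. The partition function is $$Z_N(\beta,\lambda,h;J)=\mathbb E_z\exp\Big(\frac{\beta}{\sqrt{2N}}\sum_{i,j=1}^N J_{ij}z_iz_j+\beta h\sum_{i=1}^N z_i-\frac{\beta^2}{4N}\Big(\sum_{i=1}^N z_i^2\Big)^2+\frac{\lambda}{2}\sum_{i=1}^N z_i^2\Big),$$ and the pressure is $A_N(\beta,\lambda,h)=\frac1N\mathbb E\log Z_N(\beta,\lambda,h;J)$. *)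

(* Defs.v *)
From Stdlib Require Import Reals Lra ClassicalEpsilon.
Open Scope R_scope.

Fixpoint sumN (n : nat) (f : nat -> R) : R :=
  match n with
  | O => 0
  | S m => sumN m f + f m
  end.

Definition gauss (x : R) : R := exp (- (x * x) / 2) / sqrt (2 * PI).

Definition improper_integral (f : R -> R) (l : R) : Prop :=
  forall eps : R, 0 < eps -> exists M : R, forall a b : R,
    a <= - M -> M <= b ->
    exists pr : Riemann_integrable f a b, Rabs (RiemannInt pr - l) < eps.

(** One-dimensional Gaussian expectation  E_x g(x) = int g(x) gauss(x) dx
    (value of the improper integral; it exists in all uses below). *)
Definition gint (g : R -> R) : R :=
  epsilon (inhabits 0) (fun l => improper_integral (fun x => g x * gauss x) l).

Definition vcons (x : R) (z : nat -> R) : nat -> R :=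
  fun k => match k with O => x | S k' => z k' end.

Fixpoint gexp (n : nat) (F : (nat -> R) -> R) : R :=
  match n with
  | O => F (fun _ => 0)
  | S m => gint (fun x => gexp m (fun z => F (vcons x z)))
  end.

Definition exponent (N : nat) (beta lam h : R) (J z : nat -> R) : R :=
  beta / sqrt (2 * INR N) *
    sumN N (fun i => sumN N (fun j => J (i * N + j)%nat * z i * z j))
  + beta * h * sumN N (fun i => z i)
  - beta ^ 2 / (4 * INR N) * (sumN N (fun i => z i ^ 2)) ^ 2
  + lam / 2 * sumN N (fun i => z i ^ 2).

Definition Z_N (N : nat) (beta lam h : R) (J : nat -> R) : R :=
  gexp N (fun z => exp (exponent N beta lam h J z)).

Definition A_N (N : nat) (beta lam h : R) : R :=
  / INR N * gexp (N * N) (fun J => ln (Z_N N beta lam h J)).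

(* Main.v *)
Require Import Defs.
From Stdlib Require Import Reals Lra Lia Arith ClassicalEpsilon FunctionalExtensionality.
From Coquelicot Require Import Coquelicot.
Open Scope R_scope.

(** The quartic term is exactly half the variance of the Gaussian field [H(z) = beta / sqrt (2 N) * sum J_ij z_i z_j],
    so [Z_N] integrates a Wick exponential [exp (H - Var H / 2)], and [H] has covariance
    [beta ^ 2 / (2 N) * (z . w) ^ 2].  By Kahane's comparison, a pointwise smaller covariance (up to a constant [c])
    makes [E ln Z] larger (up to [c / 2]).
    - Since [(x + y) ^ 2 / (N1 + N2) <= x ^ 2 / N1 + y ^ 2 / N2], comparing the system of size [N1 + N2] with two
      decoupled systems shows that [N A_N] is superadditive.
    - Since [beta ^ 2 q x <= beta ^ 2 / (2 N) * x ^ 2 + beta ^ 2 q ^ 2 N / 2], comparing with the linear field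
      [beta sqrt q sum J_i z_i] bounds [A_N] for every [lam], once [beta ^ 2 q > lam].
    The limit is then the supremum by Fekete's lemma.

    Comparisons are carried out with the coordinates of [z] clamped to [[-r, r]], and [r] is sent to infinity at the
    end.  All Gaussian integrals are handled through linearity and monotonicity of [gexp] on a class of
    locally Lipschitz functions of exponential growth, stable under partial integration, so neither a Fubini theorem
    nor a dominated convergence theorem is needed. *)

(** [gint] takes its value from [epsilon], so an integral carries no information until the improper
    integral is known to exist. The class [nice] is shaped so that existence, linearity and
    monotonicity reproduce themselves each time one coordinate is integrated. Limits inside
    integrals are replaced by explicit errors: a derivative passes under [gexp] once the
    second-order Taylor remainder is at most a [nice] function times [s * s]. Clamping makes the
    Gaussian field a bounded function of [z]. The log-partition function is then Lipschitz in the
    disorder, and the remainders along the interpolation are controlled by exponentials of a linear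
    function of the norm of [J], which belong to the class. Since the clamp acts on each coordinate
    separately, the covariances are the original ones evaluated at clamped points, and both
    covariance inequalities survive unchanged. *)

Lemma sqr_Rabs x : x * x = Rabs x * Rabs x.
Proof. rewrite <- Rabs_mult. symmetry. apply Rabs_pos_eq, Rle_0_sqr. Qed.

Lemma between_dist x s c : Rmin x (x + s) <= c <= Rmax x (x + s) -> Rabs (c - x) <= Rabs s.
Proof.
  intros Hc. unfold Rmin, Rmax in Hc. destruct (Rle_dec x (x + s)).
  - rewrite !Rabs_pos_eq; lra.
  - rewrite !Rabs_left1; lra.
Qed.

(** * Inequalities for the exponential *)

Lemma exp_mono x y : x <= y -> exp x <= exp y.
Proof. intros [H|H]; [left; now apply exp_increasing|right; now rewrite H]. Qed.

Lemma exp_ge_1 x : 0 <= x -> 1 <= exp x.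
Proof. intros H. rewrite <- exp_0. now apply exp_mono. Qed.

Lemma exp_lower x : 1 + x <= exp x.
Proof.
  destruct (Req_dec x 0) as [->|H]; [rewrite exp_0; lra|].
  left; now apply exp_ineq1.
Qed.

Lemma exp_le_of_le_lower x y : x <= 1 + y -> x <= exp y.
Proof. intros H; pose proof (exp_lower y); lra. Qed.

(** The extra [1] in the exponent pays for the factor 2, since [exp 1 >= 2]. This lets sums of
    growth bounds be absorbed into a single exponential. *)
Lemma exp_plus_le a b : 0 <= a -> 0 <= b -> exp a + exp b <= exp (1 + a + b).
Proof.
  intros Ha Hb.
  replace (1 + a + b) with (1 + (a + b)) by ring. rewrite exp_plus.
  assert (exp a <= exp (a + b)) by (apply exp_mono; lra).
  assert (exp b <= exp (a + b)) by (apply exp_mono; lra).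
  pose proof (exp_lower 1). pose proof (exp_pos (a + b)). nra.
Qed.

Lemma exp_lipschitz_le c x y : x <= c -> y <= c -> Rabs (exp x - exp y) <= exp c * Rabs (x - y).
Proof.
  assert (W : forall x y, x <= y -> y <= c -> Rabs (exp x - exp y) <= exp c * Rabs (x - y)).
  { clear x y. intros x y Hxy Hy.
    rewrite Rabs_left1 by (pose proof (exp_mono x y Hxy); lra).
    rewrite Rabs_left1 by lra.
    assert (exp x = exp y * exp (x - y)) by (rewrite <- exp_plus; f_equal; ring).
    pose proof (exp_lower (x - y)). pose proof (exp_mono y c Hy). pose proof (exp_pos y).
    nra. }
  intros Hx Hy. destruct (Rle_dec x y).
  - now apply W.
  - rewrite Rabs_minus_sym, (Rabs_minus_sym x). apply W; lra.
Qed.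

Lemma Rabs_exp_sub_1 x d : Rabs x <= d -> Rabs (exp x - 1) <= exp d - 1.
Proof.
  intros H. apply Rabs_le_between in H.
  pose proof (exp_mono x d ltac:(lra)). pose proof (exp_mono (- d) x ltac:(lra)).
  assert (exp d * exp (- d) = 1) by (rewrite <- exp_plus, <- exp_0; f_equal; ring).
  pose proof (exp_pos d). pose proof (exp_pos (- d)).
  apply Rabs_le. split; nra.
Qed.

(** * Finite sums *)

Lemma sumN_ext n f g : (forall i, (i < n)%nat -> f i = g i) -> sumN n f = sumN n g.
Proof.
  induction n; intros H; simpl; auto. rewrite IHn, H; auto.
Qed.

Lemma sumN_plus n f g : sumN n (fun i => f i + g i) = sumN n f + sumN n g.
Proof. induction n; simpl; [ring|]. rewrite IHn; ring. Qed.

Lemma sumN_minus n f g : sumN n (fun i => f i - g i) = sumN n f - sumN n g.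
Proof. induction n; simpl; [ring|]. rewrite IHn; ring. Qed.

Lemma sumN_scal n c f : sumN n (fun i => c * f i) = c * sumN n f.
Proof. induction n; simpl; [ring|]. rewrite IHn; ring. Qed.

Lemma sumN_const n c : sumN n (fun _ => c) = INR n * c.
Proof. induction n; [simpl; ring|]. rewrite S_INR. simpl sumN. rewrite IHn; ring. Qed.

Lemma sumN_zero n f : (forall i, (i < n)%nat -> f i = 0) -> sumN n f = 0.
Proof. intros H. rewrite (sumN_ext n f (fun _ => 0)) by auto. rewrite sumN_const; ring. Qed.

Lemma sumN_le n f g : (forall i, (i < n)%nat -> f i <= g i) -> sumN n f <= sumN n g.
Proof.
  induction n; intros H; simpl; [lra|].
  apply Rplus_le_compat; auto.
Qed.

Lemma sumN_nonneg n f : (forall i, (i < n)%nat -> 0 <= f i) -> 0 <= sumN n f.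
Proof. intros H. rewrite <- (sumN_zero n (fun _ => 0)) by auto. now apply sumN_le. Qed.

Lemma sumN_abs n f : Rabs (sumN n f) <= sumN n (fun i => Rabs (f i)).
Proof.
  induction n; simpl; [rewrite Rabs_R0; lra|].
  eapply Rle_trans; [apply Rabs_triang|lra].
Qed.

Lemma sumN_add n m f : sumN (n + m) f = sumN n f + sumN m (fun k => f (n + k)%nat).
Proof.
  induction m; simpl.
  - rewrite Nat.add_0_r; ring.
  - rewrite Nat.add_succ_r; simpl. rewrite IHm; ring.
Qed.

Lemma sumN_S_first n f : sumN (S n) f = f O + sumN n (fun k => f (S k)).
Proof. replace (S n) with (1 + n)%nat by lia. rewrite sumN_add; simpl. ring. Qed.

Lemma sumN_mul n m f : sumN (n * m) f = sumN n (fun i => sumN m (fun j => f (i * m + j)%nat)).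
Proof.
  induction n; simpl; auto.
  rewrite Nat.add_comm, sumN_add, IHn. reflexivity.
Qed.

Lemma sumN_term_le n f i : (i < n)%nat -> (forall j, (j < n)%nat -> 0 <= f j) -> f i <= sumN n f.
Proof.
  induction n; intros Hi Hf; [lia|]. simpl.
  assert (0 <= sumN n f) by (apply sumN_nonneg; auto).
  destruct (Nat.eq_dec i n) as [->|]; [lra|].
  assert (f i <= sumN n f) by (apply IHn; auto; lia).
  assert (0 <= f n) by auto. lra.
Qed.

(** * One-dimensional Gaussian integrals *)

(** One estimate encodes both continuity and exponential growth, enough for a convergent Gaussian
    integral. Unlike plain continuity it is quantitative, so it passes to partial integrals by
    monotonicity alone. *)
Definition lipexp (g : R -> R) : Prop :=
  exists K, forall x y, Rabs (g x - g y) <= exp (K * (1 + Rabs x + Rabs y)) * Rabs (x - y).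

Lemma gauss_pos x : 0 < gauss x.
Proof.
  unfold gauss. apply Rdiv_lt_0_compat; [apply exp_pos|].
  apply sqrt_lt_R0. pose proof PI_RGT_0; lra.
Qed.

Lemma gauss_le_exp x : gauss x <= exp (- (x * x) / 2).
Proof.
  unfold gauss. assert (1 <= sqrt (2 * PI)).
  { rewrite <- sqrt_1. apply sqrt_le_1_alt. pose proof PI_4.
    pose proof PI2_3_2. unfold PI2 in *. lra. }
  pose proof (exp_pos (- (x * x) / 2)).
  apply (Rmult_le_reg_r (sqrt (2 * PI))); [lra|].
  unfold Rdiv at 1. rewrite Rmult_assoc, Rinv_l by lra. nra.
Qed.

Lemma is_derive_gauss x : is_derive gauss x (- x * gauss x).
Proof.
  unfold gauss. auto_derive; auto.
  unfold Rdiv. field. apply Rgt_not_eq, sqrt_lt_R0. pose proof PI_RGT_0; lra.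
Qed.

Lemma continuous_of_derive (f : R -> R) x l : is_derive f x l -> continuous f x.
Proof. intros H. apply (ex_derive_continuous (K := R_AbsRing) (V := R_NormedModule) f x). now exists l. Qed.

Lemma gauss_continuous x : continuous gauss x.
Proof. eapply continuous_of_derive, is_derive_gauss. Qed.

Lemma lipexp_pos g : lipexp g -> exists K, 0 <= K /\
  forall x y, Rabs (g x - g y) <= exp (K * (1 + Rabs x + Rabs y)) * Rabs (x - y).
Proof.
  intros [K H]. exists (Rabs K). split; [apply Rabs_pos|]. intros x y.
  eapply Rle_trans; [apply H|]. apply Rmult_le_compat_r; [apply Rabs_pos|].
  apply exp_mono. pose proof (Rle_abs K). pose proof (Rabs_pos x). pose proof (Rabs_pos y). nra.
Qed.

Lemma lipexp_bound g : lipexp g -> exists K, 0 <= K /\ forall x, Rabs (g x) <= exp (K * (1 + Rabs x)).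
Proof.
  intros Hg. destruct (lipexp_pos g Hg) as [K [HK H]].
  exists (2 + K + Rabs (g 0)). pose proof (Rabs_pos (g 0)). split; [lra|]. intros x.
  specialize (H x 0). rewrite Rabs_R0, Rminus_0_r, Rplus_0_r in H.
  pose proof (Rabs_pos x).
  assert (Rabs (g x) <= Rabs (g x - g 0) + Rabs (g 0)).
  { replace (g x) with ((g x - g 0) + g 0) at 1 by ring. apply Rabs_triang. }
  assert (Rabs x <= exp (Rabs x)) by (apply exp_le_of_le_lower; lra).
  assert (Rabs (g 0) <= exp (Rabs (g 0))) by (apply exp_le_of_le_lower; lra).
  assert (E : Rabs (g x) <= exp (K * (1 + Rabs x) + Rabs x) + exp (Rabs (g 0))).
  { rewrite exp_plus. pose proof (exp_pos (K * (1 + Rabs x))). nra. }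
  eapply Rle_trans; [apply E|]. eapply Rle_trans; [apply exp_plus_le; nra|].
  apply exp_mono. nra.
Qed.

Lemma continuous_of_local_lip (g : R -> R) (C : R) x :
  (forall y, Rabs (y - x) <= 1 -> Rabs (g y - g x) <= C * Rabs (y - x)) -> continuous g x.
Proof.
  intros H. apply continuity_pt_filterlim. intros eps Heps.
  assert (HC : 0 < Rabs C + 1) by (pose proof (Rabs_pos C); lra).
  exists (Rmin 1 (eps / (Rabs C + 1))). split.
  - apply Rmin_pos; [lra|]. now apply Rdiv_lt_0_compat.
  - intros y [_ Hy]. simpl in *. unfold Rdist in *.
    assert (Rabs (y - x) < 1) by (eapply Rlt_le_trans; [apply Hy|apply Rmin_l]).
    assert (Rabs (y - x) < eps / (Rabs C + 1)) by (eapply Rlt_le_trans; [apply Hy|apply Rmin_r]).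
    eapply Rle_lt_trans; [apply H; lra|].
    pose proof (Rle_abs C). pose proof (Rabs_pos (y - x)).
    apply Rle_lt_trans with ((Rabs C + 1) * Rabs (y - x)); [nra|].
    apply (Rmult_lt_compat_l (Rabs C + 1)) in H1; auto.
    replace ((Rabs C + 1) * (eps / (Rabs C + 1))) with eps in H1 by (field; lra). lra.
Qed.

Lemma lipexp_continuous g x : lipexp g -> continuous g x.
Proof.
  intros Hg. destruct (lipexp_pos g Hg) as [K [HK H]].
  apply (continuous_of_local_lip _ (exp (K * (2 + 2 * Rabs x)))). intros y Hy.
  eapply Rle_trans; [apply H|]. apply Rmult_le_compat_r; [apply Rabs_pos|].
  apply exp_mono. assert (Rabs y <= 1 + Rabs x).
  { replace y with ((y - x) + x) by ring. eapply Rle_trans; [apply Rabs_triang|lra]. }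
  nra.
Qed.

Lemma ex_RInt_all (f : R -> R) a b : (forall x, continuous f x) -> ex_RInt f a b.
Proof. intros H. apply (ex_RInt_continuous (V := R_CompleteNormedModule) f). auto. Qed.

Lemma improper_integral_RInt f l : (forall x, continuous f x) ->
  (improper_integral f l <-> forall eps, 0 < eps -> exists M, forall a b, a <= - M -> M <= b ->
     Rabs (RInt f a b - l) < eps).
Proof.
  intros Hc. split; intros H eps He; destruct (H eps He) as [M HM]; exists M; intros a b Ha Hb.
  - destruct (HM a b Ha Hb) as [pr Hpr]. now rewrite (RInt_Reals f a b pr).
  - exists (ex_RInt_Reals_0 _ _ _ (ex_RInt_all f a b Hc)). rewrite <- RInt_Reals. auto.
Qed.

Lemma improper_integral_unique f l l' : (forall x, continuous f x) ->
  improper_integral f l -> improper_integral f l' -> l = l'.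
Proof.
  intros Hc H H'. rewrite improper_integral_RInt in H, H' by auto.
  apply cond_eq. intros eps He.
  destruct (H (eps / 2)) as [M HM]; [lra|]. destruct (H' (eps / 2)) as [M' HM']; [lra|].
  set (m := Rmax M M').
  assert (M <= m) by apply Rmax_l. assert (M' <= m) by apply Rmax_r.
  specialize (HM (- m) m ltac:(lra) ltac:(lra)). specialize (HM' (- m) m ltac:(lra) ltac:(lra)).
  replace (l - l') with ((l - RInt f (- m) m) + (RInt f (- m) m - l')) by ring.
  eapply Rle_lt_trans; [apply Rabs_triang|].
  rewrite (Rabs_minus_sym l). lra.
Qed.

Lemma RInt_exp_decay_right C a b (f : R -> R) : (forall x, continuous f x) ->
  (forall x, Rabs (f x) <= C * exp (- Rabs x)) -> 0 <= a <= b -> Rabs (RInt f a b) <= C * exp (- a).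
Proof.
  intros Hc Hf Hab.
  assert (HC : 0 <= C).
  { specialize (Hf 0). rewrite Rabs_R0, Ropp_0, exp_0 in Hf. pose proof (Rabs_pos (f 0)). lra. }
  assert (HI : is_RInt (fun x => C * exp (- x)) a b (minus (- C * exp (- b)) (- C * exp (- a)))).
  { apply (is_RInt_derive (fun x => - C * exp (- x))).
    - intros x _. auto_derive; auto. ring.
    - intros x _. eapply continuous_of_derive. auto_derive; auto. }
  pose proof (RInt_correct (V := R_CompleteNormedModule) f a b (ex_RInt_all f a b Hc)) as He.
  refine (Rle_trans _ _ _ (norm_RInt_le (V := R_NormedModule) f _ a b _ _ (proj2 Hab) _ He HI) _).
  - intros x Hx. eapply Rle_trans; [apply Hf|]. rewrite (Rabs_pos_eq x) by lra. lra.
  - unfold minus, plus, opp; simpl. pose proof (exp_pos (- b)). nra.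
Qed.

Lemma RInt_exp_decay_left C a b (f : R -> R) : (forall x, continuous f x) ->
  (forall x, Rabs (f x) <= C * exp (- Rabs x)) -> a <= b <= 0 -> Rabs (RInt f a b) <= C * exp b.
Proof.
  intros Hc Hf Hab.
  assert (Hc' : forall x, continuous (fun y => f (- y)) x).
  { intros x. apply (continuous_comp Ropp f); [|apply Hc].
    eapply continuous_of_derive. auto_derive; auto. }
  pose proof (RInt_exp_decay_right C (- b) (- a) (fun y => f (- y)) Hc') as H.
  rewrite Ropp_involutive in H.
  replace (RInt f a b) with (RInt (fun y => f (- y)) (- b) (- a)); [apply H|].
  - intros x. eapply Rle_trans; [apply Hf|]. rewrite Rabs_Ropp; lra.
  - lra.
  - pose proof (RInt_comp_lin f (-1) 0 (- b) (- a)) as E.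
    replace (-1 * - b + 0) with b in E by ring. replace (-1 * - a + 0) with a in E by ring.
    specialize (E (ex_RInt_all f _ _ Hc)).
    rewrite <- (opp_RInt_swap f b a) by (apply ex_RInt_all; auto). rewrite <- E.
    rewrite <- RInt_opp.
    + apply RInt_ext. intros x _. unfold scal, opp; simpl. unfold mult; simpl.
      replace (-1 * x + 0) with (- x) by ring. ring.
    + apply ex_RInt_all. intros x.
      apply (continuous_comp (fun y => -1 * y + 0) (fun y => scal (-1) (f y))).
      * eapply continuous_of_derive. auto_derive; auto.
      * apply (continuous_scal_r (-1) f). apply Hc.
Qed.

Lemma exp_neg_small eps : 0 < eps -> exists M, 0 <= M /\ exp (- M) < eps.
Proof.
  intros He. exists (/ eps). split; [left; now apply Rinv_0_lt_compat|].
  rewrite exp_Ropp.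
  assert (0 < / eps) by now apply Rinv_0_lt_compat.
  pose proof (exp_ineq1 (/ eps) ltac:(lra)).
  rewrite <- (Rinv_inv eps) at 2. apply Rinv_lt_contravar; [|lra].
  apply Rmult_lt_0_compat; [lra|apply exp_pos].
Qed.

Lemma RInt_tail (f : R -> R) C a b M : (forall x, continuous f x) ->
  (forall x, Rabs (f x) <= C * exp (- Rabs x)) -> 0 <= M -> a <= - M -> M <= b ->
  Rabs (RInt f a b - RInt f (- M) M) <= 2 * C * exp (- M).
Proof.
  intros Hc Hf HM Ha Hb.
  assert (E1 : RInt f a (- M) + RInt f (- M) b = RInt f a b)
    by (apply (RInt_Chasles f a (- M) b); apply ex_RInt_all; auto).
  assert (E2 : RInt f (- M) M + RInt f M b = RInt f (- M) b)
    by (apply (RInt_Chasles f (- M) M b); apply ex_RInt_all; auto).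
  rewrite <- E1, <- E2.
  replace (RInt f a (- M) + (RInt f (- M) M + RInt f M b) - RInt f (- M) M)
    with (RInt f a (- M) + RInt f M b) by ring.
  eapply Rle_trans; [apply Rabs_triang|].
  pose proof (RInt_exp_decay_left C a (- M) f Hc Hf ltac:(lra)).
  pose proof (RInt_exp_decay_right C M b f Hc Hf ltac:(lra)). lra.
Qed.

(** The integrals over [[- n, n]] are Cauchy because [RInt_tail] bounds what a larger window adds.
    The same bound compares an arbitrary window with a symmetric one, which handles the two
    independent endpoints in [improper_integral]. *)
Lemma improper_integral_exists (f : R -> R) C : (forall x, continuous f x) ->
  (forall x, Rabs (f x) <= C * exp (- Rabs x)) -> exists l, improper_integral f l.
Proof.
  intros Hc Hf.
  assert (HC : 0 <= C).
  { specialize (Hf 0). rewrite Rabs_R0, Ropp_0, exp_0 in Hf. pose proof (Rabs_pos (f 0)). lra. }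
  assert (Hsm : forall eps, 0 < eps -> exists M, 0 <= M /\ 2 * C * exp (- M) < eps).
  { intros eps He. destruct (exp_neg_small (eps / (2 * C + 1))) as [M [HM Hs]].
    - apply Rdiv_lt_0_compat; lra.
    - exists M. split; auto. pose proof (exp_pos (- M)).
      apply (Rmult_lt_compat_l (2 * C + 1)) in Hs; [|lra].
      replace ((2 * C + 1) * (eps / (2 * C + 1))) with eps in Hs by (field; lra). nra. }
  assert (HCa : Cauchy_crit (fun n => RInt f (- INR n) (INR n))).
  { intros eps He. destruct (Hsm (eps / 2)) as [M [HM Hs]]; [lra|].
    destruct (INR_unbounded M) as [n0 Hn0].
    exists n0. intros n m Hn Hm. unfold Rdist. apply le_INR in Hn, Hm.
    pose proof (RInt_tail f C (- INR n) (INR n) M Hc Hf HM ltac:(lra) ltac:(lra)).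
    pose proof (RInt_tail f C (- INR m) (INR m) M Hc Hf HM ltac:(lra) ltac:(lra)).
    replace (RInt f (- INR n) (INR n) - RInt f (- INR m) (INR m)) with
      ((RInt f (- INR n) (INR n) - RInt f (- M) M) + - (RInt f (- INR m) (INR m) - RInt f (- M) M)) by ring.
    eapply Rle_lt_trans; [apply Rabs_triang|]. rewrite Rabs_Ropp. lra. }
  destruct (Rcomplete.R_complete _ HCa) as [l Hl]. exists l.
  apply improper_integral_RInt; auto. intros eps He.
  destruct (Hsm (eps / 4)) as [M [HM Hs]]; [lra|].
  exists M. intros a b Ha Hb.
  destruct (Hl (eps / 4)) as [n0 Hn0]; [lra|].
  destruct (INR_unbounded M) as [n1 Hn1].
  set (n := Nat.max n0 n1). specialize (Hn0 n (Nat.le_max_l _ _)). unfold Rdist in Hn0.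
  assert (M <= INR n) by (apply Rle_trans with (INR n1); [lra|apply le_INR, Nat.le_max_r]).
  pose proof (RInt_tail f C a b M Hc Hf HM Ha Hb).
  pose proof (RInt_tail f C (- INR n) (INR n) M Hc Hf HM ltac:(lra) ltac:(lra)).
  apply Rabs_def2 in Hn0. apply Rabs_le_between in H0, H1. apply Rabs_def1; lra.
Qed.

Lemma lipexp_gauss_decay g : lipexp g -> exists C, forall x, Rabs (g x * gauss x) <= C * exp (- Rabs x).
Proof.
  intros Hg. destruct (lipexp_bound g Hg) as [K [HK H]].
  (* Completing the square in [Rabs x - (K + 1)]: [K * (1 + Rabs x) - x * x / 2 <= K + (K + 1) * (K
     + 1) / 2 - Rabs x]. *)
  exists (exp (K + (K + 1) * (K + 1) / 2)). intros x.
  rewrite Rabs_mult, (Rabs_pos_eq (gauss x)) by (left; apply gauss_pos).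
  rewrite <- exp_plus.
  apply Rle_trans with (exp (K * (1 + Rabs x)) * exp (- (x * x) / 2)).
  - apply Rmult_le_compat; auto using Rabs_pos, gauss_le_exp. left; apply gauss_pos.
  - rewrite <- exp_plus. apply exp_mono.
    assert (Rabs x * Rabs x = x * x) by (symmetry; apply sqr_Rabs).
    pose proof (Rle_0_sqr (Rabs x - (K + 1))). unfold Rsqr in *. nra.
Qed.

Lemma lipexp_gauss_continuous g x : lipexp g -> continuous (fun y => g y * gauss y) x.
Proof.
  intros Hg. apply (continuous_mult g gauss); [now apply lipexp_continuous|apply gauss_continuous].
Qed.

(** [epsilon] meets its specification only when some value does; the decay of [g x * gauss x]
    supplies one. Every later fact about [gint] rests on this. *)
Lemma gint_correct g : lipexp g -> improper_integral (fun x => g x * gauss x) (gint g).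
Proof.
  intros Hg. unfold gint. apply epsilon_spec.
  destruct (lipexp_gauss_decay g Hg) as [C HC].
  apply (improper_integral_exists _ C); auto. intros x. now apply lipexp_gauss_continuous.
Qed.

Lemma gint_unique g l : lipexp g -> improper_integral (fun x => g x * gauss x) l -> gint g = l.
Proof.
  intros Hg Hl. apply (improper_integral_unique (fun x => g x * gauss x)); auto.
  - intros x. now apply lipexp_gauss_continuous.
  - now apply gint_correct.
Qed.

Lemma lipexp_lin a b f g : lipexp f -> lipexp g -> lipexp (fun x => a * f x + b * g x).
Proof.
  intros Hf Hg. destruct (lipexp_pos f Hf) as [K [HK H]]. destruct (lipexp_pos g Hg) as [L [HL H']].
  exists (1 + Rabs a + Rabs b + K + L). intros x y.
  pose proof (Rabs_pos a). pose proof (Rabs_pos b). pose proof (Rabs_pos x). pose proof (Rabs_pos y).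
  replace (a * f x + b * g x - (a * f y + b * g y)) with (a * (f x - f y) + b * (g x - g y)) by ring.
  eapply Rle_trans; [apply Rabs_triang|]. rewrite !Rabs_mult.
  set (s := 1 + Rabs x + Rabs y) in *.
  assert (Hs : 1 <= s) by (unfold s; lra).
  specialize (H x y). specialize (H' x y). fold s in H, H'.
  pose proof (Rabs_pos (x - y)).
  assert (Rabs a <= exp (Rabs a)) by (apply exp_le_of_le_lower; lra).
  assert (Rabs b <= exp (Rabs b)) by (apply exp_le_of_le_lower; lra).
  pose proof (exp_plus_le (Rabs a + K * s) (Rabs b + L * s) ltac:(nra) ltac:(nra)) as E.
  rewrite !exp_plus in E.
  assert (exp (1 + (Rabs a + K * s) + (Rabs b + L * s)) <= exp ((1 + Rabs a + Rabs b + K + L) * s))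
    by (apply exp_mono; nra).
  rewrite !exp_plus in H7.
  pose proof (exp_pos (K * s)). pose proof (exp_pos (L * s)).
  assert (Rabs a * Rabs (f x - f y) <= (exp (Rabs a) * exp (K * s)) * Rabs (x - y)).
  { rewrite Rmult_assoc. apply Rmult_le_compat; auto using Rabs_pos. }
  assert (Rabs b * Rabs (g x - g y) <= (exp (Rabs b) * exp (L * s)) * Rabs (x - y)).
  { rewrite Rmult_assoc. apply Rmult_le_compat; auto using Rabs_pos. }
  nra.
Qed.

Lemma gint_lin a b f g : lipexp f -> lipexp g ->
  gint (fun x => a * f x + b * g x) = a * gint f + b * gint g.
Proof.
  intros Hf Hg. apply gint_unique; [now apply lipexp_lin|].
  pose proof (gint_correct f Hf) as F. pose proof (gint_correct g Hg) as G.
  assert (Hcf := fun x => lipexp_gauss_continuous f x Hf).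
  assert (Hcg := fun x => lipexp_gauss_continuous g x Hg).
  rewrite improper_integral_RInt in F, G by auto.
  apply improper_integral_RInt.
  { intros x. apply (lipexp_gauss_continuous (fun x => a * f x + b * g x)). now apply lipexp_lin. }
  intros eps He.
  pose proof (Rabs_pos a). pose proof (Rabs_pos b).
  set (e := eps / (Rabs a + Rabs b + 1)).
  assert (He' : 0 < e) by (apply Rdiv_lt_0_compat; lra).
  assert (Ee : (Rabs a + Rabs b + 1) * e = eps) by (unfold e; field; lra).
  destruct (F e He') as [M HM]. destruct (G e He') as [M' HM'].
  exists (Rmax M M'). intros u v Hu Hv.
  pose proof (Rmax_l M M'). pose proof (Rmax_r M M').
  specialize (HM u v ltac:(lra) ltac:(lra)). specialize (HM' u v ltac:(lra) ltac:(lra)).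
  assert (E : RInt (fun x => (a * f x + b * g x) * gauss x) u v =
     a * RInt (fun x => f x * gauss x) u v + b * RInt (fun x => g x * gauss x) u v).
  { pose proof (RInt_scal (fun x => f x * gauss x) u v a (ex_RInt_all _ _ _ Hcf)) as Ef.
    pose proof (RInt_scal (fun x => g x * gauss x) u v b (ex_RInt_all _ _ _ Hcg)) as Eg.
    change (scal a (RInt (fun x => f x * gauss x) u v)) with (a * RInt (fun x => f x * gauss x) u v) in Ef.
    change (scal b (RInt (fun x => g x * gauss x) u v)) with (b * RInt (fun x => g x * gauss x) u v) in Eg.
    rewrite <- Ef, <- Eg.
    refine (eq_trans _ (RInt_plus _ _ u v _ _)).
    - apply RInt_ext. intros x _. unfold plus, scal; simpl. unfold mult; simpl. ring.
    - apply ex_RInt_all. intros x. apply (continuous_scal_r a (fun x => f x * gauss x)); auto.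
    - apply ex_RInt_all. intros x. apply (continuous_scal_r b (fun x => g x * gauss x)); auto. }
  rewrite E.
  match goal with |- Rabs (a * ?p + b * ?q - (a * ?p' + b * ?q')) < _ =>
    replace (a * p + b * q - (a * p' + b * q')) with (a * (p - p') + b * (q - q')) by ring end.
  eapply Rle_lt_trans; [apply Rabs_triang|]. rewrite !Rabs_mult. nra.
Qed.

Lemma gint_le f g : lipexp f -> lipexp g -> (forall x, f x <= g x) -> gint f <= gint g.
Proof.
  intros Hf Hg Hfg.
  pose proof (gint_correct f Hf) as F. pose proof (gint_correct g Hg) as G.
  assert (Hcf := fun x => lipexp_gauss_continuous f x Hf).
  assert (Hcg := fun x => lipexp_gauss_continuous g x Hg).
  rewrite improper_integral_RInt in F, G by auto.
  apply Rnot_lt_le. intros Hlt.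
  destruct (F ((gint f - gint g) / 2)) as [M HM]; [lra|].
  destruct (G ((gint f - gint g) / 2)) as [M' HM']; [lra|].
  set (m := Rmax 0 (Rmax M M')).
  assert (0 <= m) by apply Rmax_l.
  assert (M <= m) by (eapply Rle_trans; [apply Rmax_l|apply Rmax_r]).
  assert (M' <= m) by (eapply Rle_trans; [apply Rmax_r|apply Rmax_r]).
  specialize (HM (- m) m ltac:(lra) ltac:(lra)). specialize (HM' (- m) m ltac:(lra) ltac:(lra)).
  assert (RInt (fun x => f x * gauss x) (- m) m <= RInt (fun x => g x * gauss x) (- m) m).
  { apply RInt_le; [lra|apply ex_RInt_all; auto|apply ex_RInt_all; auto|].
    intros x _. apply Rmult_le_compat_r; auto. left; apply gauss_pos. }
  apply Rabs_def2 in HM, HM'. lra.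
Qed.

Lemma lipexp_const c : lipexp (fun _ => c).
Proof.
  exists 0. intros x y. rewrite Rminus_diag, Rabs_R0.
  apply Rmult_le_pos; [left; apply exp_pos|apply Rabs_pos].
Qed.

Ltac eqR := match goal with |- ?a = ?b => change (@eq R a b) end.

(** Since [gauss] has derivative [- x * gauss x], the function [(g' x - x * g x) * gauss x] has
    primitive [g x * gauss x], and the boundary terms decay exponentially. Its integral is therefore
    0. *)
Lemma gint_ibp g g' : lipexp g -> lipexp g' -> lipexp (fun x => x * g x) ->
  (forall x, is_derive g x (g' x)) -> gint (fun x => x * g x) = gint g'.
Proof.
  intros Hg Hg' Hxg Hd.
  assert (Hl : lipexp (fun x => 1 * g' x + -1 * (x * g x))) by now apply lipexp_lin.
  assert (E : gint (fun x => 1 * g' x + -1 * (x * g x)) = 0).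
  { apply gint_unique; auto.
    destruct (lipexp_gauss_decay g Hg) as [C HC].
    assert (HC0 : 0 <= C).
    { specialize (HC 0). rewrite Rabs_R0, Ropp_0, exp_0 in HC. pose proof (Rabs_pos (g 0 * gauss 0)). lra. }
    assert (Hc := fun x => lipexp_gauss_continuous _ x Hl).
    apply improper_integral_RInt; auto. intros eps He.
    destruct (exp_neg_small (eps / (2 * C + 1))) as [M [HM Hs]]; [apply Rdiv_lt_0_compat; lra|].
    exists M. intros a b Ha Hb.
    assert (HI : is_RInt (fun x => (1 * g' x + -1 * (x * g x)) * gauss x) a b
                   (minus (g b * gauss b) (g a * gauss a))).
    { apply (is_RInt_derive (fun x => g x * gauss x)); [|intros x _; apply Hc].
      intros x _. evar_last.
      - apply (is_derive_mult g gauss x (g' x) (- x * gauss x)); auto using is_derive_gauss.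
        intros; apply Rmult_comm.
      - unfold plus, mult; simpl. ring. }
    rewrite (is_RInt_unique (V := R_CompleteNormedModule) _ _ _ _ HI). unfold minus, plus, opp; simpl.
    rewrite Rminus_0_r.
    pose proof (HC a) as HCa. pose proof (HC b) as HCb.
    rewrite (Rabs_left1 a) in HCa by lra. rewrite (Rabs_pos_eq b) in HCb by lra.
    rewrite Ropp_involutive in HCa.
    pose proof (exp_mono a (- M) ltac:(lra)). pose proof (exp_mono (- b) (- M) ltac:(lra)).
    eapply Rle_lt_trans; [apply Rabs_triang|]. rewrite Rabs_Ropp.
    pose proof (exp_pos (- M)).
    apply (Rmult_lt_compat_l (2 * C + 1)) in Hs; [|lra].
    replace ((2 * C + 1) * (eps / (2 * C + 1))) with eps in Hs by (field; lra). nra. }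
  rewrite gint_lin in E by auto. lra.
Qed.

Lemma RInt_mult_l (f : R -> R) a b l : (forall x, continuous f x) ->
  RInt (fun x => l * f x) a b = l * RInt f a b.
Proof. intros H. apply (RInt_scal (V := R_CompleteNormedModule) f). now apply ex_RInt_all. Qed.

Lemma RInt_affine (f : R -> R) u v a b : (forall x, continuous f x) ->
  RInt (fun y => u * f (u * y + v)) a b = RInt f (u * a + v) (u * b + v).
Proof. intros H. apply (RInt_comp_lin (V := R_CompleteNormedModule) f). now apply ex_RInt_all. Qed.

(** * Normalisation of the Gaussian density, by a one-variable argument *)

Definition half_gauss (x : R) : R := RInt (fun t => exp (- (t * t) / 2)) 0 x.

(** The classical companion of [half_gauss]: differentiating in [x] cancels the denominator, and the
    derivative is opposite to half that of [half_gauss x * half_gauss x]. At 0 it is the arctangent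
    integral, which is where PI enters. *)
Definition gauss_rest (x : R) : R := RInt (fun t => exp (- (x * x) * (1 + t * t) / 2) / (1 + t * t)) 0 1.

Lemma one_plus_sqr_pos t : 0 < 1 + t * t.
Proof. pose proof (Rle_0_sqr t). unfold Rsqr in *. lra. Qed.

Lemma is_derive_half_gauss x : is_derive half_gauss x (exp (- (x * x) / 2)).
Proof.
  apply (is_derive_RInt (V := R_NormedModule) (fun t => exp (- (t * t) / 2)) half_gauss 0 x).
  - exists (mkposreal 1 Rlt_0_1). intros y _.
    apply (RInt_correct (V := R_CompleteNormedModule)). apply ex_RInt_all.
    intros t. eapply continuous_of_derive. auto_derive; auto.
  - eapply continuous_of_derive. auto_derive; auto.
Qed.

Lemma is_derive_gauss_rest x : is_derive gauss_rest x (- exp (- (x * x) / 2) * half_gauss x).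
Proof.
  assert (D : forall u t, is_derive (fun z => exp (- (z * z) * (1 + t * t) / 2) / (1 + t * t)) u
                 (- u * exp (- (u * u) * (1 + t * t) / 2))).
  { intros u t. pose proof (one_plus_sqr_pos t). auto_derive; [lra|]. unfold Rdiv. field. lra. }
  (* Prepares the substitution of [x * t] for [t]; the [+ 0] matches the affine form in
     [RInt_affine]. *)
  assert (EX : forall x t : R, - x * exp (- (x * x) * (1 + t * t) / 2) =
     - exp (- (x * x) / 2) * (x * exp (- ((x * t + 0) * (x * t + 0)) / 2))).
  { intros y t.
    replace (- (y * y) * (1 + t * t) / 2) with (- (y * y) / 2 + - ((y * t + 0) * (y * t + 0)) / 2) by field.
    rewrite exp_plus. ring. }
  evar_last.
  - apply (is_derive_RInt_param (fun x t => exp (- (x * x) * (1 + t * t) / 2) / (1 + t * t)) 0 1 x).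
    + exists (mkposreal 1 Rlt_0_1). intros y _ t _. eexists. apply D.
    + intros t _.
      apply continuity_2d_pt_ext with (fun u v => - u * exp (- (u * u) * (1 + v * v) / 2)).
      { intros u v. symmetry. apply is_derive_unique, D. }
      apply continuity_2d_pt_mult.
      * apply continuity_2d_pt_opp, continuity_2d_pt_id1.
      * apply continuity_1d_2d_pt_comp.
        { apply derivable_continuous_pt, derivable_pt_exp. }
        unfold Rdiv. repeat first [apply continuity_2d_pt_mult | apply continuity_2d_pt_opp
          | apply continuity_2d_pt_plus | apply continuity_2d_pt_id1 | apply continuity_2d_pt_id2
          | apply continuity_2d_pt_const].
    + exists (mkposreal 1 Rlt_0_1). intros y _. apply ex_RInt_all. intros t.
      pose proof (one_plus_sqr_pos t).
      eapply continuous_of_derive. auto_derive; auto. lra.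
  - rewrite (RInt_ext _ (fun t => - exp (- (x * x) / 2) * (x * exp (- ((x * t + 0) * (x * t + 0)) / 2)))).
    + rewrite RInt_mult_l.
      * rewrite (RInt_affine (fun t => exp (- (t * t) / 2)) x 0 0 1).
        { unfold half_gauss. f_equal. rewrite Rmult_0_r, Rplus_0_r, Rmult_1_r, Rplus_0_r. reflexivity. }
        intros t. eapply continuous_of_derive. auto_derive; auto.
      * intros t. eapply continuous_of_derive. auto_derive; auto.
    + intros t _. exact (eq_trans (is_derive_unique _ _ _ (D x t)) (EX x t)).
Qed.

Lemma half_gauss_sqr x : half_gauss x * half_gauss x + 2 * gauss_rest x = PI / 2.
Proof.
  assert (E : forall y, is_derive (fun x => half_gauss x * half_gauss x + 2 * gauss_rest x) y 0).
  { intros y. pose proof (is_derive_half_gauss y) as H1. pose proof (is_derive_gauss_rest y) as H2.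
    evar_last.
    - apply (is_derive_plus (fun x => half_gauss x * half_gauss x) (fun x => 2 * gauss_rest x)).
      + apply (is_derive_mult half_gauss half_gauss _ _ _ H1 H1). intros; apply Rmult_comm.
      + apply (is_derive_scal gauss_rest _ 2 _ H2).
    - unfold plus, mult; simpl. ring. }
  destruct (MVT_gen (fun x => half_gauss x * half_gauss x + 2 * gauss_rest x) 0 x (fun _ => 0)) as [c [_ Hc]].
  - intros y _. apply E.
  - intros y _. apply continuity_pt_filterlim. exact (continuous_of_derive _ _ _ (E y)).
  - assert (A : half_gauss 0 = 0) by apply (RInt_point (V := R_CompleteNormedModule)).
    assert (B : gauss_rest 0 = PI / 4).
    { unfold gauss_rest. rewrite (RInt_ext _ (fun t => / (1 + t²))).
      - transitivity (atan 1 - atan 0); [|rewrite atan_1, atan_0; ring].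
        apply is_RInt_unique. apply (is_RInt_derive atan).
        + intros t _. apply is_derive_atan.
        + intros t _. unfold Rsqr. pose proof (one_plus_sqr_pos t).
          eapply continuous_of_derive. auto_derive; auto. lra.
      - intros t _. unfold Rsqr. replace (- (0 * 0) * (1 + t * t) / 2) with 0 by field.
        rewrite exp_0. apply Rmult_1_l. }
    rewrite A, B in Hc. lra.
Qed.

Lemma gauss_rest_bounds x : 0 <= gauss_rest x <= exp (- (x * x) / 2).
Proof.
  assert (Hc : forall t, continuous (fun t => exp (- (x * x) * (1 + t * t) / 2) / (1 + t * t)) t).
  { intros t. pose proof (one_plus_sqr_pos t). eapply continuous_of_derive. auto_derive; auto. lra. }
  assert (B : forall t, 0 <= exp (- (x * x) * (1 + t * t) / 2) / (1 + t * t) <= exp (- (x * x) / 2)).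
  { intros t. pose proof (one_plus_sqr_pos t). pose proof (exp_pos (- (x * x) * (1 + t * t) / 2)).
    split.
    - left. now apply Rdiv_lt_0_compat.
    - apply Rle_trans with (exp (- (x * x) * (1 + t * t) / 2)).
      + apply (Rmult_le_reg_r (1 + t * t)); auto. unfold Rdiv at 1.
        rewrite Rmult_assoc, Rinv_l by lra. pose proof (Rle_0_sqr t). unfold Rsqr in *. nra.
      + apply exp_mono. pose proof (Rle_0_sqr (x * t)). unfold Rsqr in *. lra. }
  split.
  - apply RInt_ge_0; [lra|now apply ex_RInt_all|]. intros t _. apply B.
  - eapply Rle_trans; [apply Rle_abs|].
    eapply Rle_trans; [apply (abs_RInt_le_const _ 0 1 (exp (- (x * x) / 2)))|lra].
    + lra.
    + now apply ex_RInt_all.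
    + intros t _. rewrite Rabs_pos_eq; apply B.
Qed.

(** Over [[- x, x]] the integral is [2 * half_gauss x / sqrt (2 * PI)], whose square is
    [1 - 4 / PI * gauss_rest x] and tends to 1. So the square of the full integral is 1, and
    monotonicity rules out the value -1. *)
Lemma gint_one : gint (fun _ => 1) = 1.
Proof.
  pose proof PI_RGT_0 as HPI.
  assert (Hs : 0 < sqrt (2 * PI)) by (apply sqrt_lt_R0; lra).
  assert (Hss : sqrt (2 * PI) * sqrt (2 * PI) = 2 * PI) by (apply sqrt_sqrt; lra).
  assert (Hc : forall x, continuous (fun t => exp (- (t * t) / 2)) x).
  { intros t. eapply continuous_of_derive. auto_derive; auto. }
  assert (Hodd : forall x, half_gauss (- x) = - half_gauss x).
  { intros x. pose proof (RInt_affine (fun t => exp (- (t * t) / 2)) (-1) 0 0 x Hc) as E.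
    unfold half_gauss. replace (-1 * 0 + 0) with 0 in E by ring.
    replace (-1 * x + 0) with (- x) in E by ring. rewrite <- E.
    rewrite RInt_mult_l.
    - rewrite (RInt_ext _ (fun t => exp (- (t * t) / 2))); [ring|].
      intros t _. f_equal. field.
    - intros t. eapply continuous_of_derive. auto_derive; auto. }
  assert (HI : forall x, RInt (fun t => 1 * gauss t) (- x) x = 2 * half_gauss x / sqrt (2 * PI)).
  { intros x. rewrite (RInt_ext _ (fun t => / sqrt (2 * PI) * exp (- (t * t) / 2))).
    - rewrite RInt_mult_l by auto.
      assert (E : RInt (fun t => exp (- (t * t) / 2)) (- x) 0 + half_gauss x
                    = RInt (fun t => exp (- (t * t) / 2)) (- x) x)
        by (apply (RInt_Chasles (V := R_CompleteNormedModule)); apply ex_RInt_all; auto).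
      assert (E' : - half_gauss (- x) = RInt (fun t => exp (- (t * t) / 2)) (- x) 0)
        by (apply (opp_RInt_swap (V := R_CompleteNormedModule)); apply ex_RInt_all; auto).
      rewrite <- E, <- E', Hodd. eqR. field. lra.
    - intros t _. unfold gauss. eqR. field. lra. }
  assert (HI2 : forall x, (2 * half_gauss x / sqrt (2 * PI)) * (2 * half_gauss x / sqrt (2 * PI))
                  = 1 - 4 / PI * gauss_rest x).
  { intros x. replace (2 * half_gauss x / sqrt (2 * PI) * (2 * half_gauss x / sqrt (2 * PI)))
      with (4 * (half_gauss x * half_gauss x) / (sqrt (2 * PI) * sqrt (2 * PI))) by (field; lra).
    rewrite Hss. replace (half_gauss x * half_gauss x) with (PI / 2 - 2 * gauss_rest x)
      by (rewrite <- (half_gauss_sqr x); ring). field. lra. }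
  pose proof (lipexp_const 1) as L1.
  assert (H0 : 0 <= gint (fun _ => 1)).
  { assert (E : gint (fun _ => 0 * 1 + 0 * 1) = 0 * gint (fun _ => 1) + 0 * gint (fun _ => 1))
      by (apply gint_lin; auto).
    apply Rle_trans with (gint (fun _ => 0 * 1 + 0 * 1)); [rewrite E; lra|].
    apply gint_le; auto using lipexp_const. intros; lra. }
  assert (Hsq : gint (fun _ => 1) * gint (fun _ => 1) = 1).
  { set (l := gint (fun _ => 1)) in *.
    apply cond_eq. intros eps He.
    pose proof (gint_correct _ L1) as G. fold l in G.
    rewrite improper_integral_RInt in G
      by (intros x; apply (lipexp_gauss_continuous (fun _ => 1)); auto).
    (* The cap [1] keeps [Rabs (y + l)] below [2 * l + 1], so the difference of squares is at most
       [e * (2 * l + 1)]. *)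
    set (e := Rmin 1 (eps / (2 * l + 2) / 2)).
    assert (He1 : 0 < eps / (2 * l + 2)) by (apply Rdiv_lt_0_compat; lra).
    assert (He' : 0 < e) by (unfold e; apply Rmin_pos; lra).
    assert (Hel : e * (2 * l + 1) < eps / 2).
    { assert (e <= eps / (2 * l + 2) / 2) by apply Rmin_r.
      assert (eps / (2 * l + 2) * (2 * l + 2) = eps) by (field; lra). nra. }
    assert (He2 : e <= 1) by apply Rmin_l.
    destruct (G e He') as [M HM].
    destruct (exp_neg_small (eps * PI / 8)) as [M' [HM0 HM']]; [nra|].
    (* From [m >= 2] follows [m <= m * m / 2], so the Gaussian bound on [gauss_rest m] is at most
       [exp (- M')]. *)
    set (m := Rmax 2 (Rmax M M')).
    assert (2 <= m) by apply Rmax_l.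
    assert (M <= m) by (eapply Rle_trans; [apply Rmax_l|apply Rmax_r]).
    assert (M' <= m) by (eapply Rle_trans; [apply Rmax_r|apply Rmax_r]).
    specialize (HM (- m) m ltac:(lra) ltac:(lra)). rewrite HI in HM.
    pose proof (HI2 m) as Q. set (y := 2 * half_gauss m / sqrt (2 * PI)) in *.
    pose proof (gauss_rest_bounds m) as [r0 r1].
    assert (Hm2 : m <= m * m / 2) by (assert (0 <= m * (m - 2)) by (apply Rmult_le_pos; lra); lra).
    pose proof (exp_mono (- (m * m) / 2) (- M') ltac:(lra)).
    assert (4 / PI * gauss_rest m < eps / 2).
    { apply (Rmult_lt_reg_r PI); auto. replace (4 / PI * gauss_rest m * PI) with (4 * gauss_rest m) by (field; lra).
      lra. }
    assert (0 <= 4 / PI * gauss_rest m).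
    { apply Rmult_le_pos; auto. left. apply Rdiv_lt_0_compat; lra. }
    assert (Rabs (l * l - y * y) <= e * (2 * l + 1)).
    { replace (l * l - y * y) with (- ((y - l) * (y + l))) by ring. rewrite Rabs_Ropp, Rabs_mult.
      apply Rmult_le_compat; auto using Rabs_pos; [lra|].
      apply Rabs_def2 in HM. apply Rabs_le. lra. }
    replace (l * l - 1) with ((l * l - y * y) + (y * y - 1)) by ring.
    eapply Rle_lt_trans; [apply Rabs_triang|].
    replace (y * y - 1) with (- (4 / PI * gauss_rest m)) by lra.
    rewrite Rabs_Ropp, (Rabs_pos_eq (4 / PI * _)) by auto. lra. }
  set (l := gint (fun _ => 1)) in *.
  assert (E : (l - 1) * (l + 1) = 0) by lra.
  apply Rmult_integral in E. lra.
Qed.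

Lemma gint_const c : gint (fun _ => c) = c.
Proof.
  pose proof (lipexp_const 1) as L.
  replace (fun _ : R => c) with (fun _ : R => c * 1 + 0 * 1) by (apply functional_extensionality; intros; ring).
  rewrite (gint_lin c 0 (fun _ => 1) (fun _ => 1)) by auto. rewrite gint_one. ring.
Qed.

(** * Iterated Gaussian integrals *)

(** The l1 norm is additive under [vcons], so an exponential weight in it factors when one
    coordinate is split off. *)
Definition nrm (n : nat) (z : nat -> R) : R := sumN n (fun i => Rabs (z i)).

(* The right-hand side vanishes when [z] and [z'] agree below [n]: such an [F] depends on these coordinates only. *)
Definition nice (n : nat) (F : (nat -> R) -> R) : Prop :=
  exists K, forall z z', Rabs (F z - F z')
    <= exp (K * (1 + nrm n z + nrm n z')) * nrm n (fun i => z i - z' i).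

Lemma nrm_pos n z : 0 <= nrm n z.
Proof. apply sumN_nonneg. intros; apply Rabs_pos. Qed.

Lemma nrm_vcons n x z : nrm (S n) (vcons x z) = Rabs x + nrm n z.
Proof. unfold nrm. now rewrite sumN_S_first. Qed.

Lemma nrm_coord n z i : (i < n)%nat -> Rabs (z i) <= nrm n z.
Proof. intros H. apply (sumN_term_le n (fun i => Rabs (z i))); auto. intros; apply Rabs_pos. Qed.

Lemma nrm_triang n z z' : nrm n z <= nrm n z' + nrm n (fun i => z i - z' i).
Proof.
  unfold nrm. rewrite <- sumN_plus. apply sumN_le. intros i _.
  replace (z i) with (z' i + (z i - z' i)) at 1 by ring. apply Rabs_triang.
Qed.

Lemma nrm_minus_le n z z' : nrm n (fun i => z i - z' i) <= nrm n z + nrm n z'.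
Proof.
  unfold nrm. rewrite <- sumN_plus. apply sumN_le. intros i _.
  unfold Rminus. rewrite <- (Rabs_Ropp (z' i)). apply Rabs_triang.
Qed.

Lemma nrm_minus_sym n z z' : nrm n (fun i => z i - z' i) = nrm n (fun i => z' i - z i).
Proof. apply sumN_ext. intros. apply Rabs_minus_sym. Qed.

Lemma nrm_minus_diag n z z' : (forall i, (i < n)%nat -> z i = z' i) -> nrm n (fun i => z i - z' i) = 0.
Proof. intros H. apply sumN_zero. intros i Hi. rewrite H, Rminus_diag by auto. apply Rabs_R0. Qed.

Lemma nrm_zero n : nrm n (fun _ => 0) = 0.
Proof. apply sumN_zero. intros; apply Rabs_R0. Qed.

Lemma nrm_widen n m z : (n <= m)%nat -> nrm n z <= nrm m z.
Proof.
  intros H. replace m with (n + (m - n))%nat by lia. unfold nrm. rewrite sumN_add.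
  assert (0 <= sumN (m - n) (fun k => Rabs (z (n + k)%nat))) by (apply sumN_nonneg; intros; apply Rabs_pos).
  lra.
Qed.

Definition shift (n : nat) (z : nat -> R) : nat -> R := fun i => z (n + i)%nat.

Lemma nrm_shift n m z : nrm m (shift n z) <= nrm (n + m) z.
Proof.
  unfold nrm. rewrite sumN_add.
  assert (0 <= sumN n (fun k => Rabs (z k))) by (apply sumN_nonneg; intros; apply Rabs_pos).
  unfold shift. lra.
Qed.

Lemma nice_intro n F C K :
  (forall z z', Rabs (F z - F z') <= C * exp (K * (1 + nrm n z + nrm n z')) * nrm n (fun i => z i - z' i)) ->
  nice n F.
Proof.
  intros H. exists (Rabs C + K). intros z z'. eapply Rle_trans; [apply H|].
  apply Rmult_le_compat_r; [apply nrm_pos|].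
  rewrite Rmult_plus_distr_r, exp_plus. apply Rmult_le_compat_r; [left; apply exp_pos|].
  pose proof (nrm_pos n z). pose proof (nrm_pos n z'). pose proof (Rabs_pos C). pose proof (Rle_abs C).
  apply exp_le_of_le_lower. nra.
Qed.

Lemma nice_pos n F : nice n F -> exists K, 0 <= K /\ forall z z', Rabs (F z - F z')
    <= exp (K * (1 + nrm n z + nrm n z')) * nrm n (fun i => z i - z' i).
Proof.
  intros [K H]. exists (Rabs K). split; [apply Rabs_pos|]. intros z z'.
  eapply Rle_trans; [apply H|]. apply Rmult_le_compat_r; [apply nrm_pos|].
  apply exp_mono. pose proof (Rle_abs K). pose proof (nrm_pos n z). pose proof (nrm_pos n z'). nra.
Qed.

Lemma nice_bound n F : nice n F -> exists K, 0 <= K /\ forall z, Rabs (F z) <= exp (K * (1 + nrm n z)).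
Proof.
  intros HF. destruct (nice_pos n F HF) as [K [HK H]]. set (F0 := F (fun _ => 0)).
  exists (2 + K + Rabs F0). pose proof (Rabs_pos F0) as H0. split; [lra|]. intros z.
  specialize (H z (fun _ => 0)). fold F0 in H. rewrite nrm_zero, Rplus_0_r in H.
  assert (E0 : nrm n (fun i => z i - 0) = nrm n z) by (apply sumN_ext; intros; now rewrite Rminus_0_r).
  rewrite E0 in H. set (t := nrm n z) in *. assert (Ht : 0 <= t) by apply nrm_pos.
  assert (Rabs (F z) <= Rabs (F z - F0) + Rabs F0).
  { replace (F z) with ((F z - F0) + F0) at 1 by ring. apply Rabs_triang. }
  assert (t <= exp t) by (apply exp_le_of_le_lower; lra).
  assert (Rabs F0 <= exp (Rabs F0)) by (apply exp_le_of_le_lower; lra).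
  assert (E : Rabs (F z) <= exp (K * (1 + t) + t) + exp (Rabs F0)).
  { rewrite exp_plus. pose proof (exp_pos (K * (1 + t))). nra. }
  eapply Rle_trans; [apply E|]. eapply Rle_trans; [apply exp_plus_le; nra|].
  apply exp_mono. nra.
Qed.

Lemma nice_local n F z z' : nice n F -> (forall i, (i < n)%nat -> z i = z' i) -> F z = F z'.
Proof.
  intros [K H] E. specialize (H z z'). rewrite nrm_minus_diag, Rmult_0_r in H by auto.
  apply cond_eq. intros eps He. lra.
Qed.

Lemma nice_ext n F G : (forall z, F z = G z) -> nice n F -> nice n G.
Proof. intros E. now replace G with F by (apply functional_extensionality; auto). Qed.

Lemma nice_const n c : nice n (fun _ => c).
Proof.
  exists 0. intros z z'. rewrite Rminus_diag, Rabs_R0.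
  apply Rmult_le_pos; [left; apply exp_pos|apply nrm_pos].
Qed.

Lemma nice_lipschitz n F C : (forall z z', Rabs (F z - F z') <= C * nrm n (fun i => z i - z' i)) -> nice n F.
Proof.
  intros H. apply (nice_intro n F C 0). intros z z'. rewrite Rmult_0_l, exp_0, Rmult_1_r. apply H.
Qed.

Lemma nice_coord n i : (i < n)%nat -> nice n (fun z => z i).
Proof.
  intros Hi. apply (nice_lipschitz _ _ 1). intros z z'. rewrite Rmult_1_l.
  apply (nrm_coord n (fun i => z i - z' i)); auto.
Qed.

Lemma nice_nrm n : nice n (nrm n).
Proof.
  apply (nice_lipschitz _ _ 1). intros z z'. rewrite Rmult_1_l.
  pose proof (nrm_triang n z z'). pose proof (nrm_triang n z' z). rewrite (nrm_minus_sym n z') in *.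
  apply Rabs_le. lra.
Qed.

Lemma nice_lin n a b F G : nice n F -> nice n G -> nice n (fun z => a * F z + b * G z).
Proof.
  intros HF HG. destruct (nice_pos n F HF) as [K [HK H]]. destruct (nice_pos n G HG) as [L [HL H']].
  apply (nice_intro _ _ (Rabs a + Rabs b) (K + L)). intros z z'.
  pose proof (Rabs_pos a). pose proof (Rabs_pos b).
  replace (a * F z + b * G z - (a * F z' + b * G z')) with (a * (F z - F z') + b * (G z - G z')) by ring.
  eapply Rle_trans; [apply Rabs_triang|]. rewrite !Rabs_mult.
  specialize (H z z'). specialize (H' z z').
  pose proof (nrm_pos n z). pose proof (nrm_pos n z').
  set (s := 1 + nrm n z + nrm n z') in *. set (d := nrm n (fun i => z i - z' i)) in *.
  assert (0 <= d) by apply nrm_pos.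
  assert (1 <= s) by (unfold s; lra).
  pose proof (exp_mono (K * s) ((K + L) * s) ltac:(nra)).
  pose proof (exp_mono (L * s) ((K + L) * s) ltac:(nra)).
  assert (Rabs a * Rabs (F z - F z') <= Rabs a * (exp ((K + L) * s) * d)) by
    (apply Rmult_le_compat_l; auto; eapply Rle_trans; [apply H|]; apply Rmult_le_compat_r; auto).
  assert (Rabs b * Rabs (G z - G z') <= Rabs b * (exp ((K + L) * s) * d)) by
    (apply Rmult_le_compat_l; auto; eapply Rle_trans; [apply H'|]; apply Rmult_le_compat_r; auto).
  lra.
Qed.

Lemma nice_plus n F G : nice n F -> nice n G -> nice n (fun z => F z + G z).
Proof.
  intros HF HG. apply (nice_ext _ (fun z => 1 * F z + 1 * G z)); [intros; ring|]. now apply nice_lin.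
Qed.

Lemma nice_minus n F G : nice n F -> nice n G -> nice n (fun z => F z - G z).
Proof.
  intros HF HG. apply (nice_ext _ (fun z => 1 * F z + -1 * G z)); [intros; ring|]. now apply nice_lin.
Qed.

Lemma nice_scal n c F : nice n F -> nice n (fun z => c * F z).
Proof.
  intros HF. apply (nice_ext _ (fun z => c * F z + 0 * F z)); [intros; ring|]. now apply nice_lin.
Qed.

Lemma nice_opp n F : nice n F -> nice n (fun z => - F z).
Proof. intros HF. apply (nice_ext _ (fun z => -1 * F z)); [intros; ring|]. now apply nice_scal. Qed.

Lemma nice_mult n F G : nice n F -> nice n G -> nice n (fun z => F z * G z).
Proof.
  intros HF HG. destruct (nice_pos n F HF) as [K [HK H]]. destruct (nice_pos n G HG) as [L [HL H']].
  destruct (nice_bound n F HF) as [K' [HK' B]]. destruct (nice_bound n G HG) as [L' [HL' B']].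
  apply (nice_intro _ _ 2 (K + L + K' + L')). intros z z'.
  replace (F z * G z - F z' * G z') with (F z * (G z - G z') + G z' * (F z - F z')) by ring.
  eapply Rle_trans; [apply Rabs_triang|]. rewrite !Rabs_mult.
  specialize (H z z'). specialize (H' z z'). specialize (B z). specialize (B' z').
  pose proof (nrm_pos n z). pose proof (nrm_pos n z').
  set (s := 1 + nrm n z + nrm n z') in *. set (d := nrm n (fun i => z i - z' i)) in *.
  assert (0 <= d) by apply nrm_pos.
  assert (1 <= s) by (unfold s; lra).
  assert (Rabs (F z) * Rabs (G z - G z') <= exp (K' * (1 + nrm n z)) * (exp (L * s) * d))
    by (apply Rmult_le_compat; auto using Rabs_pos).
  assert (Rabs (G z') * Rabs (F z - F z') <= exp (L' * (1 + nrm n z')) * (exp (K * s) * d))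
    by (apply Rmult_le_compat; auto using Rabs_pos).
  rewrite <- Rmult_assoc, <- exp_plus in *.
  pose proof (exp_mono (K' * (1 + nrm n z) + L * s) ((K + L + K' + L') * s) ltac:(unfold s; nra)).
  pose proof (exp_mono (L' * (1 + nrm n z') + K * s) ((K + L + K' + L') * s) ltac:(unfold s; nra)).
  nra.
Qed.

Lemma nice_sum n m (F : nat -> (nat -> R) -> R) :
  (forall k, (k < m)%nat -> nice n (F k)) -> nice n (fun z => sumN m (fun k => F k z)).
Proof.
  induction m; intros H; simpl; [apply nice_const|].
  apply nice_plus; [apply IHm; auto|auto].
Qed.

(** Without an upper bound, the exponential of a function of exponential growth could leave the
    class. This is the source of the upper bound in [admissible]. *)
Lemma nice_exp n F c : nice n F -> (forall z, F z <= c) -> nice n (fun z => exp (F z)).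
Proof.
  intros HF Hc. destruct (nice_pos n F HF) as [K [HK H]].
  apply (nice_intro _ _ (exp c) K). intros z z'. rewrite Rmult_assoc.
  eapply Rle_trans; [apply (exp_lipschitz_le c); auto|].
  apply Rmult_le_compat_l; auto. left; apply exp_pos.
Qed.

Lemma nice_exp_nrm n a b : nice n (fun z => exp (a + b * nrm n z)).
Proof.
  apply (nice_intro _ _ (exp (Rabs a) * Rabs b) (Rabs b)). intros z z'.
  pose proof (nrm_pos n z). pose proof (nrm_pos n z'). pose proof (Rle_abs a). pose proof (Rle_abs b).
  pose proof (Rabs_pos b).
  eapply Rle_trans; [apply (exp_lipschitz_le (Rabs a + Rabs b * (1 + nrm n z + nrm n z'))); nra|].
  rewrite exp_plus.
  replace (a + b * nrm n z - (a + b * nrm n z')) with (b * (nrm n z - nrm n z')) by ring.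
  rewrite Rabs_mult.
  assert (Rabs (nrm n z - nrm n z') <= nrm n (fun i => z i - z' i)).
  { pose proof (nrm_triang n z z'). pose proof (nrm_triang n z' z). rewrite (nrm_minus_sym n z') in *.
    apply Rabs_le. lra. }
  pose proof (exp_pos (Rabs a)). pose proof (exp_pos (Rabs b * (1 + nrm n z + nrm n z'))).
  replace (exp (Rabs a) * Rabs b * exp (Rabs b * (1 + nrm n z + nrm n z')) * nrm n (fun i => z i - z' i))
    with (exp (Rabs a) * exp (Rabs b * (1 + nrm n z + nrm n z')) * (Rabs b * nrm n (fun i => z i - z' i))) by ring.
  apply Rmult_le_compat_l; [|apply Rmult_le_compat_l; auto].
  apply Rmult_le_pos; lra.
Qed.

Lemma nice_pullback n m F (h : (nat -> R) -> nat -> R) :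
  (forall z, nrm n (h z) <= nrm m z) ->
  (forall z z', nrm n (fun i => h z i - h z' i) <= nrm m (fun i => z i - z' i)) ->
  nice n F -> nice m (fun z => F (h z)).
Proof.
  intros H1 H2 HF. destruct (nice_pos n F HF) as [K [HK H]]. exists K. intros z z'.
  eapply Rle_trans; [apply H|]. apply Rmult_le_compat; auto using nrm_pos.
  - left; apply exp_pos.
  - apply exp_mono. pose proof (H1 z). pose proof (H1 z'). nra.
Qed.

Lemma nice_shift n m F : nice m F -> nice (n + m) (fun z => F (shift n z)).
Proof.
  apply nice_pullback; intros; [apply nrm_shift|].
  apply (nrm_shift n m (fun i => z i - z' i)).
Qed.

Lemma nice_widen n m F : (n <= m)%nat -> nice n F -> nice m F.
Proof. intros Hnm. apply (nice_pullback n m F (fun z => z)); intros; now apply nrm_widen. Qed.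

Lemma nice_vcons m F x : nice (S m) F -> nice m (fun z => F (vcons x z)).
Proof.
  intros HF. destruct (nice_pos _ F HF) as [K [HK H]].
  apply (nice_intro _ _ (exp (2 * K * Rabs x)) K). intros z z'.
  eapply Rle_trans; [apply H|]. rewrite !nrm_vcons.
  apply Req_le. rewrite <- exp_plus. f_equal.
  - f_equal. ring.
  - unfold nrm. rewrite sumN_S_first. simpl. rewrite Rminus_diag, Rabs_R0. ring.
Qed.

Lemma gexp_ext n F G : (forall z, F z = G z) -> gexp n F = gexp n G.
Proof. intros E. f_equal. now apply functional_extensionality. Qed.

Definition gexp_linear n := forall a b F G, nice n F -> nice n G ->
  gexp n (fun z => a * F z + b * G z) = a * gexp n F + b * gexp n G.

Definition gexp_monotone n := forall F G, nice n F -> nice n G -> (forall z, F z <= G z) ->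
  gexp n F <= gexp n G.

(** The increment of the slice is bounded by integrating the pointwise [nice] bound over [z]. Its
    weight splits into a factor in [x], [y] and the factor [E z], and only linearity and
    monotonicity in dimension [m] are used. *)
Lemma slice_lipexp_aux m F : gexp_linear m -> gexp_monotone m -> nice (S m) F ->
  lipexp (fun x => gexp m (fun z => F (vcons x z))).
Proof.
  intros Hl Hm HF. destruct (nice_pos _ F HF) as [K [HK H]].
  set (E := fun z => exp (0 + 2 * K * nrm m z)).
  assert (HE : nice m E) by apply nice_exp_nrm.
  assert (W : forall x y, gexp m (fun z => F (vcons x z)) - gexp m (fun z => F (vcons y z))
      <= exp (K * (1 + Rabs x + Rabs y)) * Rabs (x - y) * gexp m E).
  { intros x y.
    replace (gexp m (fun z => F (vcons x z)) - gexp m (fun z => F (vcons y z))) with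
      (1 * gexp m (fun z => F (vcons x z)) + -1 * gexp m (fun z => F (vcons y z))) by ring.
    rewrite <- Hl by now apply nice_vcons.
    replace (exp (K * (1 + Rabs x + Rabs y)) * Rabs (x - y) * gexp m E) with
      (exp (K * (1 + Rabs x + Rabs y)) * Rabs (x - y) * gexp m E + 0 * gexp m E) by ring.
    rewrite <- Hl by auto.
    apply Hm; [apply nice_lin; now apply nice_vcons|now apply nice_lin|].
    intros z. specialize (H (vcons x z) (vcons y z)). rewrite !nrm_vcons in H.
    replace (nrm (S m) (fun i => vcons x z i - vcons y z i)) with (Rabs (x - y)) in H.
    2:{ unfold nrm. rewrite sumN_S_first. simpl.
        rewrite sumN_zero; [ring|]. intros. rewrite Rminus_diag. apply Rabs_R0. }
    replace (K * (1 + (Rabs x + nrm m z) + (Rabs y + nrm m z))) with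
      (K * (1 + Rabs x + Rabs y) + (0 + 2 * K * nrm m z)) in H by ring.
    rewrite exp_plus in H. fold (E z) in H.
    pose proof (Rle_abs (F (vcons x z) - F (vcons y z))). lra. }
  (* The constant [gexp m E] moves into the exponent, which is possible because
     [1 + Rabs x + Rabs y >= 1]. *)
  exists (K + Rabs (gexp m E)). intros x y.
  pose proof (W x y) as W1. pose proof (W y x) as W2.
  rewrite (Rabs_minus_sym y x) in W2.
  replace (K * (1 + Rabs y + Rabs x)) with (K * (1 + Rabs x + Rabs y)) in W2 by ring.
  rewrite Rmult_plus_distr_r, exp_plus.
  pose proof (Rabs_pos x). pose proof (Rabs_pos y). pose proof (Rabs_pos (gexp m E)).
  pose proof (Rle_abs (gexp m E)).
  assert (gexp m E <= exp (Rabs (gexp m E) * (1 + Rabs x + Rabs y))) by (apply exp_le_of_le_lower; nra).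
  assert (0 <= exp (K * (1 + Rabs x + Rabs y)) * Rabs (x - y))
    by (apply Rmult_le_pos; [left; apply exp_pos|apply Rabs_pos]).
  apply Rabs_le. nra.
Qed.

(** The two properties are proved together: in dimension [S m] each needs slices to be [lipexp], and
    that needs both in dimension [m]. *)
Lemma gexp_linear_monotone n : gexp_linear n /\ gexp_monotone n.
Proof.
  induction n as [|m [Hl Hm]].
  - split; red; simpl; auto.
  - split.
    + intros a b F G HF HG. simpl.
      rewrite <- gint_lin by now apply slice_lipexp_aux.
      f_equal. apply functional_extensionality. intros x. apply Hl; now apply nice_vcons.
    + intros F G HF HG H. simpl. apply gint_le; try now apply slice_lipexp_aux.
      intros x. apply Hm; auto using nice_vcons.
Qed.

Lemma gexp_lin n a b F G : nice n F -> nice n G ->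
  gexp n (fun z => a * F z + b * G z) = a * gexp n F + b * gexp n G.
Proof. apply gexp_linear_monotone. Qed.

Lemma gexp_le n F G : nice n F -> nice n G -> (forall z, F z <= G z) -> gexp n F <= gexp n G.
Proof. apply gexp_linear_monotone. Qed.

Lemma slice_lipexp m F : nice (S m) F -> lipexp (fun x => gexp m (fun z => F (vcons x z))).
Proof. apply slice_lipexp_aux; apply gexp_linear_monotone. Qed.

Lemma gexp_const n c : gexp n (fun _ => c) = c.
Proof.
  induction n; simpl; auto.
  replace (fun _ : R => gexp n (fun _ => c)) with (fun _ : R => c) by now rewrite IHn.
  apply gint_const.
Qed.

Lemma gexp_plus n F G : nice n F -> nice n G -> gexp n (fun z => F z + G z) = gexp n F + gexp n G.
Proof.
  intros HF HG. rewrite (gexp_ext _ _ (fun z => 1 * F z + 1 * G z)) by (intros; ring).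
  rewrite gexp_lin by auto. ring.
Qed.

Lemma gexp_minus n F G : nice n F -> nice n G -> gexp n (fun z => F z - G z) = gexp n F - gexp n G.
Proof.
  intros HF HG. rewrite (gexp_ext _ _ (fun z => 1 * F z + -1 * G z)) by (intros; ring).
  rewrite gexp_lin by auto. ring.
Qed.

Lemma gexp_scal n c F : nice n F -> gexp n (fun z => c * F z) = c * gexp n F.
Proof.
  intros HF. rewrite (gexp_ext _ _ (fun z => c * F z + 0 * F z)) by (intros; ring).
  rewrite gexp_lin by auto. ring.
Qed.

Lemma gexp_sum n m (F : nat -> (nat -> R) -> R) : (forall k, (k < m)%nat -> nice n (F k)) ->
  gexp n (fun z => sumN m (fun k => F k z)) = sumN m (fun k => gexp n (F k)).
Proof.
  induction m; intros H; simpl; [apply gexp_const|].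
  rewrite gexp_plus; [rewrite IHm; auto| |auto].
  apply nice_sum. auto.
Qed.

Lemma gexp_nonneg n F : nice n F -> (forall z, 0 <= F z) -> 0 <= gexp n F.
Proof.
  intros HF H. rewrite <- (gexp_const n 0). apply gexp_le; auto using nice_const.
Qed.

Lemma gexp_abs_le n F G : nice n F -> nice n G -> (forall z, Rabs (F z) <= G z) -> Rabs (gexp n F) <= gexp n G.
Proof.
  intros HF HG H. apply Rabs_le. split.
  - replace (- gexp n G) with (-1 * gexp n G) by ring. rewrite <- gexp_scal by auto.
    apply gexp_le; auto using nice_scal. intros z. specialize (H z). apply Rabs_le_between in H. lra.
  - apply gexp_le; auto. intros z. specialize (H z). apply Rabs_le_between in H. lra.
Qed.

(** The first block sits in the outer integrals, so peeling off its coordinates one at a time never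
    exchanges an order of integration. *)
Lemma gexp_mult n m F G : nice n F -> nice m G ->
  gexp (n + m) (fun z => F z * G (shift n z)) = gexp n F * gexp m G.
Proof.
  revert F. induction n; intros F HF HG.
  - simpl. rewrite <- gexp_scal by auto. apply gexp_ext. intros z. f_equal.
    (* A function that is [nice 0] is constant, so its value at the origin, used by [gexp 0], is its
       value at every [z]. *)
    apply (nice_local 0); auto. intros; lia.
  - simpl. rewrite (Rmult_comm (gint _)).
    pose proof (slice_lipexp n F HF) as L.
    transitivity (gint (fun x => gexp m G * gexp n (fun z => F (vcons x z)) + 0 * gexp n (fun z => F (vcons x z)))).
    + f_equal. apply functional_extensionality. intros x.
      transitivity (gexp n (fun z => F (vcons x z)) * gexp m G); [|ring].
      apply (IHn (fun z => F (vcons x z))); auto using nice_vcons.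
    + rewrite gint_lin by auto. ring.
Qed.

Lemma gexp_widen n m F : nice n F -> gexp (n + m) F = gexp n F.
Proof.
  intros HF. rewrite (gexp_ext _ F (fun z => F z * 1)) by (intros; ring).
  rewrite (gexp_mult n m F (fun _ => 1)) by auto using nice_const. rewrite gexp_const. ring.
Qed.

Lemma gexp_shift n m G : nice m G -> gexp (n + m) (fun z => G (shift n z)) = gexp m G.
Proof.
  intros HG. rewrite (gexp_ext _ _ (fun z => 1 * G (shift n z))) by (intros; ring).
  rewrite (gexp_mult n m (fun _ => 1) G) by auto using nice_const. rewrite gexp_const. ring.
Qed.

(** * Differentiation under the integral and Gaussian integration by parts *)

Lemma is_derive_of_quadratic (f : R -> R) x l C :
  (forall s, Rabs s <= 1 -> Rabs (f (x + s) - f x - s * l) <= C * (s * s)) -> is_derive f x l.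
Proof.
  intros H. apply is_derive_Reals. intros eps He.
  assert (HC : 0 < Rabs C + 1) by (pose proof (Rabs_pos C); lra).
  assert (Hd : 0 < Rmin 1 (eps / (Rabs C + 1))).
  { apply Rmin_pos; [lra|]. now apply Rdiv_lt_0_compat. }
  exists (mkposreal _ Hd). intros s Hs Hsd. simpl in Hsd.
  assert (Rabs s < 1) by (eapply Rlt_le_trans; [apply Hsd|apply Rmin_l]).
  assert (Hse : Rabs s < eps / (Rabs C + 1)) by (eapply Rlt_le_trans; [apply Hsd|apply Rmin_r]).
  specialize (H s ltac:(lra)).
  assert (Hs0 : 0 < Rabs s) by now apply Rabs_pos_lt.
  replace ((f (x + s) - f x) / s - l) with ((f (x + s) - f x - s * l) / s) by (field; auto).
  unfold Rdiv. rewrite Rabs_mult, Rabs_inv.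
  apply (Rmult_lt_reg_r (Rabs s)); auto. rewrite Rmult_assoc, Rinv_l, Rmult_1_r by lra.
  assert (Hss : s * s = Rabs s * Rabs s) by apply sqr_Rabs.
  rewrite Hss in H. pose proof (Rle_abs C).
  apply (Rmult_lt_compat_l (Rabs C + 1)) in Hse; auto.
  replace ((Rabs C + 1) * (eps / (Rabs C + 1))) with eps in Hse by (field; lra).
  assert (C * (Rabs s * Rabs s) <= (Rabs C + 1) * Rabs s * Rabs s) by nra. nra.
Qed.

(** The quadratic remainder is integrated by linearity and monotonicity, leaving a quadratic
    remainder with constant [gexp n B]. This takes the place of dominated convergence. *)
Lemma is_derive_gexp n (g : R -> (nat -> R) -> R) dg B x :
  (forall y, nice n (g y)) -> nice n dg -> nice n B ->
  (forall s z, Rabs s <= 1 -> Rabs (g (x + s) z - g x z - s * dg z) <= B z * (s * s)) ->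
  is_derive (fun y => gexp n (g y)) x (gexp n dg).
Proof.
  intros Hg Hdg HB H. apply (is_derive_of_quadratic _ _ _ (gexp n B)). intros s Hs.
  rewrite <- (gexp_scal n s dg) by auto. rewrite <- gexp_minus by auto.
  rewrite <- gexp_minus by auto using nice_minus, nice_scal.
  rewrite (Rmult_comm (gexp n B)), <- gexp_scal by auto.
  apply gexp_abs_le; auto using nice_minus, nice_scal.
  intros z. rewrite (Rmult_comm (s * s)). auto.
Qed.

Definition upd (z : nat -> R) (k : nat) (t : R) : nat -> R := fun i => if Nat.eq_dec i k then t else z i.

Lemma upd_vcons_0 x z t : upd (vcons x z) 0 t = vcons t z.
Proof. apply functional_extensionality. now intros [|i]. Qed.

Lemma upd_vcons_S x z k t : upd (vcons x z) (S k) t = vcons x (upd z k t).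
Proof.
  apply functional_extensionality. intros [|i]; unfold upd; simpl; auto.
  destruct (Nat.eq_dec (S i) (S k)), (Nat.eq_dec i k); auto; congruence.
Qed.

(** Induction on the dimension. For the outermost coordinate this is [gint_ibp] applied to the
    slice, whose derivative comes from [is_derive_gexp]; for an inner coordinate the identity holds
    under the outer integral for each fixed [x]. *)
Lemma gexp_ibp n k G D : (k < n)%nat -> nice n G -> nice n D ->
  (forall z, is_derive (fun t => G (upd z k t)) (z k) (D z)) ->
  gexp n (fun z => z k * G z) = gexp n D.
Proof.
  revert k G D. induction n as [|m IH]; intros k G D Hk HG HD Hder; [lia|].
  assert (HkG : nice (S m) (fun z => z k * G z)) by (apply nice_mult; auto using nice_coord).
  destruct k as [|k].
  - assert (Hder0 : forall y z, is_derive (fun t => G (vcons t z)) y (D (vcons y z))).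
    { intros y z.
      refine (is_derive_ext (K := R_AbsRing) (V := R_NormedModule)
                (fun t => G (upd (vcons y z) 0 t)) _ _ _ _ (Hder (vcons y z))).
      intros t. now rewrite upd_vcons_0. }
    simpl. set (g := fun x => gexp m (fun z => G (vcons x z))).
    assert (E : (fun x => gexp m (fun z => x * G (vcons x z))) = (fun x => x * g x)).
    { apply functional_extensionality. intros x. apply gexp_scal. now apply nice_vcons. }
    rewrite E. apply gint_ibp; try now apply slice_lipexp.
    + rewrite <- E. now apply (slice_lipexp m (fun z => z O * G z)).
    + intros x. destruct (nice_pos _ D HD) as [K [HK HKD]].
      apply (is_derive_gexp m (fun x z => G (vcons x z)) (fun z => D (vcons x z))
               (* Dominates the Lipschitz constant of [D] between [vcons c z] and [vcons x z] at a
                  mean-value point: [Rabs c <= 1 + Rabs x] when [Rabs s <= 1]. *)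
               (fun z => exp (K * (2 + 2 * Rabs x) + 2 * K * nrm m z))); try now intros; apply nice_vcons.
      { apply nice_exp_nrm. }
      intros s z Hs.
      destruct (MVT_gen (fun y => G (vcons y z)) x (x + s) (fun y => D (vcons y z))) as [c [Hc Ec]].
      * intros y _. apply Hder0.
      * intros y _. apply continuity_pt_filterlim.
        exact (continuous_of_derive _ _ _ (Hder0 y z)).
      * rewrite Ec. replace (D (vcons c z) * (x + s - x) - s * D (vcons x z))
          with (s * (D (vcons c z) - D (vcons x z))) by ring.
        rewrite Rabs_mult. specialize (HKD (vcons c z) (vcons x z)). rewrite !nrm_vcons in HKD.
        replace (nrm (S m) (fun i => vcons c z i - vcons x z i)) with (Rabs (c - x)) in HKD.
        2:{ unfold nrm. rewrite sumN_S_first. simpl.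
            rewrite sumN_zero; [ring|]. intros. rewrite Rminus_diag. apply Rabs_R0. }
        assert (Hcx : Rabs (c - x) <= Rabs s) by now apply between_dist.
        assert (Rabs c <= 1 + Rabs x).
        { replace c with ((c - x) + x) by ring. eapply Rle_trans; [apply Rabs_triang|lra]. }
        pose proof (nrm_pos m z).
        pose proof (exp_mono (K * (1 + (Rabs c + nrm m z) + (Rabs x + nrm m z)))
           (K * (2 + 2 * Rabs x) + 2 * K * nrm m z) ltac:(nra)) as Hexp.
        assert (Hss : s * s = Rabs s * Rabs s) by apply sqr_Rabs.
        rewrite Hss. eapply Rle_trans; [apply Rmult_le_compat_l; [apply Rabs_pos|apply HKD]|].
        rewrite (Rmult_comm _ (Rabs s * Rabs s)), Rmult_assoc.
        apply Rmult_le_compat_l; [apply Rabs_pos|]. rewrite (Rmult_comm (Rabs s)).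
        apply Rmult_le_compat; auto using Rabs_pos. left; apply exp_pos.
  - simpl. f_equal. apply functional_extensionality. intros x.
    apply (IH k (fun z => G (vcons x z)) (fun z => D (vcons x z))); auto using nice_vcons; [lia|].
    intros z.
    refine (is_derive_ext (K := R_AbsRing) (V := R_NormedModule)
              (fun t => G (upd (vcons x z) (S k) t)) _ _ _ _ (Hder (vcons x z))).
    intros t. now rewrite upd_vcons_S.
Qed.

Lemma upd_same z k t : upd z k t k = t.
Proof. unfold upd. now destruct (Nat.eq_dec k k). Qed.

Lemma gexp_coord_sqr n k : (k < n)%nat -> gexp n (fun z => z k * z k) = 1.
Proof.
  intros Hk. rewrite (gexp_ibp n k (fun z => z k) (fun _ => 1)); auto using nice_const, gexp_const, nice_coord.
  intros z. refine (is_derive_ext (K := R_AbsRing) (V := R_NormedModule) (fun t => t) _ _ _ _ _).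
  - intros t. simpl. now rewrite upd_same.
  - apply (is_derive_id (K := R_AbsRing)).
Qed.

(** * Gibbs averages *)

Definition admissible (n : nat) (V : (nat -> R) -> R) : Prop :=
  nice n V /\ exists c, forall z, V z <= c.

Definition lnZ (n : nat) (V : (nat -> R) -> R) : R := ln (gexp n (fun z => exp (V z))).

Definition gibbs (n : nat) (V psi : (nat -> R) -> R) : R :=
  gexp n (fun z => psi z * exp (V z)) / gexp n (fun z => exp (V z)).

Lemma exp_sub_1_le x : exp x - 1 <= x * exp x.
Proof.
  pose proof (exp_lower (- x)). pose proof (exp_pos x).
  assert (exp x * exp (- x) = 1) by (rewrite <- exp_plus, <- exp_0; f_equal; ring).
  nra.
Qed.

Lemma exp_taylor2 x : Rabs (exp x - 1 - x) <= x * x * exp (Rabs x).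
Proof.
  pose proof (exp_lower x). pose proof (exp_sub_1_le x). pose proof (exp_pos x).
  rewrite Rabs_pos_eq by lra.
  destruct (Rle_dec 0 x).
  - rewrite Rabs_pos_eq by lra. pose proof (exp_lower x). nra.
  - rewrite Rabs_left1 by lra. pose proof (exp_ge_1 (- x) ltac:(lra)). nra.
Qed.

Lemma adm_nice n V : admissible n V -> nice n V.
Proof. intros H; apply H. Qed.

Lemma adm_nice_exp n V : admissible n V -> nice n (fun z => exp (V z)).
Proof. intros [H [c Hc]]. now apply (nice_exp n V c). Qed.

(** Jensen's inequality, by integrating the tangent line of [exp] at the mean [m]. It also provides
    positivity of the partition function. *)
Lemma exp_gexp_le n V : admissible n V -> exp (gexp n V) <= gexp n (fun z => exp (V z)).
Proof.
  intros H. pose proof (adm_nice n V H). pose proof (adm_nice_exp n V H).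
  set (m := gexp n V).
  assert (E : gexp n (fun z => exp m * V z + (exp m * (1 - m)) * 1) = exp m).
  { rewrite (gexp_lin n _ _ V (fun _ => 1)) by auto using nice_const. rewrite gexp_const.
    fold m. ring. }
  rewrite <- E at 1. apply gexp_le; auto using nice_lin, nice_const.
  intros z. pose proof (exp_lower (V z - m)). pose proof (exp_pos m).
  replace (exp (V z)) with (exp m * exp (V z - m)) by (rewrite <- exp_plus; f_equal; ring). nra.
Qed.

Lemma adm_pos n V : admissible n V -> 0 < gexp n (fun z => exp (V z)).
Proof. intros H. eapply Rlt_le_trans; [apply exp_pos|now apply exp_gexp_le]. Qed.

Lemma exp_lnZ n V : admissible n V -> exp (lnZ n V) = gexp n (fun z => exp (V z)).
Proof. intros H. apply exp_ln. now apply adm_pos. Qed.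

Lemma gexp_le_lnZ n V : admissible n V -> gexp n V <= lnZ n V.
Proof.
  intros H. unfold lnZ. rewrite <- (ln_exp (gexp n V)).
  apply ln_le; [apply exp_pos|now apply exp_gexp_le].
Qed.

Lemma lnZ_le_const n V c : admissible n V -> (forall z, V z <= c) -> lnZ n V <= c.
Proof.
  intros H Hc. unfold lnZ. rewrite <- (ln_exp c).
  apply ln_le; [now apply adm_pos|]. rewrite <- (gexp_const n (exp c)).
  apply gexp_le; auto using nice_const, adm_nice_exp. intros z. now apply exp_mono.
Qed.

Lemma nice_mult_exp n V psi : admissible n V -> nice n psi -> nice n (fun z => psi z * exp (V z)).
Proof. intros H Hp. apply nice_mult; auto using adm_nice_exp. Qed.

Lemma gibbs_mult n V psi : admissible n V ->
  gibbs n V psi * gexp n (fun z => exp (V z)) = gexp n (fun z => psi z * exp (V z)).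
Proof. intros H. pose proof (adm_pos n V H). unfold gibbs. field. lra. Qed.

Lemma gibbs_ext n V f g : (forall z, f z = g z) -> gibbs n V f = gibbs n V g.
Proof. intros E. now replace g with f by (apply functional_extensionality; auto). Qed.

Lemma gibbs_lin n V a b f g : admissible n V -> nice n f -> nice n g ->
  gibbs n V (fun z => a * f z + b * g z) = a * gibbs n V f + b * gibbs n V g.
Proof.
  intros H Hf Hg. unfold gibbs.
  rewrite (gexp_ext _ _ (fun z => a * (f z * exp (V z)) + b * (g z * exp (V z)))) by (intros; ring).
  rewrite gexp_lin by now apply nice_mult_exp.
  pose proof (adm_pos n V H). field. lra.
Qed.

Lemma gibbs_const n V c : admissible n V -> gibbs n V (fun _ => c) = c.
Proof.
  intros H. unfold gibbs. rewrite gexp_scal by now apply adm_nice_exp.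
  pose proof (adm_pos n V H). field. lra.
Qed.

Lemma gibbs_scal n V c f : admissible n V -> nice n f -> gibbs n V (fun z => c * f z) = c * gibbs n V f.
Proof.
  intros H Hf. rewrite (gibbs_ext _ _ _ (fun z => c * f z + 0 * f z)) by (intros; ring).
  rewrite gibbs_lin by auto. ring.
Qed.

Lemma gibbs_plus n V f g : admissible n V -> nice n f -> nice n g ->
  gibbs n V (fun z => f z + g z) = gibbs n V f + gibbs n V g.
Proof.
  intros H Hf Hg. rewrite (gibbs_ext _ _ _ (fun z => 1 * f z + 1 * g z)) by (intros; ring).
  rewrite gibbs_lin by auto. ring.
Qed.

Lemma gibbs_minus n V f g : admissible n V -> nice n f -> nice n g ->
  gibbs n V (fun z => f z - g z) = gibbs n V f - gibbs n V g.
Proof.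
  intros H Hf Hg. rewrite (gibbs_ext _ _ _ (fun z => 1 * f z + -1 * g z)) by (intros; ring).
  rewrite gibbs_lin by auto. ring.
Qed.

Lemma gibbs_sum n V m (f : nat -> (nat -> R) -> R) : admissible n V ->
  (forall k, (k < m)%nat -> nice n (f k)) ->
  gibbs n V (fun z => sumN m (fun k => f k z)) = sumN m (fun k => gibbs n V (f k)).
Proof.
  intros H. induction m; intros Hf; simpl; [now apply gibbs_const|].
  rewrite gibbs_plus; auto; [now rewrite IHm by auto|]. apply nice_sum; auto.
Qed.

Lemma gibbs_le n V f g : admissible n V -> nice n f -> nice n g ->
  (forall z, f z <= g z) -> gibbs n V f <= gibbs n V g.
Proof.
  intros H Hf Hg Hfg. unfold gibbs. apply Rmult_le_compat_r.
  - left. apply Rinv_0_lt_compat. now apply adm_pos.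
  - apply gexp_le; try now apply nice_mult_exp. intros z.
    apply Rmult_le_compat_r; auto. left; apply exp_pos.
Qed.

Lemma gibbs_abs_le n V f B : admissible n V -> nice n f -> (forall z, Rabs (f z) <= B) ->
  Rabs (gibbs n V f) <= B.
Proof.
  intros H Hf HB. apply Rabs_le. split.
  - rewrite <- (gibbs_const n V (- B)) by auto. apply gibbs_le; auto using nice_const.
    intros z. specialize (HB z). apply Rabs_le_between in HB. lra.
  - rewrite <- (gibbs_const n V B) by auto. apply gibbs_le; auto using nice_const.
    intros z. specialize (HB z). apply Rabs_le_between in HB. lra.
Qed.

(** The Gibbs-Bogoliubov inequality: Jensen for the Gibbs measure of [V], again by the tangent line
    of [exp] at the mean [m], now weighted by [exp (V z)]. Used in both directions it yields the
    Lipschitz and Taylor bounds below. *)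
Lemma gibbs_jensen n V W : admissible n V -> admissible n W ->
  gibbs n V (fun z => W z - V z) <= lnZ n W - lnZ n V.
Proof.
  intros HV HW. set (m := gibbs n V (fun z => W z - V z)).
  assert (HD : nice n (fun z => W z - V z)) by (apply nice_minus; now apply adm_nice).
  assert (E : gexp n (fun z => exp m * ((W z - V z) * exp (V z)) + (exp m * (1 - m)) * exp (V z))
     = exp m * gexp n (fun z => exp (V z))).
  { rewrite gexp_lin by auto using nice_mult_exp, adm_nice_exp.
    rewrite <- (gibbs_mult n V (fun z => W z - V z)) by auto. fold m. ring. }
  assert (L : exp m * gexp n (fun z => exp (V z)) <= gexp n (fun z => exp (W z))).
  { rewrite <- E. apply gexp_le; auto using adm_nice_exp, nice_lin, nice_mult_exp.
    intros z. pose proof (exp_lower (W z - V z - m)).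
    replace (exp (W z)) with (exp m * exp (V z) * exp (W z - V z - m))
      by (rewrite <- !exp_plus; f_equal; ring).
    assert (0 < exp m * exp (V z)) by (apply Rmult_lt_0_compat; apply exp_pos). nra. }
  rewrite <- !exp_lnZ, <- exp_plus in L by auto.
  destruct (Rle_dec (m + lnZ n V) (lnZ n W)) as [|Hn]; [lra|].
  apply Rnot_le_lt, exp_increasing in Hn. lra.
Qed.

Lemma lnZ_lipschitz n V W d : admissible n V -> admissible n W ->
  (forall z, Rabs (V z - W z) <= d) -> Rabs (lnZ n V - lnZ n W) <= d.
Proof.
  intros HV HW Hd.
  pose proof (gibbs_jensen n V W HV HW). pose proof (gibbs_jensen n W V HW HV).
  pose proof (gibbs_abs_le n V (fun z => W z - V z) d HV
    (nice_minus _ _ _ (adm_nice _ _ HW) (adm_nice _ _ HV))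
    (fun z => eq_ind _ (fun t => t <= d) (Hd z) _ (Rabs_minus_sym _ _))) as A1.
  pose proof (gibbs_abs_le n W (fun z => V z - W z) d HW
    (nice_minus _ _ _ (adm_nice _ _ HV) (adm_nice _ _ HW)) Hd) as A2.
  apply Rabs_le_between in A1, A2. apply Rabs_le. lra.
Qed.

(** The normalised density is [exp (V z - lnZ n V)]. Replacing [V] by [W] moves its exponent by at
    most [2 * d], one [d] from the potential and one from the normalisation by [lnZ_lipschitz]. *)
Lemma gibbs_lipschitz n V W psi B d : admissible n V -> admissible n W -> nice n psi ->
  (forall z, Rabs (psi z) <= B) -> (forall z, Rabs (V z - W z) <= d) ->
  Rabs (gibbs n V psi - gibbs n W psi) <= B * (2 * d * exp (2 * d)).
Proof.
  intros HV HW Hpsi HB Hd.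
  pose proof (lnZ_lipschitz n V W d HV HW Hd) as HL.
  assert (Hrep : forall U, admissible n U -> gibbs n U psi = gexp n (fun z => psi z * exp (U z - lnZ n U))).
  { intros U HU. unfold gibbs. rewrite <- exp_lnZ by auto. unfold Rdiv. rewrite <- exp_Ropp.
    rewrite Rmult_comm, <- gexp_scal by now apply nice_mult_exp.
    apply gexp_ext. intros z. unfold Rminus. rewrite exp_plus. ring. }
  assert (Hnice : forall U, admissible n U -> nice n (fun z => psi z * exp (U z - lnZ n U))).
  { intros U HU. apply nice_mult; auto. destruct HU as [HU1 [c Hc]].
    apply (nice_exp _ _ (c - lnZ n U)); [apply nice_minus; auto using nice_const|].
    intros z. specialize (Hc z). lra. }
  assert (Hone : gexp n (fun z => exp (V z - lnZ n V)) = 1).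
  { transitivity (gexp n (fun z => exp (- lnZ n V) * exp (V z))).
    - apply gexp_ext. intros z. rewrite <- exp_plus. f_equal. ring.
    - rewrite gexp_scal by now apply adm_nice_exp. rewrite <- exp_lnZ by auto.
      rewrite <- exp_plus, <- exp_0. f_equal. ring. }
  assert (HneV : nice n (fun z => exp (V z - lnZ n V))).
  { destruct HV as [HU1 [c Hc]].
    apply (nice_exp _ _ (c - lnZ n V)); [apply nice_minus; auto using nice_const|].
    intros z. specialize (Hc z). lra. }
  rewrite !Hrep by auto. rewrite <- gexp_minus by auto.
  replace (B * (2 * d * exp (2 * d))) with (B * (2 * d * exp (2 * d)) * gexp n (fun z => exp (V z - lnZ n V)))
    by (rewrite Hone; ring).
  rewrite <- gexp_scal by auto.
  apply gexp_abs_le; auto using nice_minus, nice_scal.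
  intros z.
  replace (psi z * exp (V z - lnZ n V) - psi z * exp (W z - lnZ n W)) with
    (- (psi z * (exp (V z - lnZ n V) * (exp ((W z - V z) + (lnZ n V - lnZ n W)) - 1)))).
  2:{ replace (exp (W z - lnZ n W)) with (exp (V z - lnZ n V) * exp (W z - V z + (lnZ n V - lnZ n W)))
        by (rewrite <- exp_plus; f_equal; ring). ring. }
  rewrite Rabs_Ropp, !Rabs_mult, (Rabs_pos_eq (exp _)) by (left; apply exp_pos).
  assert (Hx : Rabs (W z - V z + (lnZ n V - lnZ n W)) <= 2 * d).
  { eapply Rle_trans; [apply Rabs_triang|]. specialize (Hd z). rewrite Rabs_minus_sym in Hd. lra. }
  pose proof (Rabs_exp_sub_1 _ _ Hx) as Hy. pose proof (exp_sub_1_le (2 * d)).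
  pose proof (exp_pos (V z - lnZ n V)). specialize (HB z). pose proof (Rabs_pos (psi z)).
  rewrite Rmult_assoc. apply Rmult_le_compat; auto.
  - apply Rmult_le_pos; [lra|apply Rabs_pos].
  - rewrite Rmult_comm. apply Rmult_le_compat_r; lra.
Qed.

(** Jensen in both directions traps [lnZ n W - lnZ n V] between the averages of [W - V] under the
    two Gibbs measures. These averages differ by a term of order [d * d] according to
    [gibbs_lipschitz]. *)
Lemma lnZ_taylor n V W d : admissible n V -> admissible n W -> (forall z, Rabs (W z - V z) <= d) ->
  Rabs (lnZ n W - lnZ n V - gibbs n V (fun z => W z - V z)) <= d * (2 * d * exp (2 * d)).
Proof.
  intros HV HW Hd.
  assert (HD : nice n (fun z => W z - V z)) by (apply nice_minus; now apply adm_nice).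
  pose proof (gibbs_jensen n V W HV HW) as J1. pose proof (gibbs_jensen n W V HW HV) as J2.
  rewrite (gibbs_ext n W _ (fun z => -1 * (W z - V z))) in J2 by (intros; ring).
  rewrite gibbs_scal in J2 by auto.
  pose proof (gibbs_lipschitz n W V (fun z => W z - V z) d d HW HV HD Hd Hd) as L.
  apply Rabs_le_between in L. apply Rabs_le. lra.
Qed.

Lemma adm_add_bounded n V f B : admissible n V -> nice n f -> (forall z, Rabs (f z) <= B) ->
  admissible n (fun z => V z + f z).
Proof.
  intros [HV [c Hc]] Hf HB. split; [now apply nice_plus|]. exists (c + B). intros z.
  specialize (Hc z). specialize (HB z). apply Rabs_le_between in HB. lra.
Qed.

(** The tilt is centred at [t0] because changing the disorder coordinate [k] of [wick] from [J k] to
    [t] adds exactly [(t - J k) * phi k z]. *)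
Lemma is_derive_gexp_tilt n V phi psi B t0 : admissible n V -> nice n phi -> nice n psi ->
  (forall z, Rabs (phi z) <= B) -> (forall z, Rabs (psi z) <= B) ->
  is_derive (fun t => gexp n (fun z => psi z * exp (V z + (t - t0) * phi z))) t0
    (gexp n (fun z => psi z * phi z * exp (V z))).
Proof.
  intros HV Hphi Hpsi Bphi Bpsi.
  assert (HB : 0 <= B) by (specialize (Bphi (fun _ => 0)); pose proof (Rabs_pos (phi (fun _ => 0))); lra).
  apply (is_derive_gexp n (fun t z => psi z * exp (V z + (t - t0) * phi z)) _
           (* One factor [B] bounds [psi]; the factor [B * B * exp B] is the second-order remainder
              of [exp (s * phi z)] for [Rabs s <= 1]. *)
           (fun z => B * (B * B * exp B) * exp (V z))).
  - intros t. apply nice_mult_exp; auto.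
    apply (adm_add_bounded _ _ (fun z => (t - t0) * phi z) (Rabs (t - t0) * B)); auto using nice_scal.
    intros z. rewrite Rabs_mult. apply Rmult_le_compat_l; auto using Rabs_pos.
  - apply nice_mult_exp; auto using nice_mult.
  - apply nice_scal. now apply adm_nice_exp.
  - intros s z Hs.
    replace (t0 + s - t0) with s by ring. rewrite Rminus_diag, Rmult_0_l, Rplus_0_r, exp_plus.
    replace (psi z * (exp (V z) * exp (s * phi z)) - psi z * exp (V z) - s * (psi z * phi z * exp (V z)))
      with (psi z * exp (V z) * (exp (s * phi z) - 1 - s * phi z)) by ring.
    pose proof (exp_taylor2 (s * phi z)) as T. pose proof (exp_pos (V z)).
    specialize (Bphi z). specialize (Bpsi z).
    pose proof (Rabs_pos (phi z)). pose proof (Rabs_pos (psi z)).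
    rewrite !Rabs_mult, (Rabs_pos_eq (exp (V z))) by lra.
    assert (Hsp : Rabs (s * phi z) <= B) by (rewrite Rabs_mult; pose proof (Rabs_pos s); nra).
    apply exp_mono in Hsp.
    assert (Hsq : phi z * phi z <= B * B).
    { rewrite <- (Rabs_pos_eq (phi z * phi z)) by apply Rle_0_sqr. rewrite Rabs_mult. nra. }
    assert (T' : Rabs (exp (s * phi z) - 1 - s * phi z) <= s * s * (B * B * exp B)).
    { eapply Rle_trans; [apply T|].
      replace (s * phi z * (s * phi z) * exp (Rabs (s * phi z)))
        with (s * s * (phi z * phi z * exp (Rabs (s * phi z)))) by ring.
      apply Rmult_le_compat_l; [apply Rle_0_sqr|].
      apply Rmult_le_compat; auto; [apply Rle_0_sqr|left; apply exp_pos]. }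
    replace (B * (B * B * exp B) * exp (V z) * (s * s)) with (B * exp (V z) * (s * s * (B * B * exp B))) by ring.
    apply Rmult_le_compat; auto using Rabs_pos; [apply Rmult_le_pos; lra|].
    apply Rmult_le_compat_r; lra.
Qed.

Lemma is_derive_gibbs_tilt n V phi psi B t0 : admissible n V -> nice n phi -> nice n psi ->
  (forall z, Rabs (phi z) <= B) -> (forall z, Rabs (psi z) <= B) ->
  is_derive (fun t => gibbs n (fun z => V z + (t - t0) * phi z) psi) t0
    (gibbs n V (fun z => psi z * phi z) - gibbs n V psi * gibbs n V phi).
Proof.
  intros HV Hphi Hpsi Bphi Bpsi.
  pose proof (is_derive_gexp_tilt n V phi psi B t0 HV Hphi Hpsi Bphi Bpsi) as D1.
  assert (D2 : is_derive (fun t => gexp n (fun z => exp (V z + (t - t0) * phi z))) t0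
    (gexp n (fun z => phi z * exp (V z)))).
  { pose proof (is_derive_gexp_tilt n V phi (fun _ => 1) (Rmax 1 B) t0 HV Hphi (nice_const n 1)) as D.
    replace (fun z => phi z * exp (V z)) with (fun z => 1 * phi z * exp (V z))
      by (apply functional_extensionality; intros; ring).
    refine (is_derive_ext (K := R_AbsRing) (V := R_NormedModule) _ _ _ _ _ (D _ _)).
    - intros t. apply gexp_ext. intros z. ring.
    - intros z. eapply Rle_trans; [apply Bphi|apply Rmax_r].
    - intros z. rewrite Rabs_R1. apply Rmax_l. }
  assert (E : forall z, V z + (t0 - t0) * phi z = V z) by (intros; ring).
  assert (E1 : gexp n (fun z => exp (V z + (t0 - t0) * phi z)) = gexp n (fun z => exp (V z)))
    by (apply gexp_ext; intros; now rewrite E).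
  assert (E2 : gexp n (fun z => psi z * exp (V z + (t0 - t0) * phi z)) = gexp n (fun z => psi z * exp (V z)))
    by (apply gexp_ext; intros; now rewrite E).
  pose proof (adm_pos n V HV) as HZ.
  evar_last.
  - apply (is_derive_div _ _ _ _ _ D1 D2). rewrite E1. lra.
  - rewrite E1, E2. unfold gibbs. field. lra.
Qed.

(** * Comparison of Wick-ordered Gaussian fields *)

(** The field is given by finitely many features [phi k], one per independent Gaussian [J k]. Its
    covariance is the sum of [phi k z * phi k z'], and integration by parts in the disorder is done
    one feature at a time. *)
Definition wick (m : nat) (phi : nat -> (nat -> R) -> R) (w : (nat -> R) -> R) (J z : nat -> R) : R :=
  w z + sumN m (fun k => J k * phi k z - phi k z * phi k z / 2).

Definition bounded_features (n m : nat) (B : R) (phi : nat -> (nat -> R) -> R) : Prop :=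
  forall k, (k < m)%nat -> nice n (phi k) /\ forall z, Rabs (phi k z) <= B.

Lemma Rabs_mult_le a b A B : Rabs a <= A -> Rabs b <= B -> Rabs (a * b) <= A * B.
Proof. intros. rewrite Rabs_mult. apply Rmult_le_compat; auto using Rabs_pos. Qed.

Lemma wick_admissible n m B phi w J : bounded_features n m B phi -> admissible n w ->
  admissible n (wick m phi w J).
Proof.
  intros Hphi Hw.
  apply (adm_add_bounded n w (fun z => sumN m (fun k => J k * phi k z - phi k z * phi k z / 2))
           (sumN m (fun k => Rabs (J k) * B + B * B / 2))); auto.
  - apply (nice_sum n m (fun k z => J k * phi k z - phi k z * phi k z / 2)). intros k Hk.
    destruct (Hphi k Hk) as [H1 _].
    apply (nice_ext _ (fun z => J k * phi k z + (- / 2) * (phi k z * phi k z))); [intros; field|].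
    auto using nice_lin, nice_mult.
  - intros z. eapply Rle_trans; [apply sumN_abs|]. apply sumN_le. intros k Hk.
    destruct (Hphi k Hk) as [_ H2]. specialize (H2 z).
    pose proof (Rabs_mult_le _ _ _ _ (Rle_refl (Rabs (J k))) H2) as A1.
    pose proof (Rabs_mult_le _ _ _ _ H2 H2) as A2.
    apply Rabs_le_between in A1, A2. apply Rabs_le. lra.
Qed.

Lemma wick_lipschitz n m B phi w J J' z : bounded_features n m B phi ->
  Rabs (wick m phi w J z - wick m phi w J' z) <= B * nrm m (fun k => J k - J' k).
Proof.
  intros Hphi. unfold wick.
  replace (w z + sumN m (fun k => J k * phi k z - phi k z * phi k z / 2) -
     (w z + sumN m (fun k => J' k * phi k z - phi k z * phi k z / 2))) with
     (sumN m (fun k => (J k * phi k z - phi k z * phi k z / 2) - (J' k * phi k z - phi k z * phi k z / 2)))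
    by (rewrite sumN_minus; ring).
  eapply Rle_trans; [apply sumN_abs|]. unfold nrm. rewrite <- sumN_scal. apply sumN_le. intros k Hk.
  replace (J k * phi k z - phi k z * phi k z / 2 - (J' k * phi k z - phi k z * phi k z / 2))
    with (phi k z * (J k - J' k)) by ring.
  apply Rabs_mult_le; [now apply (Hphi k Hk)|lra].
Qed.

Lemma nice_lnZ_wick n m B phi w : bounded_features n m B phi -> admissible n w ->
  nice m (fun J => lnZ n (wick m phi w J)).
Proof.
  intros Hphi Hw. apply (nice_lipschitz _ _ B). intros J J'.
  apply lnZ_lipschitz; eauto using wick_admissible, wick_lipschitz.
Qed.

Lemma nice_gibbs_wick n m B phi w psi B' : bounded_features n m B phi -> admissible n w ->
  nice n psi -> (forall z, Rabs (psi z) <= B') -> nice m (fun J => gibbs n (wick m phi w J) psi).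
Proof.
  intros Hphi Hw Hpsi Bpsi. apply (nice_intro _ _ (2 * Rabs B' * Rabs B) (2 * Rabs B)). intros J J'.
  (* With no features, [B] has no prescribed sign, hence the passage to [Rabs B]. *)
  assert (Hphi' : bounded_features n m (Rabs B) phi).
  { intros k Hk. destruct (Hphi k Hk). split; auto. intros z.
    eapply Rle_trans; [eauto|apply Rle_abs]. }
  eapply Rle_trans.
  - apply (gibbs_lipschitz n _ _ psi (Rabs B') (Rabs B * nrm m (fun k => J k - J' k)));
      eauto using wick_admissible, wick_lipschitz.
    intros z. eapply Rle_trans; [apply Bpsi|apply Rle_abs].
  - pose proof (nrm_minus_le m J J'). pose proof (nrm_pos m (fun k => J k - J' k)).
    pose proof (Rabs_pos B). pose proof (Rabs_pos B').
    pose proof (exp_mono (2 * (Rabs B * nrm m (fun k => J k - J' k)))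
      (2 * Rabs B * (1 + nrm m J + nrm m J')) ltac:(nra)) as E.
    replace (Rabs B' * (2 * (Rabs B * nrm m (fun k => J k - J' k)) * exp (2 * (Rabs B * nrm m (fun k => J k - J' k)))))
      with (2 * Rabs B' * Rabs B * nrm m (fun k => J k - J' k) * exp (2 * (Rabs B * nrm m (fun k => J k - J' k)))) by ring.
    rewrite (Rmult_assoc _ (exp _)), (Rmult_comm (exp (2 * Rabs B * _))), <- (Rmult_assoc _ _ (exp _)).
    apply Rmult_le_compat_l; auto.
    repeat apply Rmult_le_pos; lra.
Qed.

Lemma sumN_upd m k (f : nat -> R -> R) J t : (k < m)%nat ->
  sumN m (fun i => f i (upd J k t i)) = sumN m (fun i => f i (J i)) + (f k t - f k (J k)).
Proof.
  induction m; intros Hk; [lia|]. simpl.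
  destruct (Nat.eq_dec k m) as [->|].
  - rewrite upd_same. rewrite (sumN_ext m _ (fun i => f i (J i))); [ring|].
    intros i Hi. unfold upd. destruct (Nat.eq_dec i m); [lia|reflexivity].
  - rewrite IHm by lia. unfold upd at 1. destruct (Nat.eq_dec m k); [lia|ring].
Qed.

Lemma wick_upd m phi w J k t z : (k < m)%nat ->
  wick m phi w (upd J k t) z = wick m phi w J z + (t - J k) * phi k z.
Proof.
  intros Hk. unfold wick.
  rewrite (sumN_upd m k (fun i x => x * phi i z - phi i z * phi i z / 2)) by auto. ring.
Qed.

(** Varying [J k] tilts the potential by [phi k], so the derivative of a Gibbs average is its
    covariance with [phi k]. *)
Lemma gibbs_wick_ibp n m B phi w psi B' k : bounded_features n m B phi -> admissible n w ->
  nice n psi -> (forall z, Rabs (psi z) <= B') -> (k < m)%nat ->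
  gexp m (fun J => J k * gibbs n (wick m phi w J) psi) =
  gexp m (fun J => gibbs n (wick m phi w J) (fun z => psi z * phi k z)
                   - gibbs n (wick m phi w J) psi * gibbs n (wick m phi w J) (phi k)).
Proof.
  intros Hphi Hw Hpsi Bpsi Hk. destruct (Hphi k Hk) as [Nk Bk].
  apply (gexp_ibp m k (fun J => gibbs n (wick m phi w J) psi)); auto.
  - now apply (nice_gibbs_wick n m B phi w psi B').
  - apply nice_minus; [|apply nice_mult].
    + apply (nice_gibbs_wick n m B phi w _ (B' * B)); auto using nice_mult.
      intros z. now apply Rabs_mult_le.
    + now apply (nice_gibbs_wick n m B phi w psi B').
    + now apply (nice_gibbs_wick n m B phi w _ B).
  - intros J.
    refine (is_derive_ext (K := R_AbsRing) (V := R_NormedModule) _ _ _ _ _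
       (is_derive_gibbs_tilt n (wick m phi w J) (phi k) psi (Rmax B B') (J k) _ Nk Hpsi _ _)).
    + intros t. simpl. f_equal. apply functional_extensionality. intros z. now rewrite wick_upd.
    + eapply wick_admissible; eauto.
    + intros z. eapply Rle_trans; [apply Bk|apply Rmax_l].
    + intros z. eapply Rle_trans; [apply Bpsi|apply Rmax_r].
Qed.

(** * Interpolation by rotating one feature family into another *)

Lemma sin_cos_lipschitz x y : Rabs (sin x - sin y) <= Rabs (x - y) /\ Rabs (cos x - cos y) <= Rabs (x - y).
Proof.
  split.
  - destruct (MVT_gen sin y x cos) as [c [_ E]].
    + intros t _. apply is_derive_sin.
    + intros t _. apply continuity_sin.
    + rewrite E, Rabs_mult. pose proof (COS_bound c). pose proof (Rabs_pos (x - y)).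
      assert (Rabs (cos c) <= 1) by (apply Rabs_le; lra). nra.
  - destruct (MVT_gen cos y x (fun t => - sin t)) as [c [_ E]].
    + intros t _. apply is_derive_cos.
    + intros t _. apply continuity_cos.
    + rewrite E, Rabs_mult. pose proof (SIN_bound c). pose proof (Rabs_pos (x - y)).
      assert (Rabs (- sin c) <= 1) by (apply Rabs_le; lra). nra.
Qed.

Lemma sin_cos_taylor x s : Rabs (sin (x + s) - sin x - s * cos x) <= s * s /\
  Rabs (cos (x + s) - cos x + s * sin x) <= s * s.
Proof.
  assert (Hss : s * s = Rabs s * Rabs s) by apply sqr_Rabs.
  split.
  - destruct (MVT_gen sin x (x + s) cos) as [c [Hc E]].
    + intros t _. apply is_derive_sin.
    + intros t _. apply continuity_sin.
    + rewrite E. replace (cos c * (x + s - x) - s * cos x) with (s * (cos c - cos x)) by ring.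
      rewrite Hss. apply Rabs_mult_le; [lra|].
      eapply Rle_trans; [apply sin_cos_lipschitz|]. now apply between_dist.
  - destruct (MVT_gen cos x (x + s) (fun t => - sin t)) as [c [Hc E]].
    + intros t _. apply is_derive_cos.
    + intros t _. apply continuity_cos.
    + rewrite E. replace (- sin c * (x + s - x) + s * sin x) with (- (s * (sin c - sin x))) by ring.
      rewrite Rabs_Ropp, Hss. apply Rabs_mult_le; [lra|].
      eapply Rle_trans; [apply sin_cos_lipschitz|]. now apply between_dist.
Qed.

(** Trigonometric weights keep squared weights summing to 1 and are smooth at both endpoints,
    whereas interpolation with [sqrt t] and [sqrt (1 - t)] has singular derivatives there. *)
Definition rotate (a b : nat -> (nat -> R) -> R) (theta : R) : nat -> (nat -> R) -> R :=
  fun k z => sin theta * a k z + cos theta * b k z.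

Definition rotate' (a b : nat -> (nat -> R) -> R) (theta : R) : nat -> (nat -> R) -> R :=
  fun k z => cos theta * a k z + - sin theta * b k z.

Lemma rotate_bounded n m B a b theta : bounded_features n m B a -> bounded_features n m B b ->
  bounded_features n m (2 * B) (rotate a b theta) /\ bounded_features n m (2 * B) (rotate' a b theta).
Proof.
  intros Ha Hb.
  assert (W : forall u v, Rabs u <= 1 -> Rabs v <= 1 ->
    bounded_features n m (2 * B) (fun k z => u * a k z + v * b k z)).
  { intros u v Hu Hv k Hk. destruct (Ha k Hk) as [Na Ba]. destruct (Hb k Hk) as [Nb Bb].
    split; [now apply nice_lin|]. intros z.
    eapply Rle_trans; [apply Rabs_triang|].
    pose proof (Rabs_mult_le _ _ _ _ Hu (Ba z)). pose proof (Rabs_mult_le _ _ _ _ Hv (Bb z)). lra. }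
  pose proof (SIN_bound theta). pose proof (COS_bound theta).
  split; apply W; apply Rabs_le; lra.
Qed.

Lemma rotate_taylor a b theta s k z B : Rabs (a k z) <= B -> Rabs (b k z) <= B ->
  Rabs (rotate a b (theta + s) k z - rotate a b theta k z) <= 2 * B * Rabs s /\
  Rabs (rotate a b (theta + s) k z - rotate a b theta k z - s * rotate' a b theta k z) <= 2 * B * (s * s).
Proof.
  intros Ha Hb. unfold rotate, rotate'.
  destruct (sin_cos_lipschitz (theta + s) theta) as [S1 C1]. replace (theta + s - theta) with s in * by ring.
  destruct (sin_cos_taylor theta s) as [S2 C2].
  split.
  - replace (sin (theta + s) * a k z + cos (theta + s) * b k z - (sin theta * a k z + cos theta * b k z))
      with ((sin (theta + s) - sin theta) * a k z + (cos (theta + s) - cos theta) * b k z) by ring.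
    eapply Rle_trans; [apply Rabs_triang|].
    pose proof (Rabs_mult_le _ _ _ _ S1 Ha). pose proof (Rabs_mult_le _ _ _ _ C1 Hb). lra.
  - replace (sin (theta + s) * a k z + cos (theta + s) * b k z - (sin theta * a k z + cos theta * b k z) -
      s * (cos theta * a k z + - sin theta * b k z))
      with ((sin (theta + s) - sin theta - s * cos theta) * a k z
            + (cos (theta + s) - cos theta + s * sin theta) * b k z) by ring.
    eapply Rle_trans; [apply Rabs_triang|].
    pose proof (Rabs_mult_le _ _ _ _ S2 Ha). pose proof (Rabs_mult_le _ _ _ _ C2 Hb). lra.
Qed.

(** The derivative of [wick] along a path of features with velocity [phi']; the fixed part [w] drops
    out. *)
Definition wick' (m : nat) (phi phi' : nat -> (nat -> R) -> R) (J z : nat -> R) : R :=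
  sumN m (fun k => J k * phi' k z - phi k z * phi' k z).

Lemma wick_rotate_taylor n m B a b w theta s J z :
  bounded_features n m B a -> bounded_features n m B b -> 0 <= B ->
  Rabs (wick m (rotate a b (theta + s)) w J z - wick m (rotate a b theta) w J z)
    <= Rabs s * (2 * B * nrm m J + 6 * B * B * INR m) /\
  Rabs (wick m (rotate a b (theta + s)) w J z - wick m (rotate a b theta) w J z
        - s * wick' m (rotate a b theta) (rotate' a b theta) J z)
    <= (s * s) * (2 * B * nrm m J + 6 * B * B * INR m).
Proof.
  intros Ha Hb HB. unfold wick, wick'.
  set (p := rotate a b (theta + s)). set (q := rotate a b theta). set (q' := rotate' a b theta).
  assert (Hss : s * s = Rabs s * Rabs s) by apply sqr_Rabs.
  pose proof (Rabs_pos s) as Hs0.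
  assert (T : forall k, (k < m)%nat ->
     Rabs (p k z) <= 2 * B /\ Rabs (q k z) <= 2 * B /\ Rabs (p k z - q k z) <= 2 * B * Rabs s /\
     Rabs (p k z - q k z - s * q' k z) <= 2 * B * (s * s)).
  { intros k Hk. split; [|split].
    - now apply (rotate_bounded n m B a b (theta + s) Ha Hb).
    - now apply (rotate_bounded n m B a b theta Ha Hb).
    - apply rotate_taylor; [now apply Ha|now apply Hb]. }
  assert (Hrhs : 2 * B * nrm m J + 6 * B * B * INR m = sumN m (fun k => 2 * B * Rabs (J k) + 6 * B * B)).
  { rewrite sumN_plus, sumN_scal, sumN_const. unfold nrm. ring. }
  rewrite Hrhs. split.
  - replace (w z + sumN m (fun k => J k * p k z - p k z * p k z / 2) -
       (w z + sumN m (fun k => J k * q k z - q k z * q k z / 2))) with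
      (sumN m (fun k => (J k * p k z - p k z * p k z / 2) - (J k * q k z - q k z * q k z / 2)))
      by (rewrite sumN_minus; ring).
    eapply Rle_trans; [apply sumN_abs|]. rewrite <- sumN_scal. apply sumN_le. intros k Hk.
    destruct (T k Hk) as [T1 [T2 [T3 _]]].
    replace (J k * p k z - p k z * p k z / 2 - (J k * q k z - q k z * q k z / 2))
      with (J k * (p k z - q k z) + - (/ 2 * ((p k z - q k z) * (p k z + q k z)))) by field.
    eapply Rle_trans; [apply Rabs_triang|]. rewrite Rabs_Ropp, (Rabs_mult (/ 2)), (Rabs_pos_eq (/ 2)) by lra.
    pose proof (Rabs_mult_le _ _ _ _ (Rle_refl (Rabs (J k))) T3).
    assert (T4 : Rabs (p k z + q k z) <= 4 * B) by (eapply Rle_trans; [apply Rabs_triang|lra]).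
    pose proof (Rabs_mult_le _ _ _ _ T3 T4). pose proof (Rabs_pos (J k)).
    assert (0 <= B * B * Rabs s) by (repeat apply Rmult_le_pos; lra). nra.
  - replace (w z + sumN m (fun k => J k * p k z - p k z * p k z / 2) -
       (w z + sumN m (fun k => J k * q k z - q k z * q k z / 2)) -
       s * sumN m (fun k => J k * q' k z - q k z * q' k z)) with
      (sumN m (fun k => (J k * p k z - p k z * p k z / 2) - (J k * q k z - q k z * q k z / 2)
          - s * (J k * q' k z - q k z * q' k z)))
      by (rewrite !sumN_minus, sumN_scal, sumN_minus; ring).
    eapply Rle_trans; [apply sumN_abs|]. rewrite <- sumN_scal. apply sumN_le. intros k Hk.
    destruct (T k Hk) as [T1 [T2 [T3 T4]]].
    (* The squares are expanded as [q * (p - q - s * q') + (p - q)^2 / 2]. Against [s * s], these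
       cost [4 * B * B] and [2 * B * B], whence the constant 6. *)
    replace (J k * p k z - p k z * p k z / 2 - (J k * q k z - q k z * q k z / 2) - s * (J k * q' k z - q k z * q' k z))
      with (J k * (p k z - q k z - s * q' k z) +
            (- (q k z * (p k z - q k z - s * q' k z)) + - (/ 2 * ((p k z - q k z) * (p k z - q k z))))) by field.
    eapply Rle_trans; [apply Rabs_triang|].
    eapply Rle_trans; [apply Rplus_le_compat_l, Rabs_triang|].
    rewrite !Rabs_Ropp, (Rabs_mult (/ 2)), (Rabs_pos_eq (/ 2)) by lra.
    pose proof (Rabs_mult_le _ _ _ _ (Rle_refl (Rabs (J k))) T4).
    pose proof (Rabs_mult_le _ _ _ _ T2 T4). pose proof (Rabs_mult_le _ _ _ _ T3 T3) as T5.
    replace (2 * B * Rabs s * (2 * B * Rabs s)) with (4 * B * B * (s * s)) in T5 by (rewrite Hss; ring).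
    nra.
Qed.

Lemma nice_wick' n m B phi phi' J : bounded_features n m B phi -> bounded_features n m B phi' ->
  nice n (wick' m phi phi' J).
Proof.
  intros H H'. apply (nice_sum n m (fun k z => J k * phi' k z - phi k z * phi' k z)). intros k Hk.
  destruct (H k Hk). destruct (H' k Hk). auto using nice_minus, nice_scal, nice_mult.
Qed.

Lemma gibbs_wick' n m B phi phi' J V : bounded_features n m B phi -> bounded_features n m B phi' ->
  admissible n V -> gibbs n V (wick' m phi phi' J) =
  sumN m (fun k => J k * gibbs n V (phi' k) - gibbs n V (fun z => phi' k z * phi k z)).
Proof.
  intros H H' HV. unfold wick'.
  rewrite (gibbs_sum n V m (fun k z => J k * phi' k z - phi k z * phi' k z)); auto.
  - apply sumN_ext. intros k Hk. destruct (H k Hk). destruct (H' k Hk).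
    rewrite gibbs_minus by auto using nice_scal, nice_mult. rewrite gibbs_scal by auto.
    f_equal. apply gibbs_ext. intros; ring.
  - intros k Hk. destruct (H k Hk). destruct (H' k Hk). auto using nice_minus, nice_scal, nice_mult.
Qed.

Lemma bounded_features_mult n m B phi phi' : bounded_features n m B phi -> bounded_features n m B phi' ->
  bounded_features n m (B * B) (fun k z => phi' k z * phi k z).
Proof.
  intros H H' k Hk. destruct (H k Hk). destruct (H' k Hk). split; auto using nice_mult.
  intros z. now apply Rabs_mult_le.
Qed.

Lemma nice_gibbs_wick' n m B phi phi' w : bounded_features n m B phi -> bounded_features n m B phi' ->
  admissible n w -> nice m (fun J => gibbs n (wick m phi w J) (wick' m phi phi' J)).
Proof.
  intros H H' Hw.
  apply (nice_ext _ (fun J => sumN m (fun k => J k * gibbs n (wick m phi w J) (phi' k)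
      - gibbs n (wick m phi w J) (fun z => phi' k z * phi k z)))).
  - intros J. symmetry. eapply gibbs_wick'; eauto using wick_admissible.
  - apply (nice_sum m m (fun k J => J k * gibbs n (wick m phi w J) (phi' k)
      - gibbs n (wick m phi w J) (fun z => phi' k z * phi k z))).
    intros k Hk. pose proof (bounded_features_mult n m B phi phi' H H' k Hk) as [Np Bp].
    destruct (H' k Hk) as [N' B'].
    apply nice_minus; [apply nice_mult; [now apply nice_coord|]|].
    + now apply (nice_gibbs_wick n m B phi w _ B).
    + now apply (nice_gibbs_wick n m B phi w _ (B * B)).
Qed.

(** Integration by parts against [J k] gives the covariance of [phi' k] and [phi k]. The mean of
    their product cancels the Wick correction in [wick'], and only the product of the two means
    remains. *)
Lemma gexp_gibbs_wick' n m B phi phi' w : bounded_features n m B phi -> bounded_features n m B phi' ->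
  admissible n w ->
  gexp m (fun J => gibbs n (wick m phi w J) (wick' m phi phi' J)) =
  gexp m (fun J => - sumN m (fun k => gibbs n (wick m phi w J) (phi' k) * gibbs n (wick m phi w J) (phi k))).
Proof.
  intros H H' Hw.
  assert (Ng : forall k, (k < m)%nat -> nice m (fun J => gibbs n (wick m phi w J) (phi' k))
     /\ nice m (fun J => gibbs n (wick m phi w J) (phi k))
     /\ nice m (fun J => gibbs n (wick m phi w J) (fun z => phi' k z * phi k z))).
  { intros k Hk. pose proof (bounded_features_mult n m B phi phi' H H' k Hk) as [Np Bp].
    destruct (H k Hk). destruct (H' k Hk). repeat split.
    - now apply (nice_gibbs_wick n m B phi w _ B).
    - now apply (nice_gibbs_wick n m B phi w _ B).
    - now apply (nice_gibbs_wick n m B phi w _ (B * B)). }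
  transitivity (gexp m (fun J => sumN m (fun k => J k * gibbs n (wick m phi w J) (phi' k)
      - gibbs n (wick m phi w J) (fun z => phi' k z * phi k z)))).
  { apply gexp_ext. intros J. eapply gibbs_wick'; eauto using wick_admissible. }
  transitivity (gexp m (fun J => sumN m (fun k => -1 * (gibbs n (wick m phi w J) (phi' k) * gibbs n (wick m phi w J) (phi k))))).
  2:{ apply gexp_ext. intros J. rewrite sumN_scal. ring. }
  rewrite (gexp_sum m m (fun k J => J k * gibbs n (wick m phi w J) (phi' k)
      - gibbs n (wick m phi w J) (fun z => phi' k z * phi k z))).
  2:{ intros k Hk. destruct (Ng k Hk) as [? [? ?]]. auto using nice_minus, nice_mult, nice_coord. }
  rewrite (gexp_sum m m (fun k J => -1 * (gibbs n (wick m phi w J) (phi' k) * gibbs n (wick m phi w J) (phi k)))).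
  2:{ intros k Hk. destruct (Ng k Hk) as [? [? ?]]. auto using nice_scal, nice_mult. }
  apply sumN_ext. intros k Hk. destruct (Ng k Hk) as [N1 [N2 N3]]. destruct (H' k Hk) as [N' B'].
  rewrite gexp_minus by auto using nice_mult, nice_coord.
  rewrite (gibbs_wick_ibp n m B phi w (phi' k) B k) by auto.
  rewrite gexp_minus by auto using nice_mult. rewrite gexp_scal by auto using nice_mult. ring.
Qed.

(** The pointwise inequality is averaged over two independent replicas, one after the other: [S1]
    averages one variable with the other frozen, [S2] averages the second. The constant [c] is
    unaffected. *)
Lemma gibbs_covariance_le n m B a b V c : bounded_features n m B a -> bounded_features n m B b ->
  admissible n V ->
  (forall z z', sumN m (fun k => a k z * a k z') <= sumN m (fun k => b k z * b k z') + c) ->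
  sumN m (fun k => gibbs n V (a k) * gibbs n V (a k)) <= sumN m (fun k => gibbs n V (b k) * gibbs n V (b k)) + c.
Proof.
  intros Ha Hb HV Hc.
  assert (N : forall u v, nice n (fun z => sumN m (fun k => u k * a k z - v k * b k z))).
  { intros u v. apply (nice_sum n m (fun k z => u k * a k z - v k * b k z)). intros k Hk.
    destruct (Ha k Hk). destruct (Hb k Hk). auto using nice_minus, nice_scal. }
  assert (E : forall u v, gibbs n V (fun z => sumN m (fun k => u k * a k z - v k * b k z)) =
     sumN m (fun k => u k * gibbs n V (a k) - v k * gibbs n V (b k))).
  { intros u v. rewrite (gibbs_sum n V m (fun k z => u k * a k z - v k * b k z)); auto.
    - apply sumN_ext. intros k Hk. destruct (Ha k Hk). destruct (Hb k Hk).
      rewrite gibbs_minus by auto using nice_scal. now rewrite !gibbs_scal by auto.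
    - intros k Hk. destruct (Ha k Hk). destruct (Hb k Hk). auto using nice_minus, nice_scal. }
  assert (S1 : forall z', sumN m (fun k => gibbs n V (a k) * a k z' - gibbs n V (b k) * b k z') <= c).
  { intros z'. rewrite (sumN_ext m _ (fun k => a k z' * gibbs n V (a k) - b k z' * gibbs n V (b k)))
      by (intros; ring).
    rewrite <- (E (fun k => a k z') (fun k => b k z')).
    rewrite <- (gibbs_const n V c) by auto. apply gibbs_le; auto using nice_const.
    intros z. rewrite sumN_minus. specialize (Hc z' z). lra. }
  assert (S2 : sumN m (fun k => gibbs n V (a k) * gibbs n V (a k) - gibbs n V (b k) * gibbs n V (b k)) <= c).
  { rewrite <- (E (fun k => gibbs n V (a k)) (fun k => gibbs n V (b k))).
    rewrite <- (gibbs_const n V c) by auto. apply gibbs_le; auto using nice_const. }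
  rewrite sumN_minus in S2. lra.
Qed.

(** At each index one of [a k], [b k] vanishes, which kills the cross terms. What is left is
    [sin theta * cos theta] times the difference of the two replica overlaps. *)
Lemma rotate_overlap_le n m B a b V c theta :
  bounded_features n m B a -> bounded_features n m B b -> admissible n V ->
  (forall k, (k < m)%nat -> (forall z, a k z = 0) \/ (forall z, b k z = 0)) ->
  (forall z z', sumN m (fun k => a k z * a k z') <= sumN m (fun k => b k z * b k z') + c) ->
  0 <= sin theta -> 0 <= cos theta ->
  sumN m (fun k => gibbs n V (rotate' a b theta k) * gibbs n V (rotate a b theta k)) <= c * (sin theta * cos theta).
Proof.
  intros Ha Hb HV Hd Hc Hs Hcos.
  pose proof (gibbs_covariance_le n m B a b V c Ha Hb HV Hc) as G.
  rewrite (sumN_ext m _ (fun k => (sin theta * cos theta) *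
     (gibbs n V (a k) * gibbs n V (a k) - gibbs n V (b k) * gibbs n V (b k)))).
  - rewrite sumN_scal, sumN_minus.
    assert (0 <= sin theta * cos theta) by now apply Rmult_le_pos. nra.
  - intros k Hk. destruct (Ha k Hk). destruct (Hb k Hk).
    unfold rotate, rotate'. rewrite !gibbs_lin by auto.
    assert (Z : gibbs n V (a k) * gibbs n V (b k) = 0).
    { destruct (Hd k Hk) as [E|E].
      - rewrite (gibbs_ext n V (a k) (fun _ => 0)) by auto. rewrite gibbs_const by auto. ring.
      - rewrite (gibbs_ext n V (b k) (fun _ => 0)) by auto. rewrite gibbs_const by auto. ring. }
    replace ((cos theta * gibbs n V (a k) + - sin theta * gibbs n V (b k)) *
      (sin theta * gibbs n V (a k) + cos theta * gibbs n V (b k))) with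
      (sin theta * cos theta * (gibbs n V (a k) * gibbs n V (a k) - gibbs n V (b k) * gibbs n V (b k))
       + (cos theta * cos theta - sin theta * sin theta) * (gibbs n V (a k) * gibbs n V (b k))) by ring.
    rewrite Z. ring.
Qed.

Lemma is_derive_interpolation n m B a b w theta :
  bounded_features n m B a -> bounded_features n m B b -> 0 <= B -> admissible n w ->
  is_derive (fun t => gexp m (fun J => lnZ n (wick m (rotate a b t) w J))) theta
    (gexp m (fun J => gibbs n (wick m (rotate a b theta) w J)
                        (wick' m (rotate a b theta) (rotate' a b theta) J))).
Proof.
  intros Ha Hb HB Hw.
  assert (Hr := fun t => proj1 (rotate_bounded n m B a b t Ha Hb)).
  assert (Hr' := fun t => proj2 (rotate_bounded n m B a b t Ha Hb)).
  assert (HA := fun t J => wick_admissible n m (2 * B) _ w J (Hr t) Hw).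
  (* [Q J] bounds both the first-order and the second-order variation of the potential, uniformly in
     [z]. Being affine in [nrm m J], it makes [exp (2 * Q J)] a [nice] function. *)
  set (Q := fun J => 2 * B * nrm m J + 6 * B * B * INR m).
  assert (NQ : nice m Q) by (apply nice_plus; auto using nice_scal, nice_nrm, nice_const).
  assert (NE : nice m (fun J => exp (2 * Q J))).
  { apply (nice_ext _ (fun J => exp (2 * (6 * B * B * INR m) + 4 * B * nrm m J))).
    - intros J. f_equal. unfold Q. ring.
    - apply nice_exp_nrm. }
  apply (is_derive_gexp m (fun t J => lnZ n (wick m (rotate a b t) w J)) _
           (* The first summand is the error of [lnZ_taylor] with [d = Rabs s * Q J]; the second is
              the error of replacing the increment of the potential by [s] times its derivative. *)
           (fun J => 2 * (Q J * Q J * exp (2 * Q J)) + Q J)).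
  - intros t. now apply (nice_lnZ_wick n m (2 * B)).
  - now apply (nice_gibbs_wick' n m (2 * B)).
  - auto using nice_plus, nice_scal, nice_mult.
  - intros s J Hs.
    assert (HQ : 0 <= Q J).
    { unfold Q. pose proof (nrm_pos m J). pose proof (pos_INR m).
      apply Rplus_le_le_0_compat; repeat apply Rmult_le_pos; lra. }
    assert (T1 := fun z => proj1 (wick_rotate_taylor n m B a b w theta s J z Ha Hb HB)).
    assert (T2 := fun z => proj2 (wick_rotate_taylor n m B a b w theta s J z Ha Hb HB)).
    fold (Q J) in T1, T2.
    pose proof (lnZ_taylor n _ _ _ (HA theta J) (HA (theta + s) J) T1) as L.
    set (V := wick m (rotate a b theta) w J) in *. set (W := wick m (rotate a b (theta + s)) w J) in *.
    set (V' := wick' m (rotate a b theta) (rotate' a b theta) J) in *.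
    assert (NV' : nice n V') by (apply (nice_wick' n m (2 * B)); auto).
    assert (NVW : nice n (fun z => W z - V z)) by (apply nice_minus; apply adm_nice; apply HA).
    pose proof (gibbs_abs_le n V (fun z => W z - V z - s * V' z) (s * s * Q J) (HA theta J)) as G.
    rewrite gibbs_minus, gibbs_scal in G by (auto using nice_scal || apply HA).
    specialize (G ltac:(auto using nice_minus, nice_scal) T2).
    assert (Hss : s * s = Rabs s * Rabs s) by apply sqr_Rabs.
    pose proof (Rabs_pos s) as Hs0.
    assert (Hexp : exp (2 * (Rabs s * Q J)) <= exp (2 * Q J)) by (apply exp_mono; nra).
    assert (L' : Rabs s * Q J * (2 * (Rabs s * Q J) * exp (2 * (Rabs s * Q J)))
                  <= 2 * (Q J * Q J * exp (2 * Q J)) * (s * s)).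
    { rewrite Hss. replace (Rabs s * Q J * (2 * (Rabs s * Q J) * exp (2 * (Rabs s * Q J))))
        with (2 * (Q J * Q J) * (Rabs s * Rabs s) * exp (2 * (Rabs s * Q J))) by ring.
      replace (2 * (Q J * Q J * exp (2 * Q J)) * (Rabs s * Rabs s))
        with (2 * (Q J * Q J) * (Rabs s * Rabs s) * exp (2 * Q J)) by ring.
      apply Rmult_le_compat_l; auto. repeat apply Rmult_le_pos; lra. }
    apply Rabs_le_between in L, G. apply Rabs_le. lra.
Qed.

(* Kahane's comparison for the logarithm.  The rotation [sin t * a + cos t * b] moves the covariance from that
   of [b] to that of [a]; the Wick terms cancel the diagonal, so that the derivative only sees the overlap
   of two independent replicas. *)
Theorem wick_comparison n m B a b w c :
  bounded_features n m B a -> bounded_features n m B b -> admissible n w ->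
  (forall k, (k < m)%nat -> (forall z, a k z = 0) \/ (forall z, b k z = 0)) ->
  (forall z z', sumN m (fun k => a k z * a k z') <= sumN m (fun k => b k z * b k z') + c) ->
  gexp m (fun J => lnZ n (wick m b w J)) <= gexp m (fun J => lnZ n (wick m a w J)) + c / 2.
Proof.
  intros Ha0 Hb0 Hw Hd Hc.
  assert (Ha : bounded_features n m (Rabs B) a).
  { intros k Hk. destruct (Ha0 k Hk). split; auto. intros z. eapply Rle_trans; [eauto|apply Rle_abs]. }
  assert (Hb : bounded_features n m (Rabs B) b).
  { intros k Hk. destruct (Hb0 k Hk). split; auto. intros z. eapply Rle_trans; [eauto|apply Rle_abs]. }
  pose proof (Rabs_pos B) as HB. clear Ha0 Hb0. revert Ha Hb HB. generalize (Rabs B). clear B.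
  intros B Ha Hb HB.
  assert (Hr := fun t => proj1 (rotate_bounded n m B a b t Ha Hb)).
  assert (Hr' := fun t => proj2 (rotate_bounded n m B a b t Ha Hb)).
  set (f := fun t => gexp m (fun J => lnZ n (wick m (rotate a b t) w J))).
  set (f' := fun t => gexp m (fun J => gibbs n (wick m (rotate a b t) w J)
                        (wick' m (rotate a b t) (rotate' a b t) J))).
  (* The term [c / 2 * (sin t * sin t)] offsets the most negative possible slope
     [- (c * (sin t * cos t))], so the sum is nondecreasing on [[0, PI / 2]]. Its total increase is
     the cost [c / 2]. *)
  assert (Df : forall t, is_derive (fun t => f t + c / 2 * (sin t * sin t)) t (f' t + c * (sin t * cos t))).
  { intros t. evar_last.
    - apply (is_derive_plus f (fun t => c / 2 * (sin t * sin t)) t).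
      + now apply (is_derive_interpolation n m B).
      + auto_derive; auto.
    - unfold plus; simpl. unfold f'. field. }
  destruct (MVT_gen (fun t => f t + c / 2 * (sin t * sin t)) 0 (PI / 2) (fun t => f' t + c * (sin t * cos t)))
    as [t [Ht E]].
  - intros t _. apply Df.
  - intros t _. apply continuity_pt_filterlim. exact (continuous_of_derive _ _ _ (Df t)).
  - pose proof PI_RGT_0. rewrite Rmin_left, Rmax_right in Ht by lra.
    assert (Hs : 0 <= sin t) by (apply sin_ge_0; lra).
    assert (Hco : 0 <= cos t) by (apply cos_ge_0; lra).
    assert (Hf' : - (c * (sin t * cos t)) <= f' t).
    { unfold f'. rewrite (gexp_gibbs_wick' n m (2 * B)) by auto.
      rewrite <- (gexp_const m (- (c * (sin t * cos t)))).
      apply gexp_le; [apply nice_const| |].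
      - apply nice_opp. apply (nice_sum m m (fun k J => gibbs n (wick m (rotate a b t) w J) (rotate' a b t k) *
            gibbs n (wick m (rotate a b t) w J) (rotate a b t k))).
        intros k Hk. destruct (Hr t k Hk). destruct (Hr' t k Hk).
        apply nice_mult; now apply (nice_gibbs_wick n m (2 * B) _ w _ (2 * B)).
      - intros J. apply Ropp_le_contravar.
        apply (rotate_overlap_le n m B); auto. eapply wick_admissible; eauto. }
    rewrite sin_0, sin_PI2 in E.
    assert (E1 : f (PI / 2) = gexp m (fun J => lnZ n (wick m a w J))).
    { unfold f. apply gexp_ext. intros J. do 2 f_equal.
      unfold rotate. rewrite sin_PI2, cos_PI2.
      do 2 (apply functional_extensionality; intros). ring. }
    assert (E2 : f 0 = gexp m (fun J => lnZ n (wick m b w J))).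
    { unfold f. apply gexp_ext. intros J. do 2 f_equal.
      unfold rotate. rewrite sin_0, cos_0.
      do 2 (apply functional_extensionality; intros). ring. }
    rewrite E1, E2 in E.
    assert (0 <= (f' t + c * (sin t * cos t)) * (PI / 2 - 0)) by (apply Rmult_le_pos; lra).
    lra.
Qed.

(** * The truncated model *)

(** The disorder is a flat sequence: [k] stands for the ordered pair of its quotient and remainder
    by [N], in agreement with the index [i * N + j] in [exponent]. *)
Definition feat (N : nat) (beta : R) (k : nat) (z : nat -> R) : R :=
  beta / sqrt (2 * INR N) * (z (k / N)%nat * z (k mod N)%nat).

Definition ext_field (N : nat) (beta lam h : R) (z : nat -> R) : R :=
  beta * h * sumN N (fun i => z i) + lam / 2 * sumN N (fun i => z i ^ 2).

(** Projection onto [[- r, r]]; being 1-Lipschitz, it keeps polynomial features in the class [nice]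
    while making them bounded. *)
Definition clamp (r x : R) : R := Rmax (- r) (Rmin r x).

Definition cl (r : R) (z : nat -> R) : nat -> R := fun i => clamp r (z i).

Lemma INR_ge_1 N : (1 <= N)%nat -> 1 <= INR N.
Proof. intros H. apply le_INR in H. simpl in H. lra. Qed.

Lemma sqrt_2N N : (1 <= N)%nat -> 1 <= sqrt (2 * INR N) /\ sqrt (2 * INR N) * sqrt (2 * INR N) = 2 * INR N.
Proof.
  intros H. apply INR_ge_1 in H. split.
  - rewrite <- sqrt_1 at 1. apply sqrt_le_1_alt. lra.
  - apply sqrt_sqrt. lra.
Qed.

Lemma coupling_sqr N beta : (1 <= N)%nat ->
  beta / sqrt (2 * INR N) * (beta / sqrt (2 * INR N)) = beta ^ 2 / (2 * INR N).
Proof.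
  intros H. destruct (sqrt_2N N H) as [H1 H2].
  transitivity (beta ^ 2 / (sqrt (2 * INR N) * sqrt (2 * INR N))); [field; lra|now rewrite H2].
Qed.

Lemma coupling_le N beta : (1 <= N)%nat -> Rabs (beta / sqrt (2 * INR N)) <= Rabs beta.
Proof.
  intros H. destruct (sqrt_2N N H) as [H1 H2].
  unfold Rdiv. rewrite Rabs_mult, Rabs_inv, (Rabs_pos_eq (sqrt _)) by lra.
  rewrite <- (Rmult_1_r (Rabs beta)) at 2. apply Rmult_le_compat_l; [apply Rabs_pos|].
  rewrite <- Rinv_1. apply Rinv_le_contravar; lra.
Qed.

Lemma divmod_index N i j : (j < N)%nat -> ((i * N + j) / N = i)%nat /\ ((i * N + j) mod N = j)%nat.
Proof.
  intros H. split.
  - rewrite Nat.div_add_l by lia. rewrite Nat.div_small by lia. lia.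
  - rewrite Nat.add_comm, Nat.Div0.mod_add. now apply Nat.mod_small.
Qed.

Lemma div_mod_lt N k : (k < N * N)%nat -> (k / N < N)%nat /\ (k mod N < N)%nat.
Proof.
  intros H. split.
  - apply Nat.Div0.div_lt_upper_bound. lia.
  - apply Nat.mod_upper_bound. lia.
Qed.

Lemma sumN_matrix N (f : nat -> nat -> nat -> R) :
  sumN (N * N) (fun k => f k (k / N)%nat (k mod N)%nat) =
  sumN N (fun i => sumN N (fun j => f (i * N + j)%nat i j)).
Proof.
  rewrite sumN_mul. apply sumN_ext. intros i Hi. apply sumN_ext. intros j Hj.
  destruct (divmod_index N i j Hj) as [-> ->]. reflexivity.
Qed.

Lemma sumN_prod N (f g : nat -> R) : sumN N (fun i => sumN N (fun j => f i * g j)) = sumN N f * sumN N g.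
Proof.
  rewrite (sumN_ext N _ (fun i => sumN N g * f i)).
  - rewrite sumN_scal. ring.
  - intros i _. rewrite sumN_scal. ring.
Qed.

Lemma feat_covariance N beta z w : (1 <= N)%nat ->
  sumN (N * N) (fun k => feat N beta k z * feat N beta k w) =
  beta ^ 2 / (2 * INR N) * (sumN N (fun i => z i * w i)) ^ 2.
Proof.
  intros HN. unfold feat.
  rewrite (sumN_matrix N (fun _ i j => beta / sqrt (2 * INR N) * (z i * z j) * (beta / sqrt (2 * INR N) * (w i * w j)))).
  replace ((sumN N (fun i => z i * w i)) ^ 2) with (sumN N (fun i => z i * w i) * sumN N (fun i => z i * w i)) by ring.
  rewrite <- sumN_prod, <- sumN_scal. apply sumN_ext. intros i _.
  rewrite <- sumN_scal. apply sumN_ext. intros j _.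
  rewrite <- coupling_sqr by auto. ring.
Qed.

Lemma exponent_wick N beta lam h J z : (1 <= N)%nat ->
  exponent N beta lam h J z = wick (N * N) (feat N beta) (ext_field N beta lam h) J z.
Proof.
  intros HN. unfold exponent, wick, ext_field.
  rewrite sumN_minus.
  rewrite (sumN_ext (N * N) (fun k => feat N beta k z * feat N beta k z / 2)
             (fun k => / 2 * (feat N beta k z * feat N beta k z))) by (intros; field).
  rewrite sumN_scal, feat_covariance by auto.
  rewrite (sumN_ext N (fun i => z i * z i) (fun i => z i ^ 2)) by (intros; ring).
  assert (E : sumN (N * N) (fun k => J k * feat N beta k z) =
     beta / sqrt (2 * INR N) * sumN N (fun i => sumN N (fun j => J (i * N + j)%nat * z i * z j))).
  { unfold feat.
    rewrite (sumN_matrix N (fun k i j => J k * (beta / sqrt (2 * INR N) * (z i * z j)))).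
    rewrite <- sumN_scal. apply sumN_ext. intros i _.
    rewrite <- sumN_scal. apply sumN_ext. intros j _. ring. }
  rewrite E. pose proof (INR_ge_1 N HN). field.
  destruct (sqrt_2N N HN) as [H1 _]. lra.
Qed.

Lemma clamp_bound r x : 0 <= r -> Rabs (clamp r x) <= r.
Proof.
  intros Hr. unfold clamp. apply Rabs_le. split; [apply Rmax_l|].
  apply Rmax_lub; [lra|apply Rmin_l].
Qed.

Lemma clamp_id r x : Rabs x <= r -> clamp r x = x.
Proof.
  intros H. apply Rabs_le_between in H. unfold clamp.
  rewrite Rmin_right by lra. apply Rmax_right. lra.
Qed.

Lemma clamp_lipschitz r x y : 0 <= r -> Rabs (clamp r x - clamp r y) <= Rabs (x - y).
Proof.
  intros Hr. unfold clamp, Rmax, Rmin.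
  destruct (Rle_dec r x), (Rle_dec r y);
  repeat match goal with |- context [Rle_dec ?a ?b] => destruct (Rle_dec a b) end;
  unfold Rabs; repeat destruct Rcase_abs; lra.
Qed.

Lemma clamp_abs_le r x : 0 <= r -> Rabs (clamp r x) <= Rabs x.
Proof.
  intros Hr. pose proof (clamp_lipschitz r x 0 Hr) as H.
  rewrite (clamp_id r 0), !Rminus_0_r in H; auto. rewrite Rabs_R0; auto.
Qed.

Lemma nice_clamp n r i : 0 <= r -> (i < n)%nat -> nice n (fun z => clamp r (z i)).
Proof.
  intros Hr Hi. apply (nice_lipschitz _ _ 1). intros z z'. rewrite Rmult_1_l.
  eapply Rle_trans; [now apply clamp_lipschitz|].
  apply (nrm_coord n (fun i => z i - z' i)); auto.
Qed.

Lemma feat_clamp_bounded N beta r : (1 <= N)%nat -> 0 <= r ->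
  bounded_features N (N * N) (Rabs beta * (r * r)) (fun k z => feat N beta k (cl r z)).
Proof.
  intros HN Hr k Hk. destruct (div_mod_lt N k Hk) as [H1 H2]. unfold feat, cl. split.
  - auto using nice_scal, nice_mult, nice_clamp.
  - intros z. apply Rabs_mult_le; [now apply coupling_le|].
    apply Rabs_mult_le; now apply clamp_bound.
Qed.

Lemma nice_pow2 n F : nice n F -> nice n (fun z => F z ^ 2).
Proof. intros H. apply (nice_ext _ (fun z => F z * F z)); [intros; ring|]. now apply nice_mult. Qed.

Lemma ext_field_clamp_admissible N beta lam h r : 0 <= r ->
  admissible N (fun z => ext_field N beta lam h (cl r z)).
Proof.
  intros Hr. unfold ext_field, cl. split.
  - apply nice_lin.
    + apply (nice_sum N N (fun i z => clamp r (z i))). auto using nice_clamp.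
    + apply (nice_sum N N (fun i z => clamp r (z i) ^ 2)). auto using nice_clamp, nice_pow2.
  - exists (sumN N (fun _ => Rabs (beta * h) * r + Rabs (lam / 2) * (r * r))). intros z.
    rewrite <- !sumN_scal, <- sumN_plus. apply sumN_le. intros i _.
    pose proof (clamp_bound r (z i) Hr) as B.
    pose proof (Rabs_mult_le _ _ _ _ (Rle_refl (Rabs (beta * h))) B) as A1.
    pose proof (Rabs_mult_le _ _ _ _ (Rle_refl (Rabs (lam / 2))) (Rabs_mult_le _ _ _ _ B B)) as A2.
    apply Rabs_le_between in A1, A2. simpl. rewrite Rmult_1_r. lra.
Qed.

Lemma lnZ_ext n V W : (forall z, V z = W z) -> lnZ n V = lnZ n W.
Proof. intros E. now replace W with V by (apply functional_extensionality; auto). Qed.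

(** The log-partition function at fixed disorder, not divided by [N]. Only the exponent sees the
    clamped point; the Gaussian measure is untouched. *)
Definition pressure_cl (N : nat) (beta lam h r : R) (J : nat -> R) : R :=
  lnZ N (fun z => exponent N beta lam h J (cl r z)).

Lemma pressure_cl_wick N beta lam h r J : (1 <= N)%nat ->
  pressure_cl N beta lam h r J =
  lnZ N (wick (N * N) (fun k z => feat N beta k (cl r z)) (fun z => ext_field N beta lam h (cl r z)) J).
Proof. intros HN. apply lnZ_ext. intros z. now rewrite exponent_wick. Qed.

Lemma exponent_clamp_admissible N beta lam h r J : (1 <= N)%nat -> 0 <= r ->
  admissible N (fun z => exponent N beta lam h J (cl r z)).
Proof.
  intros HN Hr.
  replace (fun z => exponent N beta lam h J (cl r z)) with
    (wick (N * N) (fun k z => feat N beta k (cl r z)) (fun z => ext_field N beta lam h (cl r z)) J).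
  - eapply wick_admissible; [now apply feat_clamp_bounded|now apply ext_field_clamp_admissible].
  - apply functional_extensionality. intros z. now rewrite exponent_wick.
Qed.

Lemma nice_pressure_cl N beta lam h r : (1 <= N)%nat -> 0 <= r ->
  nice (N * N) (pressure_cl N beta lam h r).
Proof.
  intros HN Hr. eapply nice_ext; [intros J; symmetry; now apply pressure_cl_wick|].
  eapply nice_lnZ_wick; [now apply feat_clamp_bounded|now apply ext_field_clamp_admissible].
Qed.

Lemma lnZ_sum n m V W : admissible n V -> admissible m W ->
  lnZ (n + m) (fun z => V z + W (shift n z)) = lnZ n V + lnZ m W.
Proof.
  intros HV HW. unfold lnZ. rewrite <- ln_mult by now apply adm_pos.
  f_equal. rewrite <- gexp_mult by now apply adm_nice_exp.
  apply gexp_ext. intros z. apply exp_plus.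
Qed.

Lemma square_sum_convex x y p q : 0 < p -> 0 < q -> (x + y) ^ 2 / (p + q) <= x ^ 2 / p + y ^ 2 / q.
Proof.
  intros Hp Hq. apply Rminus_le_0.
  replace (x ^ 2 / p + y ^ 2 / q - (x + y) ^ 2 / (p + q)) with ((x * q - y * p) ^ 2 / (p * q * (p + q)))
    by (field; lra).
  apply Rmult_le_pos; [apply pow2_ge_0|].
  left. apply Rinv_0_lt_compat. repeat apply Rmult_lt_0_compat; lra.
Qed.

Theorem pressure_cl_superadditive N1 N2 beta lam h r : (1 <= N1)%nat -> (1 <= N2)%nat -> 0 <= r ->
  gexp (N1 * N1) (pressure_cl N1 beta lam h r) + gexp (N2 * N2) (pressure_cl N2 beta lam h r)
  <= gexp ((N1 + N2) * (N1 + N2)) (pressure_cl (N1 + N2) beta lam h r).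
Proof.
  intros H1 H2 Hr. set (N := (N1 + N2)%nat).
  assert (HN : (1 <= N)%nat) by (unfold N; lia).
  (* Three disjoint blocks of Gaussians, for the joint system and for each subsystem, so that the
     two fields are independent and at each index one of [a], [b] vanishes. *)
  set (m := (N * N + (N1 * N1 + N2 * N2))%nat).
  set (w := fun z => ext_field N beta lam h (cl r z)).
  set (a := fun k z => if (k <? N * N)%nat then feat N beta k (cl r z) else 0).
  set (b := fun k z => if (k <? N * N)%nat then 0
     else if (k - N * N <? N1 * N1)%nat then feat N1 beta (k - N * N) (cl r z)
     else feat N2 beta (k - N * N - N1 * N1) (cl r (shift N1 z))).
  set (B := Rabs beta * (r * r)).
  assert (HB : 0 <= B) by (repeat apply Rmult_le_pos; auto using Rabs_pos).
  assert (Hw : admissible N w) by now apply ext_field_clamp_admissible.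
  assert (Zero : nice N (fun _ => 0) /\ forall z : nat -> R, Rabs 0 <= B)
    by (split; [apply nice_const|intros; now rewrite Rabs_R0]).
  assert (Ha : bounded_features N m B a).
  { intros k Hk. unfold a. destruct (k <? N * N)%nat eqn:E; [|exact Zero].
    apply (feat_clamp_bounded N beta r); auto. now apply Nat.ltb_lt. }
  assert (Hb : bounded_features N m B b).
  { intros k Hk. unfold b. destruct (k <? N * N)%nat eqn:E; [exact Zero|].
    apply Nat.ltb_ge in E.
    destruct (k - N * N <? N1 * N1)%nat eqn:E'.
    - apply Nat.ltb_lt in E'. destruct (feat_clamp_bounded N1 beta r H1 Hr _ E') as [F1 F2].
      split; auto. apply (nice_widen N1); [unfold N; lia|auto].
    - apply Nat.ltb_ge in E'.
      destruct (feat_clamp_bounded N2 beta r H2 Hr (k - N * N - N1 * N1)%nat) as [F1 F2]; [unfold m in Hk; lia|].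
      split; [now apply (nice_shift N1 N2 (fun z => feat N2 beta (k - N * N - N1 * N1) (cl r z)))|].
      intros z. apply F2. }
  assert (Hsplit : forall f, sumN m f = sumN (N * N) f + (sumN (N1 * N1) (fun k => f (N * N + k)%nat)
       + sumN (N2 * N2) (fun k => f (N * N + (N1 * N1 + k))%nat))).
  { intros f. unfold m. rewrite sumN_add. f_equal. now rewrite sumN_add. }
  assert (Ea : forall k z, (k < N * N)%nat -> a k z = feat N beta k (cl r z)).
  { intros k z Hk. unfold a. apply Nat.ltb_lt in Hk. now rewrite Hk. }
  assert (Ea0 : forall k z, a (N * N + k)%nat z = 0).
  { intros k z. unfold a. destruct (N * N + k <? N * N)%nat eqn:E; auto. apply Nat.ltb_lt in E. lia. }
  assert (Eb0 : forall k z, (k < N * N)%nat -> b k z = 0).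
  { intros k z Hk. unfold b. apply Nat.ltb_lt in Hk. now rewrite Hk. }
  assert (Eb1 : forall k z, (k < N1 * N1)%nat -> b (N * N + k)%nat z = feat N1 beta k (cl r z)).
  { intros k z Hk. unfold b.
    destruct (N * N + k <? N * N)%nat eqn:E; [apply Nat.ltb_lt in E; lia|].
    replace (N * N + k - N * N)%nat with k by lia. apply Nat.ltb_lt in Hk. now rewrite Hk. }
  assert (Eb2 : forall k z, b (N * N + (N1 * N1 + k))%nat z = feat N2 beta k (cl r (shift N1 z))).
  { intros k z. unfold b.
    destruct (N * N + (N1 * N1 + k) <? N * N)%nat eqn:E; [apply Nat.ltb_lt in E; lia|].
    replace (N * N + (N1 * N1 + k) - N * N)%nat with (N1 * N1 + k)%nat by lia.
    destruct (N1 * N1 + k <? N1 * N1)%nat eqn:E'; [apply Nat.ltb_lt in E'; lia|].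
    now replace (N1 * N1 + k - N1 * N1)%nat with k by lia. }
  pose proof (wick_comparison N m B a b w 0 Ha Hb Hw) as K.
  (* The Gaussians of the other blocks do not enter and integrate to 1. *)
  assert (KA : gexp m (fun J => lnZ N (wick m a w J)) = gexp (N * N) (pressure_cl N beta lam h r)).
  { rewrite <- (gexp_widen (N * N) (N1 * N1 + N2 * N2)) by now apply nice_pressure_cl.
    apply gexp_ext. intros J. rewrite pressure_cl_wick by auto. apply lnZ_ext. intros z.
    unfold wick. rewrite Hsplit. fold w. unfold w at 1.
    rewrite (sumN_zero (N1 * N1)), (sumN_zero (N2 * N2)) by (intros; rewrite Ea0; field).
    rewrite !Rplus_0_r. f_equal. apply sumN_ext. intros k Hk. now rewrite Ea. }
  (* The external field is a sum over sites, so the comparison potential splits into one part per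
     subsystem and the log-partition functions add. *)
  assert (KB : gexp m (fun J => lnZ N (wick m b w J)) =
     gexp (N1 * N1) (pressure_cl N1 beta lam h r) + gexp (N2 * N2) (pressure_cl N2 beta lam h r)).
  { transitivity (gexp m (fun J => (fun J' => pressure_cl N1 beta lam h r J'
        + pressure_cl N2 beta lam h r (shift (N1 * N1) J')) (shift (N * N) J))).
    - apply gexp_ext. intros J. unfold pressure_cl.
      rewrite <- (lnZ_sum N1 N2 (fun z => exponent N1 beta lam h (shift (N * N) J) (cl r z))
         (fun z => exponent N2 beta lam h (shift (N1 * N1) (shift (N * N) J)) (cl r z)))
        by now apply exponent_clamp_admissible.
      apply lnZ_ext. intros z. rewrite !exponent_wick by auto. unfold wick. rewrite Hsplit.
      rewrite (sumN_zero (N * N)) by (intros; rewrite Eb0 by auto; field).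
      rewrite (sumN_ext (N1 * N1) (fun k => J (N * N + k)%nat * b (N * N + k)%nat z
            - b (N * N + k)%nat z * b (N * N + k)%nat z / 2)
         (fun k => shift (N * N) J k * feat N1 beta k (cl r z) - feat N1 beta k (cl r z) * feat N1 beta k (cl r z) / 2))
        by (intros; now rewrite Eb1).
      rewrite (sumN_ext (N2 * N2) (fun k => J (N * N + (N1 * N1 + k))%nat * b (N * N + (N1 * N1 + k))%nat z
            - b (N * N + (N1 * N1 + k))%nat z * b (N * N + (N1 * N1 + k))%nat z / 2)
         (fun k => shift (N1 * N1) (shift (N * N) J) k * feat N2 beta k (cl r (shift N1 z))
           - feat N2 beta k (cl r (shift N1 z)) * feat N2 beta k (cl r (shift N1 z)) / 2))
        by (intros; now rewrite Eb2).
      unfold w, ext_field, N. rewrite !sumN_add. unfold cl, shift. ring.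
    - assert (NP1 := nice_pressure_cl N1 beta lam h r H1 Hr).
      assert (NP2 := nice_pressure_cl N2 beta lam h r H2 Hr).
      assert (NP1' := nice_widen (N1 * N1) (N1 * N1 + N2 * N2) _ (Nat.le_add_r _ _) NP1).
      assert (NP2' := nice_shift (N1 * N1) (N2 * N2) _ NP2).
      unfold m. rewrite (gexp_shift (N * N) (N1 * N1 + N2 * N2)
        (fun J' => pressure_cl N1 beta lam h r J' + pressure_cl N2 beta lam h r (shift (N1 * N1) J')))
        by now apply nice_plus.
      rewrite gexp_plus by auto. rewrite gexp_widen, gexp_shift by auto. reflexivity. }
  rewrite KA, KB in K.
  replace (gexp (N * N) (pressure_cl N beta lam h r)) with (gexp (N * N) (pressure_cl N beta lam h r) + 0 / 2) by field.
  apply K.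
  - intros k Hk. destruct (Nat.lt_ge_cases k (N * N)) as [L|L]; [right; auto|left].
    intros z. replace k with (N * N + (k - N * N))%nat by lia. apply Ea0.
  - intros z z'. rewrite !Hsplit.
    rewrite (sumN_zero (N1 * N1) (fun k => a _ z * _)), (sumN_zero (N2 * N2) (fun k => a _ z * _)) by (intros; rewrite Ea0; ring).
    rewrite (sumN_zero (N * N) (fun k => b _ z * _)) by (intros; rewrite Eb0 by auto; ring).
    rewrite (sumN_ext (N * N) (fun k => a k z * a k z') (fun k => feat N beta k (cl r z) * feat N beta k (cl r z')))
      by (intros; now rewrite !Ea).
    rewrite (sumN_ext (N1 * N1) _ (fun k => feat N1 beta k (cl r z) * feat N1 beta k (cl r z')))
      by (intros; now rewrite !Eb1).
    rewrite (sumN_ext (N2 * N2) _ (fun k => feat N2 beta k (cl r (shift N1 z)) * feat N2 beta k (cl r (shift N1 z'))))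
      by (intros; now rewrite !Eb2).
    rewrite !feat_covariance by auto.
    (* The overlap over [N1 + N2] sites is the sum of the overlaps [x] and [y] of the two blocks,
       which brings the covariance inequality to [square_sum_convex]. *)
    unfold N at 2. rewrite sumN_add. unfold N. rewrite plus_INR.
    set (x := sumN N1 (fun i => cl r z i * cl r z' i)).
    change (sumN N2 (fun k => cl r z (N1 + k)%nat * cl r z' (N1 + k)%nat))
      with (sumN N2 (fun k => cl r (shift N1 z) k * cl r (shift N1 z') k)).
    set (y := sumN N2 (fun k => cl r (shift N1 z) k * cl r (shift N1 z') k)).
    apply INR_ge_1 in H1, H2.
    pose proof (square_sum_convex x y (INR N1) (INR N2) ltac:(lra) ltac:(lra)) as C.
    assert (Hb2 : 0 <= beta ^ 2 / 2) by (apply Rmult_le_pos; [apply pow2_ge_0|lra]).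
    apply (Rmult_le_compat_l _ _ _ Hb2) in C.
    replace (beta ^ 2 / (2 * (INR N1 + INR N2)) * (x + y) ^ 2) with (beta ^ 2 / 2 * ((x + y) ^ 2 / (INR N1 + INR N2)))
      by (field; lra).
    replace (0 + (beta ^ 2 / (2 * INR N1) * x ^ 2 + beta ^ 2 / (2 * INR N2) * y ^ 2) + 0)
      with (beta ^ 2 / 2 * (x ^ 2 / INR N1 + y ^ 2 / INR N2)) by (field; lra).
    lra.
Qed.

Theorem pressure_cl_upper N beta lam h r : (1 <= N)%nat -> 0 < beta -> 0 <= r ->
  gexp (N * N) (pressure_cl N beta lam h r)
  <= INR N * (beta ^ 2 * h ^ 2 + (1 + Rabs lam) + (1 + Rabs lam) ^ 2 / (4 * beta ^ 2)).
Proof.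
  intros HN Hbeta Hr.
  (* Chosen so that [beta ^ 2 * q = 1 + Rabs lam]: the Wick correction of the linear field then
     outweighs [lam / 2 * y ^ 2] and leaves at least [- y ^ 2 / 2] per site. *)
  set (q := (1 + Rabs lam) / beta ^ 2).
  assert (Hb2 : 0 < beta ^ 2) by nra.
  assert (Hl : 0 < 1 + Rabs lam) by (pose proof (Rabs_pos lam); lra).
  set (g := sqrt (1 + Rabs lam)).
  assert (Hg : g * g = 1 + Rabs lam) by (apply sqrt_sqrt; lra).
  set (m := (N * N + N)%nat).
  set (w := fun z => ext_field N beta lam h (cl r z)).
  set (a := fun k (z : nat -> R) => if (k <? N * N)%nat then 0 else g * cl r z (k - N * N)%nat).
  set (b := fun k z => if (k <? N * N)%nat then feat N beta k (cl r z) else 0).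
  set (B := Rabs beta * (r * r) + Rabs g * r).
  assert (HB1 : 0 <= Rabs beta * (r * r)) by (repeat apply Rmult_le_pos; auto using Rabs_pos).
  assert (HB2 : 0 <= Rabs g * r) by (repeat apply Rmult_le_pos; auto using Rabs_pos).
  assert (Hw : admissible N w) by now apply ext_field_clamp_admissible.
  assert (Zero : nice N (fun _ => 0) /\ forall z : nat -> R, Rabs 0 <= B)
    by (split; [apply nice_const|intros; rewrite Rabs_R0; unfold B; lra]).
  assert (Hb : bounded_features N m B b).
  { intros k Hk. unfold b. destruct (k <? N * N)%nat eqn:E; [|exact Zero].
    apply Nat.ltb_lt in E. destruct (feat_clamp_bounded N beta r HN Hr k E) as [F1 F2].
    split; auto. intros z. specialize (F2 z). unfold B; lra. }
  assert (Ha : bounded_features N m B a).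
  { intros k Hk. unfold a. destruct (k <? N * N)%nat eqn:E; [exact Zero|].
    apply Nat.ltb_ge in E. split.
    - apply nice_scal. apply nice_clamp; auto. unfold m in Hk. lia.
    - intros z. eapply Rle_trans; [apply (Rabs_mult_le g _ _ r (Rle_refl _))|unfold B; lra].
      now apply clamp_bound. }
  assert (Eb : forall k z, (k < N * N)%nat -> b k z = feat N beta k (cl r z)).
  { intros k z Hk. unfold b. apply Nat.ltb_lt in Hk. now rewrite Hk. }
  assert (Eb0 : forall k z, b (N * N + k)%nat z = 0).
  { intros k z. unfold b. destruct (N * N + k <? N * N)%nat eqn:E; auto. apply Nat.ltb_lt in E. lia. }
  assert (Ea0 : forall k z, (k < N * N)%nat -> a k z = 0).
  { intros k z Hk. unfold a. apply Nat.ltb_lt in Hk. now rewrite Hk. }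
  assert (Ea : forall k z, a (N * N + k)%nat z = g * cl r z k).
  { intros k z. unfold a. destruct (N * N + k <? N * N)%nat eqn:E; [apply Nat.ltb_lt in E; lia|].
    now replace (N * N + k - N * N)%nat with k by lia. }
  (* This constant is what completes the square [beta ^ 2 / (2 * INR N) * (x - INR N * q) ^ 2] in
     the overlap [x]. *)
  pose proof (wick_comparison N m B a b w (beta ^ 2 * q ^ 2 * INR N / 2) Ha Hb Hw) as K.
  assert (KB : gexp m (fun J => lnZ N (wick m b w J)) = gexp (N * N) (pressure_cl N beta lam h r)).
  { rewrite <- (gexp_widen (N * N) N) by now apply nice_pressure_cl.
    apply gexp_ext. intros J. rewrite pressure_cl_wick by auto. apply lnZ_ext. intros z.
    unfold wick. unfold m. rewrite sumN_add. fold w. unfold w at 1.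
    rewrite (sumN_zero N) by (intros; rewrite Eb0; field).
    rewrite !Rplus_0_r. f_equal. apply sumN_ext. intros k Hk. now rewrite Eb. }
  set (c0 := beta ^ 2 * h ^ 2).
  (* Per site the potential is at most [(beta * h + g * j) * y - y ^ 2 / 2]. Its maximum over [y] is
     half of [(beta * h + g * j) ^ 2], which is at most [(beta * h) ^ 2 + (g * j) ^ 2]. *)
  set (U := fun J : nat -> R => sumN N (fun i => c0 + (1 + Rabs lam) * (J (N * N + i)%nat * J (N * N + i)%nat))).
  assert (NUi : forall i, (i < N)%nat -> nice m (fun J => c0 + (1 + Rabs lam) * (J (N * N + i)%nat * J (N * N + i)%nat))).
  { intros i Hi. apply nice_plus; [apply nice_const|]. apply nice_scal.
    apply nice_mult; apply nice_coord; unfold m; lia. }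
  assert (NU : nice m U)
    by (apply (nice_sum m N (fun i J => c0 + (1 + Rabs lam) * (J (N * N + i)%nat * J (N * N + i)%nat))); auto).
  assert (EU : gexp m U = INR N * (c0 + (1 + Rabs lam))).
  { unfold U. rewrite (gexp_sum m N (fun i J => c0 + (1 + Rabs lam) * (J (N * N + i)%nat * J (N * N + i)%nat))) by auto.
    rewrite <- sumN_const. apply sumN_ext. intros i Hi.
    assert (Hi' : (N * N + i < m)%nat) by (unfold m; lia).
    rewrite gexp_plus, gexp_scal, gexp_const, gexp_coord_sqr
      by auto using nice_const, nice_scal, nice_mult, nice_coord. ring. }
  assert (KA : gexp m (fun J => lnZ N (wick m a w J)) <= gexp m U).
  { apply gexp_le; auto.
    - now apply (nice_lnZ_wick N m B).
    - intros J. apply lnZ_le_const; [eapply wick_admissible; eauto|].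
      intros z. unfold wick, m. rewrite sumN_add, (sumN_zero (N * N)) by (intros; rewrite Ea0 by auto; field).
      unfold w, ext_field, U. rewrite <- !sumN_scal, Rplus_0_l, <- !sumN_plus.
      apply sumN_le. intros i _. rewrite Ea.
      set (y := cl r z i). set (j := J (N * N + i)%nat).
      assert (Hgj : g * j * (g * j) = (1 + Rabs lam) * (j * j)) by (rewrite <- Hg; ring).
      rewrite <- Hgj. unfold c0. pose proof (Rle_abs lam).
      replace (g * y * (g * y) / 2) with ((1 + Rabs lam) * (y * y) / 2) by (rewrite <- Hg; field).
      assert (lam * (y * y) <= Rabs lam * (y * y)) by (apply Rmult_le_compat_r; [apply Rle_0_sqr|auto]).
      pose proof (Rle_0_sqr (beta * h + g * j - y)) as S1. pose proof (Rle_0_sqr (beta * h - g * j)) as S2.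
      unfold Rsqr in S1, S2. simpl. lra. }
  rewrite KB in K. rewrite EU in KA.
  assert (K' : gexp (N * N) (pressure_cl N beta lam h r) <=
    gexp m (fun J => lnZ N (wick m a w J)) + beta ^ 2 * q ^ 2 * INR N / 2 / 2).
  { apply K.
    - intros k Hk. destruct (Nat.lt_ge_cases k (N * N)) as [L|L]; [left; auto|right].
      intros z. replace k with (N * N + (k - N * N))%nat by lia. apply Eb0.
    - intros z z'. unfold m. rewrite !sumN_add.
      rewrite (sumN_zero (N * N) (fun k => a _ z * _)) by (intros; rewrite Ea0 by auto; ring).
      rewrite (sumN_zero N (fun k => b _ z * _)) by (intros; rewrite Eb0; ring).
      rewrite (sumN_ext (N * N) _ (fun k => feat N beta k (cl r z) * feat N beta k (cl r z')))
        by (intros; now rewrite !Eb).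
      rewrite (sumN_ext N (fun k => a (N * N + k)%nat z * a (N * N + k)%nat z')
         (fun k => (g * g) * (cl r z k * cl r z' k))) by (intros; rewrite !Ea; ring).
      rewrite sumN_scal, feat_covariance by auto.
      set (x := sumN N (fun k => cl r z k * cl r z' k)).
      apply INR_ge_1 in HN.
      assert (Hq : beta ^ 2 * q = 1 + Rabs lam) by (unfold q; field; lra).
      rewrite Hg, <- Hq.
      assert (0 <= beta ^ 2 / (2 * INR N) * (x - INR N * q) ^ 2).
      { apply Rmult_le_pos; [|apply pow2_ge_0]. left. apply Rdiv_lt_0_compat; lra. }
      replace (beta ^ 2 / (2 * INR N) * (x - INR N * q) ^ 2) with
        (beta ^ 2 / (2 * INR N) * x ^ 2 + beta ^ 2 * q ^ 2 * INR N / 2 - beta ^ 2 * q * x) in H by (field; lra).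
      lra. }
  replace (beta ^ 2 * q ^ 2 * INR N / 2 / 2) with (INR N * ((1 + Rabs lam) ^ 2 / (4 * beta ^ 2))) in K'
    by (unfold q; field; lra).
  fold c0. lra.
Qed.

(** * Removing the truncation *)

Definition sqn (N : nat) (z : nat -> R) : R := sumN N (fun i => z i ^ 2).

Definition pressure (N : nat) (beta lam h : R) (J : nat -> R) : R :=
  lnZ N (fun z => exponent N beta lam h J z).

Lemma sqn_nonneg N z : 0 <= sqn N z.
Proof. apply sumN_nonneg. intros; apply pow2_ge_0. Qed.

Lemma sqn_term N z i : (i < N)%nat -> z i ^ 2 <= sqn N z.
Proof. intros H. apply (sumN_term_le N (fun i => z i ^ 2)); auto. intros; apply pow2_ge_0. Qed.

Lemma nice_sqn N : nice N (sqn N).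
Proof. apply (nice_sum N N (fun i z => z i ^ 2)). auto using nice_pow2, nice_coord. Qed.

Lemma sqn_clamp_le N r z : 0 <= r -> sqn N (cl r z) <= sqn N z.
Proof.
  intros Hr. apply sumN_le. intros i _. unfold cl.
  pose proof (clamp_abs_le r (z i) Hr) as H. rewrite <- !Rsqr_pow2. now apply Rsqr_le_abs_1.
Qed.

Lemma feat_abs_le N beta k z : (1 <= N)%nat -> (k < N * N)%nat ->
  Rabs (feat N beta k z) <= Rabs beta * sqn N z.
Proof.
  intros HN Hk. destruct (div_mod_lt N k Hk) as [H1 H2]. unfold feat.
  apply Rabs_mult_le; [now apply coupling_le|].
  pose proof (sqn_term N z _ H1) as S1. pose proof (sqn_term N z _ H2) as S2.
  set (x := z (k / N)%nat) in *. set (y := z (k mod N)%nat) in *.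
  pose proof (pow2_ge_0 (x - y)). pose proof (pow2_ge_0 (x + y)).
  apply Rabs_le. lra.
Qed.

Lemma nice_feat N beta k : (k < N * N)%nat -> nice N (feat N beta k).
Proof.
  intros Hk. destruct (div_mod_lt N k Hk) as [H1 H2]. unfold feat.
  auto using nice_scal, nice_mult, nice_coord.
Qed.

Lemma nice_exponent N beta lam h J : (1 <= N)%nat -> nice N (exponent N beta lam h J).
Proof.
  intros HN.
  apply (nice_ext _ (wick (N * N) (feat N beta) (ext_field N beta lam h) J));
    [intros z; now rewrite exponent_wick|].
  unfold wick, ext_field. apply nice_plus.
  - apply nice_lin; [apply (nice_sum N N (fun i z => z i)); auto using nice_coord|apply nice_sqn].
  - apply (nice_sum N (N * N) (fun k z => J k * feat N beta k z - feat N beta k z * feat N beta k z / 2)).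
    intros k Hk. pose proof (nice_feat N beta k Hk) as F.
    apply (nice_ext _ (fun z => J k * feat N beta k z + - / 2 * (feat N beta k z * feat N beta k z)));
      [intros; field|auto using nice_lin, nice_mult].
Qed.

Lemma exponent_eq N beta lam h J z : (1 <= N)%nat ->
  exponent N beta lam h J z = sumN (N * N) (fun k => J k * feat N beta k z)
    + beta * h * sumN N (fun i => z i) - beta ^ 2 / (4 * INR N) * (sqn N z) ^ 2 + lam / 2 * sqn N z.
Proof.
  intros HN. rewrite exponent_wick by auto. unfold wick, ext_field. rewrite sumN_minus.
  rewrite (sumN_ext (N * N) (fun k => feat N beta k z * feat N beta k z / 2)
             (fun k => / 2 * (feat N beta k z * feat N beta k z))) by (intros; field).
  rewrite sumN_scal, feat_covariance by auto.
  rewrite (sumN_ext N (fun i => z i * z i) (fun i => z i ^ 2)) by (intros; ring).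
  unfold sqn. pose proof (INR_ge_1 N HN). field. lra.
Qed.

Lemma coupling_sum_le N beta J z : (1 <= N)%nat ->
  Rabs (sumN (N * N) (fun k => J k * feat N beta k z)) <= Rabs beta * sqn N z * nrm (N * N) J.
Proof.
  intros HN. eapply Rle_trans; [apply sumN_abs|]. unfold nrm. rewrite <- sumN_scal.
  apply sumN_le. intros k Hk. rewrite (Rmult_comm (J k)).
  apply Rabs_mult_le; [now apply feat_abs_le|lra].
Qed.

Lemma field_sum_le N beta h z : Rabs (beta * h * sumN N (fun i => z i)) <= INR N * (beta * h) ^ 2 + sqn N z.
Proof.
  unfold sqn. rewrite <- sumN_scal, <- sumN_const, <- sumN_plus.
  eapply Rle_trans; [apply sumN_abs|]. apply sumN_le. intros i _.
  pose proof (pow2_ge_0 (beta * h - z i)). pose proof (pow2_ge_0 (beta * h + z i)).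
  pose proof (pow2_ge_0 (beta * h)). pose proof (pow2_ge_0 (z i)).
  apply Rabs_le. lra.
Qed.

(** The negative square of [sqn N z] beats all terms linear in it, and completing the square leaves
    a bound quadratic in the disorder. The lower bound is polynomial in [z], ready to be integrated
    in Jensen's inequality. *)
Lemma exponent_bounds N beta lam h : (1 <= N)%nat -> 0 < beta -> exists C, 0 <= C /\
  forall J z, exponent N beta lam h J z <= C * (1 + nrm (N * N) J) ^ 2 /\
    - (C * (1 + nrm (N * N) J) * (1 + sqn N z ^ 2)) <= exponent N beta lam h J z.
Proof.
  intros HN Hbeta.
  pose proof (INR_ge_1 N HN) as HN1.
  set (q := beta ^ 2 / (4 * INR N)).
  assert (Hq : 0 < q) by (apply Rdiv_lt_0_compat; [nra|lra]).
  (* The three summands are the coefficients of [sqn N z] coming from the coupling, the magnetic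
     field and [lam]. *)
  set (b := Rabs beta + 1 + Rabs lam).
  assert (Hb : 0 <= b) by (unfold b; pose proof (Rabs_pos beta); pose proof (Rabs_pos lam); lra).
  set (d := INR N * (beta * h) ^ 2).
  assert (Hd : 0 <= d) by (apply Rmult_le_pos; [lra|apply pow2_ge_0]).
  assert (Hbq : 0 <= b ^ 2 / (4 * q)) by (apply Rmult_le_pos; [apply pow2_ge_0|left; apply Rinv_0_lt_compat; lra]).
  exists (b ^ 2 / (4 * q) + b + d + q). split; [lra|]. intros J z.
  rewrite exponent_eq by auto. fold q.
  pose proof (coupling_sum_le N beta J z HN) as A1. pose proof (field_sum_le N beta h z) as A2. fold d in A2.
  pose proof (sqn_nonneg N z) as HS. pose proof (nrm_pos (N * N) J) as HJ.
  set (S := sqn N z) in *. set (j := nrm (N * N) J) in *.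
  assert (A3 : Rabs (lam / 2 * S) <= Rabs lam * S).
  { rewrite Rabs_mult, (Rabs_pos_eq S) by auto. apply Rmult_le_compat_r; auto.
    unfold Rdiv. rewrite Rabs_mult, (Rabs_pos_eq (/ 2)) by lra. pose proof (Rabs_pos lam). lra. }
  assert (A4 : Rabs beta * S * j + S + Rabs lam * S <= b * (1 + j) * S).
  { unfold b. pose proof (Rabs_pos beta). pose proof (Rabs_pos lam).
    assert (0 <= S * j) by (now apply Rmult_le_pos).
    assert (0 <= Rabs lam * (S * j)) by (now apply Rmult_le_pos).
    assert (0 <= Rabs beta * S) by (now apply Rmult_le_pos). lra. }
  apply Rabs_le_between in A1, A2, A3.
  set (X := sumN (N * N) (fun k => J k * feat N beta k z)) in *.
  set (Y := beta * h * sumN N (fun i => z i)) in *. set (L := lam / 2 * S) in *.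
  split.
  - assert (E : b * (1 + j) * S - q * S ^ 2 <= b ^ 2 / (4 * q) * (1 + j) ^ 2).
    { apply Rminus_le_0.
      replace (b ^ 2 / (4 * q) * (1 + j) ^ 2 - (b * (1 + j) * S - q * S ^ 2))
        with ((b * (1 + j) - 2 * q * S) ^ 2 / (4 * q)) by (field; lra).
      apply Rmult_le_pos; [apply pow2_ge_0|left; apply Rinv_0_lt_compat; lra]. }
    assert (1 <= (1 + j) ^ 2) by nra.
    assert (0 <= (b + q) * (1 + j) ^ 2) by (apply Rmult_le_pos; [lra|apply pow2_ge_0]).
    assert (d <= d * (1 + j) ^ 2) by nra. lra.
  - assert (HS2 : S <= 1 + S ^ 2) by (pose proof (pow2_ge_0 (S - 1)); pose proof (pow2_ge_0 S); lra).
    pose proof (pow2_ge_0 S) as HS3.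
    assert (B1 : b * (1 + j) * S <= b * (1 + j) * (1 + S ^ 2)).
    { apply Rmult_le_compat_l; auto. apply Rmult_le_pos; lra. }
    assert (HW : 1 + S ^ 2 <= (1 + j) * (1 + S ^ 2)) by (assert (0 <= j * (1 + S ^ 2)) by (apply Rmult_le_pos; lra); lra).
    assert (B2 : d * 1 <= d * ((1 + j) * (1 + S ^ 2))) by (apply Rmult_le_compat_l; lra).
    assert (B3 : q * S ^ 2 <= q * ((1 + j) * (1 + S ^ 2))) by (apply Rmult_le_compat_l; lra).
    assert (B4 : 0 <= b ^ 2 / (4 * q) * ((1 + j) * (1 + S ^ 2))) by (apply Rmult_le_pos; auto; lra).
    lra.
Qed.

Lemma exponent_admissible N beta lam h J : (1 <= N)%nat -> 0 < beta -> admissible N (exponent N beta lam h J).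
Proof.
  intros HN Hb. split; [now apply nice_exponent|].
  destruct (exponent_bounds N beta lam h HN Hb) as [C [_ H]]. eexists. intros z. apply (H J z).
Qed.

(** The upper bound is pointwise and the lower one is Jensen's. One [C] serves every [r], because
    clamping can only decrease [sqn]. *)
Lemma lnZ_quadratic_bound N beta lam h : (1 <= N)%nat -> 0 < beta -> exists C, 0 <= C /\
  (forall J z, exponent N beta lam h J z <= C * (1 + nrm (N * N) J) ^ 2) /\
  (forall J, Rabs (pressure N beta lam h J) <= C * (1 + nrm (N * N) J) ^ 2) /\
  (forall r J, 0 <= r -> Rabs (pressure_cl N beta lam h r J) <= C * (1 + nrm (N * N) J) ^ 2).
Proof.
  intros HN Hb. destruct (exponent_bounds N beta lam h HN Hb) as [C [HC H]].
  set (E := fun z => 1 + sqn N z ^ 2).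
  assert (NE : nice N E) by (apply nice_plus; auto using nice_const, nice_pow2, nice_sqn).
  assert (HE1 : 1 <= gexp N E).
  { rewrite <- (gexp_const N 1). apply gexp_le; auto using nice_const.
    intros z. unfold E. pose proof (pow2_ge_0 (sqn N z)). lra. }
  exists (C * gexp N E). split; [apply Rmult_le_pos; lra|].
  assert (Hsq : forall J, 1 <= (1 + nrm (N * N) J) /\ (1 + nrm (N * N) J) <= (1 + nrm (N * N) J) ^ 2).
  { intros J. pose proof (nrm_pos (N * N) J). nra. }
  assert (HCE : forall J, C * (1 + nrm (N * N) J) ^ 2 <= C * gexp N E * (1 + nrm (N * N) J) ^ 2).
  { intros J. specialize (Hsq J). rewrite (Rmult_comm C (gexp N E)), Rmult_assoc.
    rewrite <- (Rmult_1_l (C * _)) at 1. apply Rmult_le_compat_r; auto. apply Rmult_le_pos; lra. }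
  assert (W : forall J V, admissible N V -> (forall z, V z <= C * (1 + nrm (N * N) J) ^ 2) ->
     (forall z, - (C * (1 + nrm (N * N) J) * E z) <= V z) ->
     Rabs (lnZ N V) <= C * gexp N E * (1 + nrm (N * N) J) ^ 2).
  { intros J V HV H1 H2. apply Rabs_le. split.
    - eapply Rle_trans; [|now apply gexp_le_lnZ].
      apply Rle_trans with (gexp N (fun z => - (C * (1 + nrm (N * N) J)) * E z)).
      + rewrite gexp_scal by auto. specialize (Hsq J).
        assert (0 <= C * gexp N E) by (apply Rmult_le_pos; lra). nra.
      + apply gexp_le; auto using nice_scal, adm_nice. intros z. specialize (H2 z). lra.
    - eapply Rle_trans; [apply (lnZ_le_const N V _ HV H1)|apply HCE]. }
  split; [|split].
  - intros J z. eapply Rle_trans; [apply H|apply HCE].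
  - intros J. apply W; [now apply exponent_admissible| |]; intros z; apply H.
  - intros r J Hr. apply W; [now apply exponent_clamp_admissible|intros z; apply H|].
    intros z. eapply Rle_trans; [|apply H]. apply Ropp_le_contravar.
    apply Rmult_le_compat_l; [pose proof (Hsq J); apply Rmult_le_pos; lra|].
    unfold E. pose proof (sqn_clamp_le N r z Hr). pose proof (sqn_nonneg N (cl r z)). nra.
Qed.

Lemma exponent_J_diff N beta lam h J J' z : (1 <= N)%nat ->
  Rabs (exponent N beta lam h J' z - exponent N beta lam h J z)
  <= nrm (N * N) (fun k => J' k - J k) * (Rabs beta * sqn N z).
Proof.
  intros HN. rewrite !exponent_eq by auto.
  match goal with |- Rabs (?a + ?b - ?c + ?d - (?e + ?b - ?c + ?d)) <= _ =>
    replace (a + b - c + d - (e + b - c + d)) with (a - e) by ring end.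
  rewrite <- sumN_minus.
  rewrite (sumN_ext _ _ (fun k => (J' k - J k) * feat N beta k z)) by (intros; ring).
  eapply Rle_trans; [now apply (coupling_sum_le N beta (fun k => J' k - J k) z)|]. lra.
Qed.

(* The local Lipschitz constant of the pressure is a Gibbs second moment; by Jensen it is at most
   the increment of the pressure when [lam] is raised by [2 * Rabs beta]. *)
Lemma nice_pressure N beta lam h : (1 <= N)%nat -> 0 < beta -> nice (N * N) (pressure N beta lam h).
Proof.
  intros HN Hb.
  destruct (lnZ_quadratic_bound N beta lam h HN Hb) as [C [HC [_ [H _]]]].
  destruct (lnZ_quadratic_bound N beta (lam + 2 * Rabs beta) h HN Hb) as [C' [HC' [_ [H' _]]]].
  set (S := fun z => Rabs beta * sqn N z).
  assert (NS : nice N S) by (apply nice_scal, nice_sqn).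
  assert (HA := fun lam J => exponent_admissible N beta lam h J HN Hb).
  assert (M : forall J, gibbs N (exponent N beta lam h J) S <= (C + C') * (1 + nrm (N * N) J) ^ 2).
  { intros J. pose proof (gibbs_jensen N _ _ (HA lam J) (HA (lam + 2 * Rabs beta) J)) as G.
    rewrite (gibbs_ext N _ _ S) in G.
    - specialize (H J). specialize (H' J). apply Rabs_le_between in H, H'.
      unfold pressure in H, H'.
      change (lnZ N (exponent N beta lam h J)) with (lnZ N (fun z => exponent N beta lam h J z)) in G.
      change (lnZ N (exponent N beta (lam + 2 * Rabs beta) h J))
        with (lnZ N (fun z => exponent N beta (lam + 2 * Rabs beta) h J z)) in G.
      lra.
    - intros z. rewrite !exponent_eq by auto. unfold S. field.
      pose proof (INR_ge_1 N HN). lra. }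
  (* Jensen under the Gibbs measure of [J] needs the moment bound at [J] only; exchanging [J] and
     [J'] later gives the other sign. *)
  assert (D : forall J J', pressure N beta lam h J - pressure N beta lam h J' <=
     nrm (N * N) (fun k => J k - J' k) * ((C + C') * (1 + nrm (N * N) J) ^ 2)).
  { intros J J'. pose proof (gibbs_jensen N _ _ (HA lam J) (HA lam J')) as G.
    assert (L : gibbs N (exponent N beta lam h J) (fun z => - nrm (N * N) (fun k => J k - J' k) * S z)
      <= gibbs N (exponent N beta lam h J) (fun z => exponent N beta lam h J' z - exponent N beta lam h J z)).
    { apply gibbs_le; auto using nice_scal.
      - apply nice_minus; now apply nice_exponent.
      - intros z. pose proof (exponent_J_diff N beta lam h J J' z HN) as E.
        rewrite nrm_minus_sym in E. fold (S z) in E. apply Rabs_le_between in E. lra. }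
    rewrite gibbs_scal in L by auto.
    pose proof (nrm_pos (N * N) (fun k => J k - J' k)) as P0.
    pose proof (Rmult_le_compat_l _ _ _ P0 (M J)).
    unfold pressure.
    change (lnZ N (exponent N beta lam h J)) with (lnZ N (fun z => exponent N beta lam h J z)) in G.
    change (lnZ N (exponent N beta lam h J')) with (lnZ N (fun z => exponent N beta lam h J' z)) in G.
    lra. }
  apply (nice_intro _ _ (C + C') 2). intros J J'.
  pose proof (nrm_pos (N * N) J) as P1. pose proof (nrm_pos (N * N) J') as P2.
  pose proof (nrm_pos (N * N) (fun k => J k - J' k)) as P0.
  assert (B : forall x y, 0 <= x -> 0 <= y -> (1 + x) ^ 2 <= exp (2 * (1 + x + y))).
  { intros x y Hx Hy. replace (2 * (1 + x + y)) with ((1 + x + y) + (1 + x + y)) by ring.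
    rewrite exp_plus. pose proof (exp_lower (1 + x + y)). nra. }
  pose proof (B _ _ P1 P2) as B1. pose proof (B _ _ P2 P1) as B2.
  replace (1 + nrm (N * N) J' + nrm (N * N) J) with (1 + nrm (N * N) J + nrm (N * N) J') in B2 by ring.
  set (e := exp (2 * (1 + nrm (N * N) J + nrm (N * N) J'))) in *.
  pose proof (D J J') as D1. pose proof (D J' J) as D2. rewrite (nrm_minus_sym _ J' J) in D2.
  set (dl := nrm (N * N) (fun k => J k - J' k)) in *.
  assert (F : forall x, x <= e -> dl * ((C + C') * x) <= (C + C') * e * dl).
  { intros x Hx. rewrite (Rmult_comm _ dl). apply Rmult_le_compat_l; auto. apply Rmult_le_compat_l; lra. }
  pose proof (F _ B1). pose proof (F _ B2). apply Rabs_le. lra.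
Qed.

Lemma ln_lipschitz m x y : 0 < m -> m <= x -> m <= y -> Rabs (ln x - ln y) <= Rabs (x - y) / m.
Proof.
  intros Hm.
  assert (W : forall x y, m <= x -> m <= y -> ln x - ln y <= Rabs (x - y) / m).
  { clear x y. intros x y Hx Hy.
    assert (E : ln x - ln y <= x / y - 1).
    { rewrite <- ln_div by lra. pose proof (exp_lower (ln (x / y))) as K.
      rewrite exp_ln in K by (apply Rdiv_lt_0_compat; lra). lra. }
    eapply Rle_trans; [apply E|].
    replace (x / y - 1) with ((x - y) / y) by (field; lra).
    apply Rle_trans with (Rabs (x - y) / y).
    - apply Rmult_le_compat_r; [left; apply Rinv_0_lt_compat; lra|apply Rle_abs].
    - apply Rmult_le_compat_l; [apply Rabs_pos|apply Rinv_le_contravar; lra]. }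
  intros Hx Hy. pose proof (W x y Hx Hy). pose proof (W y x Hy Hx). rewrite (Rabs_minus_sym y x) in *.
  apply Rabs_le. lra.
Qed.

Lemma exponent_clamp_eq N beta lam h r J z : (1 <= N)%nat -> nrm N z <= r ->
  exponent N beta lam h J (cl r z) = exponent N beta lam h J z.
Proof.
  intros HN Hz. apply (nice_local N); [now apply nice_exponent|].
  intros i Hi. apply clamp_id. pose proof (nrm_coord N z i Hi). lra.
Qed.

(** The first bound is small for large [r] but involves the exponential of a square in [J], which
    need not be Gaussian-integrable. The second does not improve with [r] but is polynomial. They
    serve moderate and large disorder respectively. *)
Lemma pressure_cl_close N beta lam h : (1 <= N)%nat -> 0 < beta -> exists C, 0 <= C /\
  forall r J, 0 < r -> Rabs (pressure_cl N beta lam h r J - pressure N beta lam h J)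
    <= C * exp (C * (1 + nrm (N * N) J) ^ 2) / r /\
  Rabs (pressure_cl N beta lam h r J - pressure N beta lam h J) <= C * (1 + nrm (N * N) J) ^ 2.
Proof.
  intros HN Hb. destruct (lnZ_quadratic_bound N beta lam h HN Hb) as [C [HC [H0 [H1 H2]]]].
  set (c1 := gexp N (nrm N)).
  assert (Hc1 : 0 <= c1) by (apply gexp_nonneg; auto using nice_nrm, nrm_pos).
  exists (2 * C + c1). split; [lra|]. intros r J Hr.
  set (t2 := (1 + nrm (N * N) J) ^ 2).
  assert (Ht : 0 <= t2) by apply pow2_ge_0.
  specialize (H1 J). specialize (H2 r J (Rlt_le _ _ Hr)). fold t2 in H1, H2.
  assert (Hc1t : 0 <= c1 * t2) by now apply Rmult_le_pos.
  split.
  - assert (HA := exponent_admissible N beta lam h J HN Hb).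
    assert (HAc := exponent_clamp_admissible N beta lam h r J HN (Rlt_le _ _ Hr)).
    (* A common lower bound for both partition functions, on which the Lipschitz constant of [ln]
       depends. *)
    set (m := exp (- (C * t2))).
    assert (Hm : 0 < m) by apply exp_pos.
    assert (L1 : m <= gexp N (fun z => exp (exponent N beta lam h J z))).
    { rewrite <- (exp_lnZ N (exponent N beta lam h J)) by auto. apply exp_mono.
      apply Rabs_le_between in H1. apply H1. }
    assert (L2 : m <= gexp N (fun z => exp (exponent N beta lam h J (cl r z)))).
    { rewrite <- (exp_lnZ N (fun z => exponent N beta lam h J (cl r z))) by auto. apply exp_mono.
      apply Rabs_le_between in H2. apply H2. }
    eapply Rle_trans; [apply (ln_lipschitz m _ _ Hm L2 L1)|].
    assert (D : Rabs (gexp N (fun z => exp (exponent N beta lam h J (cl r z)))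
        - gexp N (fun z => exp (exponent N beta lam h J z))) <= exp (C * t2) / r * c1).
    { assert (NA := adm_nice_exp N _ HA). assert (NAc := adm_nice_exp N _ HAc). cbv beta in NAc.
      rewrite <- gexp_minus by auto. unfold c1. rewrite <- gexp_scal by apply nice_nrm.
      apply gexp_abs_le; auto using nice_minus, nice_scal, nice_nrm.
      (* For [nrm N z <= r] the clamp is inactive. Otherwise [nrm N z / r > 1], as in Markov's
         inequality, and the crude bound on both exponentials suffices. *)
      intros z. destruct (Rle_dec (nrm N z) r) as [Hz|Hz].
      - rewrite exponent_clamp_eq by auto. rewrite Rminus_diag, Rabs_R0.
        apply Rmult_le_pos; [|apply nrm_pos]. left. apply Rdiv_lt_0_compat; auto. apply exp_pos.
      - assert (E1 : exp (exponent N beta lam h J (cl r z)) <= exp (C * t2)) by apply exp_mono, H0.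
        assert (E2 : exp (exponent N beta lam h J z) <= exp (C * t2)) by apply exp_mono, H0.
        pose proof (exp_pos (exponent N beta lam h J (cl r z))). pose proof (exp_pos (exponent N beta lam h J z)).
        apply Rle_trans with (exp (C * t2)); [apply Rabs_le; lra|].
        apply (Rmult_le_reg_r r); auto.
        replace (exp (C * t2) / r * nrm N z * r) with (exp (C * t2) * nrm N z) by (field; lra).
        apply Rmult_le_compat_l; [left; apply exp_pos|lra]. }
    apply Rle_trans with (exp (C * t2) / r * c1 / m).
    { apply Rmult_le_compat_r; auto. left. now apply Rinv_0_lt_compat. }
    unfold m. rewrite exp_Ropp. unfold Rdiv. rewrite Rinv_inv.
    replace (exp (C * t2) * / r * c1 * exp (C * t2)) with (c1 * exp (2 * C * t2) * / r).
    2:{ replace (2 * C * t2) with (C * t2 + C * t2) by ring. rewrite exp_plus. ring. }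
    apply Rmult_le_compat_r; [left; now apply Rinv_0_lt_compat|].
    apply Rmult_le_compat; try lra; [left; apply exp_pos|]. apply exp_mono. lra.
  - unfold Rminus. eapply Rle_trans; [apply Rabs_triang|]. rewrite Rabs_Ropp. lra.
Qed.

Lemma gexp_pressure_cl_limit N beta lam h eps : (1 <= N)%nat -> 0 < beta -> 0 < eps ->
  exists r0, 0 < r0 /\ forall r, r0 <= r ->
    Rabs (gexp (N * N) (pressure_cl N beta lam h r) - gexp (N * N) (pressure N beta lam h)) <= eps.
Proof.
  intros HN Hb He. destruct (pressure_cl_close N beta lam h HN Hb) as [C [HC H]].
  (* The polynomial bound carries an extra factor [1 + nrm (N * N) J], so that where this factor
     exceeds [T] the error is at most [/ T * G J]. *)
  set (G := fun J => C * (1 + nrm (N * N) J) ^ 2 * (1 + nrm (N * N) J)).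
  assert (NG : nice (N * N) G).
  { assert (nice (N * N) (fun J => 1 + nrm (N * N) J)) by (apply nice_plus; auto using nice_const, nice_nrm).
    apply nice_mult; auto. apply nice_scal. now apply nice_pow2. }
  set (c := gexp (N * N) G).
  assert (Hc : 0 <= c).
  { apply gexp_nonneg; auto. intros J. pose proof (nrm_pos (N * N) J).
    apply Rmult_le_pos; [apply Rmult_le_pos; [lra|apply pow2_ge_0]|lra]. }
  (* [T] brings the large-disorder part below [eps / 2]. Then [A] bounds the exponential for
     disorder up to [T], and the threshold on [r] makes [A / r] at most [eps / 2]. *)
  set (T := 2 * (c + 1) / eps).
  assert (HT : 0 < T) by (apply Rdiv_lt_0_compat; lra).
  set (A := C * exp (C * T ^ 2)).
  assert (HA : 0 <= A) by (apply Rmult_le_pos; [lra|left; apply exp_pos]).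
  exists (2 * (A + 1) / eps). split; [apply Rdiv_lt_0_compat; lra|]. intros r Hr.
  assert (Hr0 : 0 < r) by (eapply Rlt_le_trans; [|apply Hr]; apply Rdiv_lt_0_compat; lra).
  assert (Nc := nice_pressure_cl N beta lam h r HN (Rlt_le _ _ Hr0)).
  assert (Np := nice_pressure N beta lam h HN Hb).
  rewrite <- gexp_minus by auto.
  apply Rle_trans with (gexp (N * N) (fun J => A / r + / T * G J)).
  - apply gexp_abs_le; auto using nice_minus, nice_plus, nice_const, nice_scal.
    intros J. destruct (H r J Hr0) as [B1 B2]. pose proof (nrm_pos (N * N) J) as HJ.
    assert (HG : 0 <= / T * G J).
    { apply Rmult_le_pos; [left; now apply Rinv_0_lt_compat|].
      apply Rmult_le_pos; [apply Rmult_le_pos; [lra|apply pow2_ge_0]|lra]. }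
    assert (HAr : 0 <= A / r) by (apply Rmult_le_pos; auto; left; now apply Rinv_0_lt_compat).
    destruct (Rle_dec (1 + nrm (N * N) J) T) as [Hle|Hle].
    + assert (C * exp (C * (1 + nrm (N * N) J) ^ 2) / r <= A / r); [|lra].
      apply Rmult_le_compat_r; [left; now apply Rinv_0_lt_compat|].
      apply Rmult_le_compat_l; auto. apply exp_mono, Rmult_le_compat_l; auto. nra.
    + assert (C * (1 + nrm (N * N) J) ^ 2 <= / T * G J); [|lra].
      apply (Rmult_le_reg_l T); auto. replace (T * (/ T * G J)) with (G J) by (field; lra).
      unfold G. rewrite (Rmult_comm T). apply Rmult_le_compat_l; [|lra].
      apply Rmult_le_pos; [lra|apply pow2_ge_0].
  - rewrite gexp_plus, gexp_scal, gexp_const by auto using nice_const, nice_scal. fold c.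
    assert (A / r <= eps / 2).
    { apply (Rmult_le_reg_r r); auto. unfold Rdiv at 1. rewrite Rmult_assoc, Rinv_l by lra.
      apply (Rmult_le_compat_l eps) in Hr; [|lra].
      replace (eps * (2 * (A + 1) / eps)) with (2 * (A + 1)) in Hr by (field; lra). lra. }
    assert (/ T * c <= eps / 2).
    { apply (Rmult_le_reg_l T); auto. replace (T * (/ T * c)) with c by (field; lra).
      replace (T * (eps / 2)) with (c + 1) by (unfold T; field; lra). lra. }
    lra.
Qed.

Lemma gexp_pressure_superadditive N1 N2 beta lam h : (1 <= N1)%nat -> (1 <= N2)%nat -> 0 < beta ->
  gexp (N1 * N1) (pressure N1 beta lam h) + gexp (N2 * N2) (pressure N2 beta lam h)
  <= gexp ((N1 + N2) * (N1 + N2)) (pressure (N1 + N2) beta lam h).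
Proof.
  intros H1 H2 Hb. apply Rnot_lt_le. intros Hlt. apply Rlt_0_minus in Hlt.
  (* A sixth of the supposed gap: the three approximation errors together use at most half of it. *)
  set (e := (gexp (N1 * N1) (pressure N1 beta lam h) + gexp (N2 * N2) (pressure N2 beta lam h)
    - gexp ((N1 + N2) * (N1 + N2)) (pressure (N1 + N2) beta lam h)) / 6) in *.
  destruct (gexp_pressure_cl_limit N1 beta lam h e H1 Hb ltac:(unfold e; lra)) as [r1 [P1 L1]].
  destruct (gexp_pressure_cl_limit N2 beta lam h e H2 Hb ltac:(unfold e; lra)) as [r2 [P2 L2]].
  destruct (gexp_pressure_cl_limit (N1 + N2) beta lam h e ltac:(lia) Hb ltac:(unfold e; lra)) as [r3 [P3 L3]].
  set (r := r1 + r2 + r3).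
  specialize (L1 r ltac:(unfold r; lra)). specialize (L2 r ltac:(unfold r; lra)). specialize (L3 r ltac:(unfold r; lra)).
  pose proof (pressure_cl_superadditive N1 N2 beta lam h r H1 H2 ltac:(unfold r; lra)).
  apply Rabs_le_between in L1, L2, L3. unfold e in *. lra.
Qed.

Lemma gexp_pressure_upper N beta lam h : (1 <= N)%nat -> 0 < beta ->
  gexp (N * N) (pressure N beta lam h)
  <= INR N * (beta ^ 2 * h ^ 2 + (1 + Rabs lam) + (1 + Rabs lam) ^ 2 / (4 * beta ^ 2)).
Proof.
  intros HN Hb. apply Rle_plus_epsilon. intros e He.
  destruct (gexp_pressure_cl_limit N beta lam h e HN Hb He) as [r [P L]].
  specialize (L r (Rle_refl r)).
  pose proof (pressure_cl_upper N beta lam h r HN Hb ltac:(lra)).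
  apply Rabs_le_between in L. lra.
Qed.

(** * Superadditive sequences *)

Lemma superadditive_limit (x : nat -> R) C :
  (forall n m, (1 <= n)%nat -> (1 <= m)%nat -> INR n * x n + INR m * x m <= INR (n + m) * x (n + m)%nat) ->
  (forall n, (1 <= n)%nat -> x n <= C) ->
  exists L, Un_cv x L /\ is_lub (fun y => exists n, (1 <= n)%nat /\ y = x n) L.
Proof.
  intros Hs Hb.
  destruct (completeness (fun y => exists n, (1 <= n)%nat /\ y = x n)) as [L HL].
  - exists C. intros y [n [Hn ->]]. auto.
  - exists (x 1%nat), 1%nat. split; auto.
  - exists L. split; auto. intros eps He.
    assert (Hm : exists m, (1 <= m)%nat /\ L - eps / 2 < x m).
    { apply NNPP. intros Hno.
      assert (L <= L - eps / 2); [|lra]. apply HL. intros y [n [Hn ->]].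
      apply Rnot_lt_le. intros Hlt. apply Hno. now exists n. }
    destruct Hm as [m [Hm1 Hm2]].
    (* A bound for all remainder terms [INR r * x r] with [r <= m], independent of [n]. *)
    set (K := sumN (S m) (fun r => Rabs (INR r * x r))).
    assert (HK : forall r, (r <= m)%nat -> - K <= INR r * x r).
    { intros r Hr. pose proof (sumN_term_le (S m) (fun r => Rabs (INR r * x r)) r ltac:(lia)
        (fun _ _ => Rabs_pos _)) as T. fold K in T. apply Rabs_le_between in T. lra. }
    assert (Hq : forall q r, (1 <= r)%nat ->
       INR q * (INR m * x m) + INR r * x r <= INR (q * m + r) * x (q * m + r)%nat).
    { induction q; intros r Hr; [simpl; lra|].
      rewrite S_INR. specialize (IHq r Hr).
      pose proof (Hs m (q * m + r)%nat Hm1 ltac:(lia)) as S1.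
      replace (S q * m + r)%nat with (m + (q * m + r))%nat by lia. lra. }
    set (D := INR m * Rabs (x m) + K).
    assert (HD : 0 <= D).
    { apply Rplus_le_le_0_compat; [apply Rmult_le_pos; [apply pos_INR|apply Rabs_pos]|].
      apply sumN_nonneg. intros; apply Rabs_pos. }
    destruct (INR_unbounded (2 * D / eps)) as [n0 Hn0].
    exists (S n0). intros n Hn.
    assert (Hxn : x n <= L) by (apply HL; exists n; split; auto; lia).
    assert (Hn1 : 1 <= INR n) by (apply INR_ge_1; lia).
    assert (Hlow : INR n * x m - D <= INR n * x n).
    { set (q := ((n - 1) / m)%nat). set (r := S ((n - 1) mod m)).
      assert (En : (q * m + r)%nat = n).
      { unfold q, r. pose proof (Nat.div_mod_eq (n - 1) m). lia. }
      assert (Hr : (r <= m)%nat) by (unfold r; pose proof (Nat.mod_upper_bound (n - 1) m ltac:(lia)); lia).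
      pose proof (Hq q r ltac:(unfold r; lia)) as Q. rewrite En in Q.
      specialize (HK r Hr).
      assert (EI : INR q * INR m = INR n - INR r) by (rewrite <- mult_INR, <- En, plus_INR; ring).
      assert (INR r * x m <= INR m * Rabs (x m)).
      { apply Rle_trans with (INR r * Rabs (x m)).
        - apply Rmult_le_compat_l; [apply pos_INR|apply Rle_abs].
        - apply Rmult_le_compat_r; [apply Rabs_pos|now apply le_INR]. }
      replace (INR q * (INR m * x m)) with ((INR q * INR m) * x m) in Q by ring.
      rewrite EI in Q. unfold D. lra. }
    assert (HDn : D < INR n * (eps / 2)).
    { apply le_INR in Hn. rewrite S_INR in Hn.
      apply (Rmult_lt_compat_r (eps / 2)) in Hn0; [|lra].
      replace (2 * D / eps * (eps / 2)) with D in Hn0 by (field; lra).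
      assert (INR n0 * (eps / 2) <= INR n * (eps / 2)) by (apply Rmult_le_compat_r; lra). lra. }
    assert (x m - eps / 2 < x n) by (apply (Rmult_lt_reg_l (INR n)); lra).
    unfold Rdist. apply Rabs_def1; lra.
Qed.

Theorem mainTheorem3 (beta lam h : R) (Hbeta : 0 < beta) :
  exists L : R,
    Un_cv (fun N => A_N N beta lam h) L /\
    is_lub (fun x => exists N : nat, (1 <= N)%nat /\ x = A_N N beta lam h) L.
Proof.
  (* [pressure] unfolds to [ln (Z_N ...)], so only the normalisation has to be cancelled, which
     needs [N >= 1]. *)
  assert (HA : forall N, (1 <= N)%nat -> INR N * A_N N beta lam h = gexp (N * N) (pressure N beta lam h)).
  { intros N HN. apply INR_ge_1 in HN. unfold A_N. rewrite <- Rmult_assoc, Rinv_r, Rmult_1_l by lra.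
    reflexivity. }
  apply (superadditive_limit (fun N => A_N N beta lam h)
    (beta ^ 2 * h ^ 2 + (1 + Rabs lam) + (1 + Rabs lam) ^ 2 / (4 * beta ^ 2))).
  - intros n m Hn Hm. rewrite !HA by lia. now apply gexp_pressure_superadditive.
  - intros n Hn. apply (Rmult_le_reg_l (INR n)); [apply INR_ge_1 in Hn; lra|].
    rewrite HA by auto. now apply gexp_pressure_upper.
Qed.
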